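(* Let $\mathfrak g$ be a subalgebra of $\mathfrak{gl}(V,V_* )$. Then every Levi component of $\mathfrak g$ is a maximal locally semisimple subalgebra of $\mathfrak g$, and any two Levi components of $\mathfrak g$ are isomorphic.
   Context: $V,V_*$: countable-dimensional complex vector spaces with a nondegenerate pairing; $\mathfrak{gl}(V,V_* )$ is the Lie algebra of the associative algebra $V\otimes V_*$ with $(v\otimes w)(v'\otimes w')=\langle v',w\rangle v\otimes w'$. The locally solvable radical $\mathfrak r$ of $\mathfrak g$ is its largest locally solvable ideal. A subalgebra $\mathfrak l\subset\mathfrak g$ is a Levi component if $[\mathfrak g,\mathfrak g]$ is the vector space direct sum of the ideal $\mathfrak r\cap[\mathfrak g,\mathfrak g]$ and the subalgebra $\mathfrak l$. A Lie algebra is locally semisimple if it is a union of nested finite-dimensional semisimple subalgebras. *)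

(* Defs.v *)
From Stdlib Require Import Reals Lra ClassicalEpsilon FunctionalExtensionality PropExtensionality.
From HB Require Import structures.
From mathcomp Require Import all_boot all_algebra.

Record cplx := mkC { Re : R; Im : R }.

Lemma cplx_ext (x y : cplx) : Re x = Re y -> Im x = Im y -> x = y.
Proof. by case: x => a b; case: y => c d /= -> ->. Qed.

Definition cplx_eqb (x y : cplx) : bool :=
  if Req_EM_T (Re x) (Re y) then (if Req_EM_T (Im x) (Im y) then true else false) else false.
Lemma cplx_eqP : Equality.axiom cplx_eqb.
Proof.
move=> x y; rewrite /cplx_eqb.
case: Req_EM_T => h1; last by constructor => e; apply: h1; rewrite e.
case: Req_EM_T => h2; last by constructor => e; apply: h2; rewrite e.
by constructor; apply: cplx_ext.
Qed.
HB.instance Definition _ := hasDecEq.Build cplx cplx_eqP.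

Definition cplx_find (P : pred cplx) (n : nat) : option cplx :=
  match excluded_middle_informative (exists x, P x) with
  | left h => Some (proj1_sig (constructive_indefinite_description _ h))
  | right _ => None end.
Lemma cplx_find_correct P n x : cplx_find P n = Some x -> P x.
Proof.
rewrite /cplx_find; case: excluded_middle_informative => // h [<-].
exact: proj2_sig (constructive_indefinite_description _ h).
Qed.
Lemma cplx_find_complete (P : pred cplx) : (exists x, P x) -> exists n, cplx_find P n.
Proof. by move=> h; exists 0%N; rewrite /cplx_find; case: excluded_middle_informative. Qed.
Lemma cplx_find_ext (P Q : pred cplx) : P =1 Q -> cplx_find P =1 cplx_find Q.
Proof. by move=> /functional_extensionality -> n. Qed.
HB.instance Definition _ := hasChoice.Build cplx cplx_find_correct cplx_find_complete cplx_find_ext.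

Local Open Scope R_scope.
Definition czero := mkC 0 0.
Definition cone := mkC 1 0.
Definition cadd x y := mkC (Re x + Re y) (Im x + Im y).
Definition copp x := mkC (- Re x) (- Im x).
Definition cmul x y := mkC (Re x * Re y - Im x * Im y) (Re x * Im y + Im x * Re y).
Definition cinv x := let n := Re x * Re x + Im x * Im x in mkC (Re x / n) (- Im x / n).

Lemma caddA : associative cadd.
Proof. by move=> x y z; apply: cplx_ext => /=; ring. Qed.
Lemma caddC : commutative cadd.
Proof. by move=> x y; apply: cplx_ext => /=; ring. Qed.
Lemma cadd0 : left_id czero cadd.
Proof. by move=> x; apply: cplx_ext => /=; ring. Qed.
Lemma caddN : left_inverse czero copp cadd.
Proof. by move=> x; apply: cplx_ext => /=; ring. Qed.
HB.instance Definition _ := GRing.isZmodule.Build cplx caddA caddC cadd0 caddN.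

Lemma cmulA : associative cmul.
Proof. by move=> x y z; apply: cplx_ext => /=; ring. Qed.
Lemma cmulC : commutative cmul.
Proof. by move=> x y; apply: cplx_ext => /=; ring. Qed.
Lemma cmul1 : left_id cone cmul.
Proof. by move=> x; apply: cplx_ext => /=; ring. Qed.
Lemma cmulDl : left_distributive cmul cadd.
Proof. by move=> x y z; apply: cplx_ext => /=; ring. Qed.
Lemma cone_neq0 : cone != czero.
Proof. by apply/eqP => -[]; lra. Qed.
HB.instance Definition _ := GRing.Zmodule_isComNzRing.Build cplx cmulA cmulC cmul1 cmulDl cone_neq0.

Lemma cmulV (x : cplx) : x != 0%R -> cmul (cinv x) x = cone.
Proof.
case: x => a b /eqP hx; rewrite /cinv /cmul /=.
have hn : a * a + b * b <> 0.
  move=> h; apply: hx; apply: cplx_ext => /=; nra.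
by apply: cplx_ext => /=; field.
Qed.
Lemma cinv0 : cinv 0%R = 0%R.
Proof. by apply: cplx_ext => /=; rewrite /Rdiv ?Rmult_0_l ?Rmult_0_r ?Ropp_0 ?Rmult_0_l. Qed.
HB.instance Definition _ := GRing.ComNzRing_isField.Build cplx cmulV cinv0.

Local Close Scope R_scope.

Set Implicit Arguments.
Unset Strict Implicit.
Unset Printing Implicit Defensive.
Import GRing.Theory.
Local Open Scope ring_scope.

(** countable dimension: V is spanned by a countable family of vectors
    (equivalently, V has a finite or countably infinite basis). *)
Definition countable_dim (V : lmodType cplx) : Prop :=
  exists e : nat -> V, forall v : V,
    exists (n : nat) (c : nat -> cplx), v = \sum_(i < n) c i *: e i.

Definition bilinear_pairing (V W : lmodType cplx) (p : V -> W -> cplx) : Prop :=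
  (forall (a : cplx) (v v' : V) (w : W), p (a *: v + v') w = a * p v w + p v' w) /\
  (forall (a : cplx) (v : V) (w w' : W), p v (a *: w + w') = a * p v w + p v w').

Definition nondegenerate_pairing (V W : lmodType cplx) (p : V -> W -> cplx) : Prop :=
  (forall v : V, (forall w : W, p v w = 0) -> v = 0) /\
  (forall w : W, (forall v : V, p v w = 0) -> w = 0).

Section Ops.
Variable V : lmodType cplx.
Definition opzero : V -> V := fun _ => 0.
Definition opadd (f g : V -> V) : V -> V := fun x => f x + g x.
Definition opscale (c : cplx) (f : V -> V) : V -> V := fun x => c *: f x.
Definition opbr (f g : V -> V) : V -> V := fun x => f (g x) - g (f x).
Definition opsum (s : seq (V -> V)) : V -> V := foldr opadd opzero s.
End Ops.

Definition opset (V : lmodType cplx) := (V -> V) -> Prop.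

(** gl(V,V_* ): the image of V (x) V_* acting on V by (v (x) w)(x) = <x,w> v.
    (This map is injective since the pairing is nondegenerate, and the
    associative product (v(x)w)(v'(x)w') = <v',w> v(x)w' is composition.) *)
Definition gl (V W : lmodType cplx) (p : V -> W -> cplx) : opset V :=
  fun f => exists s : seq (V * W),
    forall x : V, f x = \sum_(vw <- s) p x vw.2 *: vw.1.

Section LieNotions.
Variable V : lmodType cplx.
Implicit Types S T G I l r : opset V.

Definition incl S T : Prop := forall f, S f -> T f.

Definition subspace S : Prop :=
  S (@opzero V) /\ (forall f g, S f -> S g -> S (opadd f g)) /\
  (forall c f, S f -> S (opscale c f)).

Definition subalgebra S : Prop :=
  subspace S /\ (forall f g, S f -> S g -> S (opbr f g)).

Definition ideal I G : Prop :=
  subspace I /\ incl I G /\ (forall x y, G x -> I y -> I (opbr x y)).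

Definition span S : opset V :=
  fun f => exists s : seq (cplx * (V -> V)),
    (forall q, List.In q s -> S q.2) /\
    f = opsum [seq opscale q.1 q.2 | q <- s].

Definition fin_dim S : Prop :=
  exists l : seq (V -> V), (forall f, List.In f l -> S f) /\
    (forall f, S f -> span (fun g => List.In g l) f).

Definition derived S : opset V :=
  span (fun h => exists a b, S a /\ S b /\ h = opbr a b).

Fixpoint derived_series (n : nat) S : opset V :=
  if n is n'.+1 then derived (derived_series n' S) else S.

Definition solvable S : Prop :=
  exists n, forall f, derived_series n S f -> f = @opzero V.

Definition gen (l : seq (V -> V)) : opset V :=
  fun f => forall T, subalgebra T -> (forall g, List.In g l -> T g) -> T f.

Definition locally_solvable S : Prop :=
  forall l : seq (V -> V), (forall g, List.In g l -> S g) -> solvable (gen l).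

Definition semisimple S : Prop :=
  forall I, ideal I S -> solvable I -> forall f, I f -> f = @opzero V.

Definition locsolv_radical G r : Prop :=
  ideal r G /\ locally_solvable r /\
  (forall I, ideal I G -> locally_solvable I -> incl I r).

Definition levi_component G l : Prop :=
  subalgebra l /\ incl l G /\
  exists r, locsolv_radical G r /\
    (forall f, derived G f <->
       exists a b, (r a /\ derived G a) /\ l b /\ f = opadd a b) /\
    (forall f, r f -> derived G f -> l f -> f = @opzero V).

Definition locally_semisimple S : Prop :=
  exists (J : Type) (F : J -> opset V),
    (forall j, subalgebra (F j) /\ fin_dim (F j) /\ semisimple (F j)) /\
    (forall i j, incl (F i) (F j) \/ incl (F j) (F i)) /\
    (forall f, S f <-> exists j, F j f).

Definition maximal_locally_semisimple G l : Prop :=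
  subalgebra l /\ incl l G /\ locally_semisimple l /\
  (forall m, subalgebra m -> incl m G -> locally_semisimple m ->
     incl l m -> incl m l).

Definition lie_isomorphic S T : Prop :=
  exists phi : (V -> V) -> (V -> V),
    (forall f, S f -> T (phi f)) /\
    (forall f g, S f -> S g -> phi (opadd f g) = opadd (phi f) (phi g)) /\
    (forall c f, S f -> phi (opscale c f) = opscale c (phi f)) /\
    (forall f g, S f -> S g -> phi (opbr f g) = opbr (phi f) (phi g)) /\
    (forall f g, S f -> S g -> phi f = phi g -> f = g) /\
    (forall h, T h -> exists f, S f /\ phi f = h).

End LieNotions.

(* Main.v *)
Require Import Defs.
From Stdlib Require Import Reals Lra Classical ClassicalEpsilon FunctionalExtensionality PropExtensionality Ncring Ncring_tac.
From HB Require Import structures.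
From mathcomp Require Import all_boot all_algebra.
From mathcomp Require Import Rstruct complex.

(* Write g' = [g,g] and let r be the radical. Any two Levi components are isomorphic to
   g' / (r cap g'). A semisimple finite-dimensional algebra is perfect, so a locally semisimple
   m containing a Levi component l lies in g'; the r-part of an element of m lies in m, hence in a
   solvable ideal of a finite-dimensional semisimple subalgebra of m, and vanishes. This gives
   maximality.

   The substance is that l is locally semisimple: every finite M in l lies in a finite-dimensional
   semisimple subalgebra of l, and countable dimension turns these into a chain. Let N be a large
   finite-dimensional piece of g, represented on the double of a finite-dimensional model, where
   an antiautomorphism * of the matrix algebra satisfies x* = -x on N. Let A be the associative
   algebra generated by N, A^1 the same with the unit, and J the radical of its trace form.
   A trace tr (a u) with a in the span of the v_i (x) w_j sees u only through finitely many numbers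
   p (u v_i) w_j, so finitely many words u decide whether a is orthogonal to everything generated
   by g. Hence N can be chosen so that the elements of J lying in M + M A^1 M belong to the space J0
   of those orthogonal to the whole algebra of g; elements of g' in J0 lie in r. The two-sided ideal
   T = A^1 M A^1 then satisfies T J T in J0, so that for the Lie algebra N' = N cap T cap [N,N] the
   nilpotent part is two-step modulo J0. Whitehead's lemma, proved with Casimir elements of the trace
   form, splits it off, and a correction by an idempotent together with * produces a subalgebra S
   containing M that is semisimple modulo J0. Projecting S to l along r gives the required
   semisimple subalgebra. *)

Set Implicit Arguments.
Unset Strict Implicit.
Unset Printing Implicit Defensive.
Import Defs GRing.Theory.
Local Open Scope ring_scope.

(** * The complex numbers: split polynomials, characteristic zero, sums of squared moduli *)

Local Notation K := cplx.
Delimit Scope R_scope with coqR.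

(** The radical J is computed from N alone, and only elements orthogonal to words in all of g are
    shown to lie in r; so the splitting has to be exact modulo J0, not merely modulo J. Relative to
    an approximate unit h of the algebra of N', an element x has four corners. Whitehead's lemma
    repairs (1 - h) x h at the price of subtracting some nilpotent v from x, and the opposite corner
    h x (1 - h) would ask for a second, unrelated v. If x is skew under the antiautomorphism, the
    condition on one corner is the image of the condition on the other, and a single v serves both.
    This is the reason for the double: the action on V and its dual makes every linear Lie algebra
    skew. The corner (1 - h) x (1 - h) is not reached by cohomology at all; what remains of it
    disappears after taking brackets twice, and nothing is lost because N' is perfect modulo its
    nilpotent part. Finally M has to survive the correction, so the unit is built from a left unit
    of the right ideal generated by M, and the correction is normalized to vanish on M modulo J0. *)

Definition to_Ri (x : K) : R[i] := (Re x +i* Im x)%C.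
Definition of_Ri (x : R[i]) : K := mkC (complex.Re x) (complex.Im x).

Lemma to_RiK : cancel to_Ri of_Ri.
Proof. by case. Qed.
Lemma of_RiK : cancel of_Ri to_Ri.
Proof. by case. Qed.

Lemma of_Ri_zmod : zmod_morphism of_Ri.
Proof. by move=> [a b] [c d]; apply: cplx_ext. Qed.
Lemma of_Ri_monoid : monoid_morphism of_Ri.
Proof. by split=> // -[a b] [c d]; apply: cplx_ext. Qed.
HB.instance Definition _ := GRing.isZmodMorphism.Build R[i] K of_Ri of_Ri_zmod.
HB.instance Definition _ := GRing.isMonoidMorphism.Build R[i] K of_Ri of_Ri_monoid.

Lemma to_Ri_zmod : zmod_morphism to_Ri.
Proof. by move=> x y; apply: (can_inj of_RiK); rewrite raddfB /= !to_RiK. Qed.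
Lemma to_Ri_monoid : monoid_morphism to_Ri.
Proof. by split=> [|x y]; apply: (can_inj of_RiK); rewrite ?to_RiK ?rmorph1 // rmorphM /= !to_RiK. Qed.
HB.instance Definition _ := GRing.isZmodMorphism.Build K R[i] to_Ri to_Ri_zmod.
HB.instance Definition _ := GRing.isMonoidMorphism.Build K R[i] to_Ri to_Ri_monoid.

(** Algebraic closedness is transported from [R[i]] along the ring isomorphism given by [to_Ri] and
    [of_Ri]. *)
Lemma cplx_poly_split (p : {poly K}) :
  exists rs : seq K, p = lead_coef p *: \prod_(z <- rs) ('X - z%:P).
Proof.
have [rs e] := closed_field_poly_normal (map_poly to_Ri p).
exists (map of_Ri rs).
have mapK : map_poly of_Ri (map_poly to_Ri p) = p.
  by rewrite -map_poly_comp map_poly_id // => x _ /=; rewrite to_RiK.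
rewrite -{1}mapK e linearZ /= lead_coef_map to_RiK big_map; congr (_ *: _).
by rewrite rmorph_prod; apply: eq_bigr => z _; rewrite /= map_polyXsubC.
Qed.

Lemma Re_natr k : Re (k%:R : K) = INR k.
Proof.
by elim: k => // k ih; rewrite S_INR -ih -[k.+1]addn1 natrD.
Qed.

Lemma cplx_char0 k : (k%:R == 0 :> K) = (k == 0)%N.
Proof.
apply/eqP/eqP => [h|->//].
by have := Re_natr k; rewrite h /= => h1; apply/INR_eq; rewrite -h1.
Qed.

Definition conjc (x : K) : K := mkC (Re x) (- Im x).

Lemma conjcB : {morph conjc : x y / x - y}.
Proof. by move=> x y; apply: cplx_ext => /=; ring. Qed.

(** A vanishing sum of nonnegative reals has vanishing terms. In Cartan's criterion [F] runs over
    eigenvalues and [w] gives the ranks of the spectral projections. *)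
Lemma sum_normc_eq0 (I : eqType) (r : seq I) (F : I -> K) (w : I -> nat) :
  \sum_(i <- r) (F i * conjc (F i)) *+ w i = 0 ->
  forall i, i \in r -> (0 < w i)%N -> F i = 0.
Proof.
have sq z : Re (z * conjc z) = (Re z * Re z + Im z * Im z)%coqR by rewrite /=; ring.
have ReM z k : Re (z *+ k) = (Re z * INR k)%coqR.
  elim: k => [|k ih]; first by rewrite mulr0n /= Rmult_0_r.
  by rewrite mulrS S_INR /= ih; ring.
have Resum (s : seq I) : (0 <= Re (\sum_(i <- s) (F i * conjc (F i)) *+ w i))%coqR.
  elim: s => [|a s ih]; first by rewrite big_nil; apply: Rle_refl.
  rewrite big_cons [Re _]/=; apply: Rplus_le_le_0_compat => //.
  rewrite ReM sq; apply: Rmult_le_pos (pos_INR _); nra.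
move=> e i ir wi.
have {e} := congr1 Re e; rewrite (perm_big _ (perm_to_rem ir)) big_cons [Re (_ + _)]/= [Re 0]/=.
move=> e; have h := Resum (rem i r); move: e; rewrite ReM sq => e.
have wp : (0 < INR (w i))%coqR by apply: lt_0_INR; apply/ltP.
have h2 : (Re (F i) * Re (F i) + Im (F i) * Im (F i) = 0)%coqR.
  have : (0 <= Re (F i) * Re (F i) + Im (F i) * Im (F i))%coqR by nra.
  set v := Re (\sum_(_ <- _) _) in e h; set u := (Re (F i) * _ + _)%coqR in e *; move=> hu; nra.
by apply: cplx_ext; rewrite /=; nra.
Qed.

From mathcomp Require Import ring zify.
Import Defs GRing.Theory.

(** * Subspaces and idempotents of matrix algebras *)

Section NonCommutativeRing.
Variable n : nat.
Global Instance mx_ring_ops : @Ring_ops 'M[K]_n 0 1 +%R *%R (fun x y => x - y) (@GRing.opp _) eq := {}.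
Global Instance mx_ring : Ring (Ro := mx_ring_ops).
Proof.
constructor=> //.
- exact: eq_equivalence.
- by move=> ? ? -> ? ? ->.
- by move=> ? ? -> ? ? ->.
- by move=> ? ? -> ? ? ->.
- by move=> ? ? ->.
- exact: add0r.
- exact: addrC.
- exact: addrA.
- exact: mul1r.
- exact: mulr1.
- exact: mulrA.
- exact: mulrDl.
- by move=> x y z; exact: mulrDr.
- exact: subrr.
Qed.
End NonCommutativeRing.

Lemma dep_choice (A B : Type) (P : A -> B -> Prop) :
  (forall a, exists b, P a b) -> exists f, forall a, P a (f a).
Proof.
move=> h; exists (fun a => proj1_sig (constructive_indefinite_description _ (h a))) => a.
exact: proj2_sig (constructive_indefinite_description _ (h a)).
Qed.

(** Every later choice of an object of maximal dimension or rank goes through this lemma; excluded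
    middle makes [C] boolean. *)
Lemma bounded_max (C : nat -> Prop) b : (exists k, C k) -> (forall k, C k -> (k <= b)%N) ->
  exists m, C m /\ forall k, C k -> (k <= m)%N.
Proof.
move=> ex ub; pose Cb k : bool := if excluded_middle_informative (C k) then true else false.
have CbP k : reflect (C k) (Cb k) by rewrite /Cb; case: excluded_middle_informative => h; constructor.
have ex' : exists k, Cb k by case: ex => k /CbP; exists k.
have ub' k : Cb k -> (k <= b)%N by move/CbP/ub.
by case: (ex_maxnP ex' ub') => m /CbP Cm hm; exists m; split=> // k /CbP/hm.
Qed.

Section Subspaces.
Variable L : lmodType K.
Implicit Types P Q : L -> Prop.

Definition sp P := P 0 /\ forall a x y, P x -> P y -> P (a *: x + y).

Lemma sp0 P : sp P -> P 0. Proof. by case. Qed.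
Lemma spZ P a x : sp P -> P x -> P (a *: x).
Proof. by case=> P0 h Px; rewrite -[_ *: _]addr0; apply: h. Qed.
Lemma spD P x y : sp P -> P x -> P y -> P (x + y).
Proof. by case=> P0 h Px; rewrite -[x]scale1r; apply: h. Qed.
Lemma spN P x : sp P -> P x -> P (- x).
Proof. by move=> hP Px; rewrite -scaleN1r; apply: spZ. Qed.
Lemma spB P x y : sp P -> P x -> P y -> P (x - y).
Proof. by move=> hP Px Py; apply: spD => //; apply: spN. Qed.
Lemma sp_sum P I (r : seq I) (C : pred I) (F : I -> L) :
  sp P -> (forall i, C i -> P (F i)) -> P (\sum_(i <- r | C i) F i).
Proof.
by move=> hP h; elim/big_ind: _ => //; [exact: sp0 | move=> *; exact: spD].
Qed.
Lemma spBC P x y : sp P -> P (x - y) -> P (y - x).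
Proof. by move=> hP h; rewrite -opprB; apply: spN. Qed.
Lemma sp_of_sub P x y : sp P -> P (x - y) -> P y -> P x.
Proof. by move=> hP h Py; rewrite -[x](subrK y); apply: spD. Qed.
Lemma sp_cap P Q : sp P -> sp Q -> sp (fun x => P x /\ Q x).
Proof. by move=> [P0 hP] [Q0 hQ]; split=> // a x y [? ?] [? ?]; split; auto. Qed.

(** Encoded as an intersection, so that applying a membership hypothesis to a subspace [Q] is
    already the induction principle; [alg] below follows the same pattern. *)
Definition lspan P : L -> Prop :=
  fun x => forall Q, sp Q -> (forall y, P y -> Q y) -> Q x.
Lemma lspan_sp P : sp (lspan P).
Proof.
split=> [Q hQ _|a x y hx hy Q hQ h]; first exact: sp0.
by apply: spD => //; [apply: spZ => //; apply: hx | apply: hy].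
Qed.
Lemma lspan_in P x : P x -> lspan P x. Proof. by move=> h Q _; apply. Qed.

Definition sumsp P Q : L -> Prop := fun z => exists x y, P x /\ Q y /\ z = x + y.
Lemma sumsp_sp P Q : sp P -> sp Q -> sp (sumsp P Q).
Proof.
move=> hP hQ; split; first by exists 0, 0; rewrite addr0; split; [|split] => //; exact: sp0.
move=> a _ _ [x [y [Px [Qy ->]]]] [x' [y' [Px' [Qy' ->]]]].
exists (a *: x + x'), (a *: y + y'); split; first by case: hP => _; apply.
by split; [case: hQ => _; apply | rewrite scalerDr addrACA].
Qed.
Lemma sumspl P Q x : sp Q -> P x -> sumsp P Q x.
Proof. by move=> hQ Px; exists x, 0; rewrite addr0; split=> //; split=> //; apply: sp0. Qed.
Lemma sumspr P Q x : sp P -> Q x -> sumsp P Q x.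
Proof. by move=> hP Qx; exists 0, x; rewrite add0r; split=> //; apply: sp0. Qed.
End Subspaces.

(** A subspace of maximal dimension inside [P] absorbs every element of [P]. This gives a predicate
    a basis. *)
Lemma sp_vspace (L : vectType K) (P : L -> Prop) : sp P ->
  exists U : {vspace L}, forall x, x \in U <-> P x.
Proof.
move=> hP.
pose C k := exists U : {vspace L}, (forall x, x \in U -> P x) /\ \dim U = k.
have [||m [[U [hU dU]] hmax]] := @bounded_max C (\dim {: L}).
- exists 0%N; exists 0%VS; split; last exact: dimv0.
  by move=> x; rewrite memv0 => /eqP ->; apply: sp0.
- by move=> k [U [_ <-]]; apply: dimvS; apply: subvf.
exists U => x; split=> [|Px]; first exact: hU.
have : C (\dim (U + <[x]>)%VS).
  exists (U + <[x]>)%VS; split=> // y.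
  by move=> /memv_addP [u hu [v /vlineP [a ->] ->]]; apply: spD => //; [apply: hU | apply: spZ].
move=> /hmax; rewrite -dU => hle.
have e : U = (U + <[x]>)%VS by apply/eqP; rewrite eqEdim addvSl.
by rewrite e; apply: (subvP (addvSr _ _)); apply: memv_line.
Qed.

Section Matrices.
Variable n : nat.
Local Notation E := 'M[K]_n.
Implicit Types (x y z e f : E) (P Q R N I F : E -> Prop).

Lemma mxZl (a : K) x y : (a *: x) * y = a *: (x * y).
Proof. by rewrite [RHS]scalemxAl. Qed.
Lemma mxZr (a : K) x y : x * (a *: y) = a *: (x * y).
Proof. by rewrite [RHS]scalemxAr. Qed.

Lemma mxSl (a : K) x : a%:M * x = a *: x.
Proof. exact: mul_scalar_mx. Qed.
Lemma mxSr (a : K) x : x * a%:M = a *: x.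
Proof. exact: mul_mx_scalar. Qed.

Definition mxnil x := exists k, x ^+ k = 0.
Definition mulclosed R := forall x y, R x -> R y -> R (x * y).

Lemma mcM R x y : mulclosed R -> R x -> R y -> R (x * y).
Proof. by move=> h; apply: h. Qed.

Lemma mxtr_mulC x y : \tr (x * y) = \tr (y * x).
Proof. exact: mxtrace_mulC. Qed.
End Matrices.

(** All eigenvalues are zero, so the characteristic polynomial is a power of X, and its subleading
    coefficient is minus the trace. *)
Lemma trace_nilp n (x : 'M[K]_n) : mxnil x -> \tr x = 0.
Proof.
case: n x => [|n] x [k hk]; first by rewrite /mxtrace big_ord0.
have [rs e] := cplx_poly_split (char_poly x).
have m := char_poly_monic x; rewrite (monicP m) scale1r in e.
have all0 z : z \in rs -> z = 0.
  move=> zr; have : root (char_poly x) z by rewrite e root_prod_XsubC.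
  rewrite -eigenvalue_root_char => /eigenvalueP [v hv vn0].
  have hj j : v *m (x ^+ j) = z ^+ j *: v.
    elim: j => [|j ih]; first by rewrite expr0 scale1r mulmx1.
    by rewrite exprS -mulmxE mulmxA hv -scalemxAl ih scalerA -exprS.
  have := hj k; rewrite hk mulmx0 => /esym/eqP; rewrite scaler_eq0 (negbTE vn0) orbF.
  by rewrite expf_eq0 => /andP [_ /eqP].
have e2 : char_poly x = 'X^(size rs).
  rewrite e -(size_map (fun z => 'X - z%:P) rs) -(big_map (fun z => 'X - z%:P) xpredT id).
  elim: rs all0 {e} => [|z rs ih] h; first by rewrite big_nil.
  rewrite /= big_cons ih; last by move=> y yr; apply: h; rewrite inE yr orbT.
  by rewrite (h z) ?inE ?eqxx // subr0 -exprS.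
have sz : size rs = n.+1.
  by have := size_char_poly x; rewrite e2 size_polyXn => -[].
have := char_poly_trace x (ltn0Sn n); rewrite e2 sz coefXn /= ltn_eqF // => /esym/eqP.
by rewrite oppr_eq0 => /eqP.
Qed.

(** Idempotence makes the reversed product [row_base f *m col_base f] of the rank factorization an
    identity matrix. *)
Lemma trace_idem n (f : 'M[K]_n) : f * f = f -> \tr f = (\rank f)%:R.
Proof.
move=> ff; have e : row_base f *m col_base f = 1%:M.
  have h : col_base f *m (row_base f *m col_base f) = col_base f.
    apply: (row_free_inj (row_base_free f)).
    by rewrite mulmxA mulmx_base -mulmxA mulmx_base.
  have /row_fullP [B hB] := col_base_full f.
  by have := congr1 (mulmx B) h; rewrite mulmxA hB mul1mx.
by rewrite -{1}(mulmx_base f) mxtrace_mulC e mxtrace1.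
Qed.

Lemma trace_idem_eq0 n (f : 'M[K]_n) : f * f = f -> \tr f = 0 -> f = 0.
Proof.
move=> ff; rewrite trace_idem // => /eqP; rewrite cplx_char0 mxrank_eq0 => /eqP //.
Qed.

Lemma Bezout_eq1 (p q : {poly K}) : coprimep p q -> exists u v, u * p + v * q = 1.
Proof.
move=> /Bezout_coprimepP [[u v] /= h].
have /eqpP [[a b] /= /andP [an bn] e'] := h; move: e'.
move=> e; exists ((b^-1 * a) *: u), ((b^-1 * a) *: v); move: an bn e => _ bn e.
rewrite -!scalerAl -scalerDr -scalerA.
by rewrite e alg_polyC -mul_polyC -polyCM mulVf.
Qed.

(* The spectral projection onto a nonzero eigenvalue is a polynomial without constant term in x. *)
Lemma spectral_idem n (x : 'M[K]_n) : ~ mxnil x -> exists (l : K) (f : 'M[K]_n),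
  [/\ l != 0, f != 0, f * f = f, mxnil (x * f - l *: f) &
      forall R, sp R -> mulclosed R -> R x -> R f].
Proof.
case: n x => [|n] x nx; first by case: nx; exists 0%N; rewrite expr0 [1]flatmx0.
have [rs e] := cplx_poly_split (char_poly x).
have m := char_poly_monic x; rewrite (monicP m) scale1r in e.
have [l lr ln0] : exists2 l, l \in rs & l != 0.
  apply: NNPP => h; apply: nx; exists (size rs).
  suff e2 : char_poly x = 'X^(size rs).
    by have := Cayley_Hamilton x; rewrite e2 rmorphXn /= horner_mx_X.
  rewrite e; have : forall z, z \in rs -> z = 0.
    by move=> z zr; apply/eqP; apply: contraT => zn; case: h; exists z.
  elim: rs {e h} => [|z s ih] h; first by rewrite big_nil.
  rewrite /= big_cons ih; last by move=> y yr; apply: h; rewrite inE yr orbT.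
  by rewrite (h z) ?inE ?eqxx // subr0 -exprS.
have rt : root (char_poly x) l by rewrite e root_prod_XsubC.
have [[|k] [q]] := multiplicity_XsubC (char_poly x) l; rewrite monic_neq0 //= => nr e2.
  by move: nr; rewrite expr0 mulr1 in e2; rewrite -e2 rt.
set c := ('X - l%:P) ^+ k.+1 in e2.
(* The extra factor X, coprime to [c] because l is nonzero, is what keeps the polynomial defining f
   free of a constant term. *)
have cop : coprimep c ('X * q).
  by rewrite coprimep_expl // coprimepMr coprimepX (coprimep_sym _ q) coprimep_XsubC nr andbT rootE !hornerE oppr_eq0.
have [u [v uv]] := Bezout_eq1 cop.
pose H := horner_mx x.
have HM : {morph H : p q / p * q} by move=> ? ?; rewrite /H rmorphM.
have cq0 : H (c * q) = 0 by rewrite mulrC -e2; apply: Cayley_Hamilton.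
pose f := H (v * ('X * q)).
have f1 : 1 - f = H (u * c).
  by rewrite /f -[1](rmorph1 H) -uv -rmorphB addrK.
have ff : f * f = f.
  apply/esym/eqP; rewrite -subr_eq0 -{1}[f]mulr1 -mulrBr f1 /f -HM.
  have -> : v * ('X * q) * (u * c) = (v * 'X * u) * (c * q) by ring.
  by rewrite HM cq0 mulr0.
exists l, f; split=> //.
- apply/eqP => f0; move: f1; rewrite f0 subr0 mulrC HM => f1.
  move: rt; rewrite -eigenvalue_root_char => /eigenvalueP [w hw wn0].
  have hc : w *m H c = 0.
    rewrite /c exprS HM /H rmorphB /= horner_mx_X horner_mx_C -mulmxE mulmxA mulmxBr hw mul_mx_scalar subrr.
    by rewrite mul0mx.
  by move/eqP: wn0; apply; rewrite -[w]mulmx1 [1%:M]f1 -mulmxE mulmxA hc mul0mx.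
- exists k.+1.
  have -> : x * f - l *: f = H ('X - l%:P) * f.
    by rewrite /H rmorphB /= horner_mx_X horner_mx_C mulrBl -mul_scalar_mx.
  rewrite exprMn_comm; last by rewrite /GRing.comm /f -!HM mulrC.
  have -> : f ^+ k.+1 = f by elim: k {c e2 cop uv cq0 f1} => // j ih; rewrite exprS ih.
  rewrite -rmorphXn /= -/c /f -HM.
  have -> : c * (v * ('X * q)) = (v * 'X) * (c * q) by ring.
  by rewrite HM cq0 mulr0.
- move=> R hR hm Rx.
  have hp p : R (H (p * 'X)).
    elim/poly_ind: p => [|p c' ih]; first by rewrite mul0r /H rmorph0; apply: sp0.
    have -> : H ((p * 'X + c'%:P) * 'X) = H (p * 'X) * x + c' *: x.
      by rewrite HM /H rmorphD /= horner_mx_C horner_mx_X mulrDl -mul_scalar_mx.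
    by apply: spD => //; [apply: hm | apply: spZ].
  by rewrite /f ['X * q]mulrC mulrA; apply: hp.
Qed.

Section Idempotents.
Variable n : nat.
Local Notation E := 'M[K]_n.
Implicit Types (x y z e f : E) (P Q R N I F : E -> Prop).

(** Take e of maximal rank. If x - e x were not nilpotent, its spectral idempotent f would satisfy e
    f = 0, and e + f - f e would be an idempotent of larger rank; ranks are compared through
    traces. *)
Lemma idem_mod_nil F : sp F -> mulclosed F ->
  exists e, [/\ F e, e * e = e & forall x, F x -> mxnil (x - e * x)].
Proof.
move=> hF hm.
pose C k := exists e, [/\ F e, e * e = e & \rank e = k].
have [||m [[e [Fe ee rk]] hmax]] := @bounded_max C n.
- by exists 0%N; exists 0; rewrite mulr0 mxrank0; split=> //; apply: sp0.
- by move=> k [e [_ _ <-]]; apply: rank_leq_row.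
exists e; split=> // x Fx; apply: NNPP => nx.
have [l [f [ln0 fn0 ff _ hf]]] := spectral_idem nx.
have [z [Fz fz]] : exists z, F z /\ f = z - e * z.
  apply: (hf (fun f => exists z, F z /\ f = z - e * z)); last by exists x.
    split; first by exists 0; rewrite mulr0 subrr; split=> //; apply: sp0.
    move=> a _ _ [y [Fy ->]] [y' [Fy' ->]]; exists (a *: y + y').
    split; first by case: hF => _; apply.
    by rewrite mulrDr mxZr opprD addrACA scalerBr.
  move=> _ _ [y [Fy ->]] [y' [Fy' ->]]; exists (y * (y' - e * y')); split.
    by apply: mcM => //; apply: spB => //; apply: mcM.
  by rewrite mulrBl mulrA.
have ef : e * f = 0 by rewrite fz mulrBr mulrA ee subrr.
have Ff : F f by rewrite fz; apply: spB => //; apply: mcM.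
pose e' := e + f - f * e.
have ee' : e' * e' = e'.
  have -> : e' * e' = e * e + e * f - e * f * e + f * e + f * f - f * f * e - f * (e * e) - f * (e * f) + f * (e * f) * e.
    by rewrite /e'; non_commutative_ring.
  rewrite ee ff ef mul0r mulr0 mul0r /e'; non_commutative_ring.
have : C (\rank e').
  by exists e'; split=> //; apply: spB; [|apply: spD|apply: mcM].
move/hmax; rewrite -rk leqNgt; case/negP.
have te : \tr e' = \tr e + \tr f.
  by rewrite /e' linearB linearD /= mxtr_mulC ef mxtrace0 subr0.
move: te; rewrite !trace_idem // -natrD => /eqP; rewrite -subr_eq0.
have : (\rank e < \rank e + \rank f)%N by rewrite -ltn_psubLR ?subnn ?lt0n mxrank_eq0.
move=> h1 h2; rewrite (_ : \rank e' = \rank e + \rank f)%N //.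
by apply/eqP; move: h2; case: (leqP (\rank e') (\rank e + \rank f)) => hl;
  [rewrite -opprB oppr_eq0 -natrB // cplx_char0 subn_eq0 => h; rewrite eqn_leq hl h
  |rewrite -natrB 1?ltnW // cplx_char0 subn_eq0 leqNgt hl].
Qed.

(** The radical of the trace form of R. For an associative algebra it is a two-sided ideal of
    nilpotent matrices and takes the place of the Jacobson radical. *)
Definition trrad R x := R x /\ forall y, R y -> \tr (x * y) = 0.

Lemma trrad_sp R : sp R -> sp (trrad R).
Proof.
move=> hR; split; first by split; [exact: sp0 | move=> y _; rewrite mul0r mxtrace0].
move=> a x y [Rx hx] [Ry hy]; split; first by case: hR => _; apply.
by move=> z Rz; rewrite mulrDl mxZl linearD linearZ /= hx // hy // mulr0 addr0.
Qed.
Lemma trrad_mull R x y : mulclosed R -> R x -> trrad R y -> trrad R (x * y).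
Proof.
move=> hm Rx [Ry hy]; split; first exact: hm.
by move=> z Rz; rewrite mxtr_mulC mulrA mxtr_mulC; apply: hy; apply: hm.
Qed.
Lemma trrad_mulr R x y : mulclosed R -> trrad R x -> R y -> trrad R (x * y).
Proof.
move=> hm [Rx hx] Ry; split; first exact: hm.
by move=> z Rz; rewrite -mulrA; apply: hx; apply: hm.
Qed.
(** A non-nilpotent element would put a nonzero idempotent f into the radical, although tr (f f) =
    tr f is the rank of f. *)
Lemma trrad_nilp R x : sp R -> mulclosed R -> trrad R x -> mxnil x.
Proof.
move=> hR hm hx; apply: NNPP => nx.
have [l [f [_ fn0 ff _ hf]]] := spectral_idem nx.
have [Rf h] : trrad R f.
  apply: hf => //; first exact: trrad_sp.
  by move=> y z hy [Rz _]; apply: trrad_mulr.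
by move/eqP: fn0; apply; apply: trace_idem_eq0 => //; rewrite -{1}ff; apply: h.
Qed.

(** (x - e x) y = x y - e (x y) is nilpotent because x y stays in the right ideal F, so its trace
    vanishes. *)
Lemma right_ideal_idem R F : sp R -> mulclosed R -> sp F ->
  (forall x, F x -> R x) -> (forall x y, F x -> R y -> F (x * y)) ->
  exists e, [/\ F e, e * e = e & forall x, F x -> trrad R (x - e * x)].
Proof.
move=> hR hm hF FR Fr.
have [e [Fe ee he]] : exists e, [/\ F e, e * e = e & forall x, F x -> mxnil (x - e * x)].
  by apply: idem_mod_nil => // x y Fx Fy; apply: Fr => //; apply: FR.
exists e; split=> // x Fx; split.
  by apply: spB => //; [exact: FR|apply: mcM => //; exact: FR].
move=> y Ry; rewrite mulrBl -mulrA; apply: trace_nilp; apply: he; exact: Fr.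
Qed.
End Idempotents.

(** * Engel's theorem *)

Section Lie.
Variable n : nat.
Local Notation E := 'M[K]_n.
Implicit Types (x y z e f : E) (P Q R N I F H : E -> Prop).

Definition br x y := x * y - y * x.
Definition brclosed N := forall x y, N x -> N y -> N (br x y).
Definition lie N := sp N /\ brclosed N.
Definition lideal I N := [/\ sp I, forall x, I x -> N x & forall x y, N x -> I y -> I (br x y)].
Definition brk N := lspan (fun z => exists x y, N x /\ N y /\ z = br x y).
Definition alg P : E -> Prop :=
  fun x => forall Q, sp Q -> mulclosed Q -> (forall y, P y -> Q y) -> Q x.

Lemma alg_sp P : sp (alg P).
Proof.
split=> [Q hQ _ _|a x y hx hy Q hQ hm h]; first exact: sp0.
by apply: spD => //; [apply: spZ => //; apply: hx | apply: hy].
Qed.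
Lemma alg_mc P : mulclosed (alg P).
Proof. by move=> x y hx hy Q hQ hm h; apply: mcM => //; [apply: hx | apply: hy]. Qed.
Lemma alg_mul P x y : alg P x -> alg P y -> alg P (x * y).
Proof. exact: alg_mc. Qed.
Lemma alg_in P x : P x -> alg P x. Proof. by move=> Px Q _ _; apply. Qed.
Lemma alg_mono P Q x : (forall y, P y -> alg Q y) -> alg P x -> alg Q x.
Proof. by move=> h; apply; [exact: alg_sp | exact: alg_mc |]. Qed.

Lemma brk_sp N : sp (brk N). Proof. exact: lspan_sp. Qed.
Lemma brk_in N x y : N x -> N y -> brk N (br x y).
Proof. by move=> Nx Ny; apply: lspan_in; exists x, y. Qed.
Lemma brk_sub N P x : sp P -> (forall x y, N x -> N y -> P (br x y)) -> brk N x -> P x.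
Proof. by move=> hP h; apply=> // _ [y [z [Ny [Nz ->]]]]; apply: h. Qed.
Lemma lie_brk N x : lie N -> brk N x -> N x.
Proof. by case=> hN hb; apply: brk_sub. Qed.
Lemma brDl x y z : br (x + y) z = br x z + br y z.
Proof. rewrite /br; non_commutative_ring. Qed.
Lemma brDr x y z : br z (x + y) = br z x + br z y.
Proof. rewrite /br; non_commutative_ring. Qed.
Lemma brBl x y z : br (x - y) z = br x z - br y z.
Proof. rewrite /br; non_commutative_ring. Qed.
Lemma brZl (a : K) x y : br (a *: x) y = a *: br x y.
Proof. by rewrite /br mxZl mxZr scalerBr. Qed.
Lemma brZr (a : K) x y : br x (a *: y) = a *: br x y.
Proof. by rewrite /br mxZl mxZr scalerBr. Qed.
Lemma brN x y : br x y = - br y x.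
Proof. by rewrite /br opprB. Qed.
Lemma br0l x : br 0 x = 0. Proof. by rewrite /br mul0r mulr0 subrr. Qed.
Lemma br0r x : br x 0 = 0. Proof. by rewrite /br mul0r mulr0 subrr. Qed.
Lemma brMr x y z : br x (y * z) = br x y * z + y * br x z.
Proof. rewrite /br; non_commutative_ring. Qed.
Lemma brMl x y z : br (x * y) z = x * br y z + br x z * y.
Proof. rewrite /br; non_commutative_ring. Qed.
Lemma jacobi x y z : br x (br y z) = br (br x y) z + br y (br x z).
Proof. rewrite /br; non_commutative_ring. Qed.
Lemma br_spl P y : sp P -> sp (fun x => P (br x y)).
Proof.
move=> hP; split; first by rewrite br0l; apply: sp0.
by move=> a x z h1 h2; rewrite brDl brZl; case: hP => _; apply.
Qed.
Lemma br_spr P y : sp P -> sp (fun x => P (br y x)).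
Proof.
move=> hP; split; first by rewrite br0r; apply: sp0.
by move=> a x z h1 h2; rewrite brDr brZr; case: hP => _; apply.
Qed.
Lemma mul_spl P y : sp P -> sp (fun x => P (x * y)).
Proof.
move=> hP; split; first by rewrite mul0r; apply: sp0.
by move=> a x z h1 h2; rewrite mulrDl mxZl; case: hP => _; apply.
Qed.
Lemma mul_spr P y : sp P -> sp (fun x => P (y * x)).
Proof.
move=> hP; split; first by rewrite mulr0; apply: sp0.
by move=> a x z h1 h2; rewrite mulrDr mxZr; case: hP => _; apply.
Qed.
Lemma sp_all (T : Type) (C : T -> Prop) (P : T -> E -> Prop) :
  (forall t, C t -> sp (P t)) -> sp (fun x => forall t, C t -> P t x).
Proof.
move=> h; split=> [t Ct|a x y hx hy t Ct]; first by apply: sp0; apply: h.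
by case: (h t Ct) => _; apply; [apply: hx | apply: hy].
Qed.
Lemma trace_br x y z : \tr (br x y * z) = \tr (x * br y z).
Proof.
rewrite /br mulrBl mulrBr !linearB /= -!mulrA; congr (_ - _).
by rewrite mxtr_mulC -mulrA.
Qed.
(* ad y is a derivation, so it preserves the associative algebra of anything it preserves. *)
Lemma br_alg I y x : (forall z, I z -> alg I (br y z)) -> alg I x -> alg I (br y x).
Proof.
move=> h Ix; suff [] : alg I x /\ alg I (br y x) by [].
apply: (Ix (fun x => alg I x /\ alg I (br y x))).
- by apply: sp_cap; [exact: alg_sp | apply: br_spr; exact: alg_sp].
- move=> u v [Iu hu] [Iv hv]; split; first exact: alg_mul.
  by rewrite brMr; apply: (spD (alg_sp _)); apply: alg_mul.
- by move=> z Iz; split; [apply: alg_in | apply: h].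
Qed.

(** Engel's conclusion for the action on the quotient by U, a nonzero vector killed by H, phrased
    without forming the quotient. *)
Definition unipotent_extendable H := forall U : 'cV[K]_n -> Prop, sp U ->
  (forall h u, H h -> U u -> U (h *m u)) -> (exists v, ~ U v) ->
  exists v, ~ U v /\ forall h, H h -> U (h *m v).

(** The vectors killed by all products of i elements of H. *)
Fixpoint flag H i : 'cV[K]_n -> Prop :=
  if i is i'.+1 then fun v => forall h, H h -> flag H i' (h *m v) else fun v => v = 0.

Lemma flag_sp H i : sp (flag H i).
Proof.
elim: i => [|i ih] /=.
  by split=> // a x y -> ->; rewrite scaler0 addr0.
split=> [h _|a x y hx hy h Hh]; first by rewrite mulmx0; apply: sp0.
by rewrite mulmxDr -scalemxAr; case: ih => _; apply; [apply: hx | apply: hy].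
Qed.
Lemma flagS H i v : flag H i v -> flag H i.+1 v.
Proof.
elim: i v => [|i ih] v /=; first by move=> -> h _; rewrite mulmx0.
by move=> hv h Hh; apply: ih; apply: hv.
Qed.
Lemma flag_le H i j v : (i <= j)%N -> flag H i v -> flag H j v.
Proof.
move=> /subnK <-; elim: (j - i)%N => // k ih h.
by rewrite addSn; apply: flagS; apply: ih.
Qed.

(** By extendability each term is strictly larger than the previous one until it is the whole space,
    so a proper i-th term would have dimension at least i. *)
Lemma flag_full H : unipotent_extendable H -> forall i v, (n <= i)%N -> flag H i v.
Proof.
move=> hH; suff h i : (forall v, flag H i v) \/
    exists U : {vspace 'cV[K]_n}, (forall v, v \in U -> flag H i v) /\ (i <= \dim U)%N.
  move=> i v ni; apply: (flag_le ni); case: (h n) => // -[U [hU dU]].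
  apply: hU; suff -> : U = fullv by rewrite memvf.
  by apply/eqP; rewrite eqEdim subvf dimvf /dim /= muln1.
elim: i => [|i [ih|[U [hU dU]]]].
- by right; exists 0%VS; rewrite dimv0; split=> // v; rewrite memv0 => /eqP.
- by left=> v; apply: flagS.
case: (classic (forall v, flag H i v)) => [hf|hf]; first by left=> v; apply: flagS.
right.
have [V hV] := sp_vspace (flag_sp H i).
have [|v [nv hv]] := hH _ (flag_sp H i) _ (not_all_ex_not _ _ hf).
  by move=> h u Hh /flagS; apply.
exists (V + <[v]>)%VS; split.
  move=> w /memv_addP [u /hV hu [_ /vlineP [a ->] ->]].
  apply: (spD (flag_sp _ _)); first exact: flagS.
  by apply: (spZ _ (flag_sp _ _)).
have : (U <= V)%VS by apply/subvP => w /hU /hV.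
move=> /dimvS /(leq_trans dU) dV; apply: (leq_ltn_trans dV).
rewrite ltn_neqAle dimvS ?addvSl // andbT; apply/negP => /eqP e.
have e2 : V = (V + <[v]>)%VS by apply/eqP; rewrite eqEdim addvSl e leqnn.
by apply: nv; apply/hV; rewrite e2; apply: (subvP (addvSr _ _)); apply: memv_line.
Qed.

Lemma mx_eq0_vec y : (forall v : 'cV[K]_n, y *m v = 0) -> y = 0.
Proof. by move=> h; apply/matrixP => i j; have := h (delta_mx j 0); rewrite -colE => /matrixP /(_ i 0); rewrite !mxE. Qed.

Lemma mxMv x y (v : 'cV[K]_n) : (x * y) *m v = x *m (y *m v).
Proof. by rewrite mulmxA. Qed.

(** Otherwise repeated brackets with H keep producing elements of N outside H. Each bracket improves
    the effect [Phi] on the flag by one step: it is trivially satisfied at j = 0, and at j = 2n it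
    forces the element to be zero, which lies in H. *)
Lemma engel_normalizer H N : lie N -> sp H -> (forall x, H x -> N x) ->
  unipotent_extendable H -> (exists x, N x /\ ~ H x) ->
  exists x, [/\ N x, ~ H x & forall h, H h -> H (br h x)].
Proof.
move=> [hN bN] hH HN ue [x0 [Nx0 nx0]]; apply: NNPP => no.
pose Phi j y := forall i v, flag H i v -> flag H (i + n - j)%N (y *m v).
have step j h y : Phi j y -> H h -> Phi j.+1 (br h y).
  move=> hy Hh i v hv; rewrite /br mulmxBl !mxMv; apply: (spB (flag_sp _ _)).
    have := hy i v hv; case: (i + n - j)%N (subnS (i + n) j) => [|m] -> /=.
      by move=> ->; rewrite mulmx0.
    by apply.
  case: i hv => [->|i hv]; first by rewrite !mulmx0; exact: (sp0 (flag_sp _ _)).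
  by rewrite addSn subSS; apply: hy; apply: hv.
have seq j : exists x, [/\ N x, ~ H x & Phi j x].
  elim: j => [|j [x [Nx nx hx]]].
    by exists x0; split=> // i v _; rewrite subn0; apply: flag_full => //; exact: leq_addl.
  have [h [Hh nh]] : exists h, H h /\ ~ H (br h x).
    apply: NNPP => no2; apply: no; exists x; split=> // h Hh.
    by apply: NNPP => nh; apply: no2; exists h.
  by exists (br h x); split=> //; [apply: bN => //; apply: HN | apply: step].
have [x [_ nx hx]] := seq (n + n)%N; apply: nx.
rewrite [x](_ : _ = 0); first exact: sp0.
apply: mx_eq0_vec => v; have := hx n v (flag_full ue v (leqnn n)).
by rewrite subnn.
Qed.

(** A maximal subalgebra with extendable action is enlarged by an element z normalizing it.
    Nilpotency of z provides the last power z^j v outside the invariant subspace, and this vector is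
    killed modulo the subspace by z and by the subalgebra. *)
Lemma engel N : lie N -> (forall x, N x -> mxnil x) -> unipotent_extendable N.
Proof.
move=> lN hnil; have [hN bN] := lN.
pose C k := exists U : {vspace E}, [/\ forall x, x \in U -> N x, brclosed (fun x => x \in U),
  unipotent_extendable (fun x => x \in U) & \dim U = k].
have [||m [[U [UN bU ue dU]] hmax]] := @bounded_max C (\dim {: E}).
- exists 0%N; exists 0%VS; split; last exact: dimv0.
  + by move=> x; rewrite memv0 => /eqP ->; apply: sp0.
  + by move=> x y; rewrite !memv0 => /eqP -> _; rewrite br0l eqxx.
  + move=> U hU _ [v hv]; exists v; split=> // h; rewrite memv0 => /eqP ->.
    by rewrite mul0mx; apply: sp0.
- by move=> k [U [_ _ _ <-]]; apply: dimvS; apply: subvf.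
have spU : sp (fun x => x \in U).
  by split=> [|a x y hx hy]; [exact: mem0v | apply: memvD => //; apply: memvZ].
suff full x : N x -> x \in U.
  move=> W hW st nf; have [|v [nv hv]] := ue W hW _ nf.
    by move=> h u /UN; apply: st.
  by exists v; split=> // h /full; apply: hv.
move=> Nx; apply: contraT => nx.
have [|z [Nz nz hz]] := engel_normalizer lN spU UN ue.
  by exists x; split=> //; apply/negP.
have : C (\dim (U + <[z]>)%VS).
  exists (U + <[z]>)%VS; split=> //.
  - by move=> y /memv_addP [u /UN hu [_ /vlineP [a ->] ->]]; apply: spD => //; apply: spZ.
  - move=> _ _ /memv_addP [u hu [_ /vlineP [a ->] ->]] /memv_addP [w hw [_ /vlineP [b ->] ->]].
    apply: (subvP (addvSl _ _)); rewrite brDl !brDr !brZl !brZr.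
    have -> : br z z = 0 by rewrite /br subrr.
    rewrite !scaler0 addr0 (brN z w); apply: memvD.
      by apply: memvD; [exact: bU | apply: memvZ; exact: hz].
    by apply: memvZ; rewrite memvN; exact: hz.
  - move=> W hW st nf; have [|v [nv hv]] := ue W hW _ nf.
      by move=> h u hh; apply: st; apply: (subvP (addvSl _ _)).
    have zW u : W u -> W (z *m u).
      by apply: st; apply: (subvP (addvSr _ _)); apply: memv_line.
    have [k hk] := hnil z Nz.
    have [j [nj hj]] : exists j, ~ W (z ^+ j *m v) /\ W (z ^+ j.+1 *m v).
      have : W (z ^+ k *m v) by rewrite hk mul0mx; apply: sp0.
      elim: k {hk} => [|k ih] hk; first by case: nv; move: hk; rewrite expr0 mul1mx.
      by case: (classic (W (z ^+ k *m v))) => // nk; exists k.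
    exists (z ^+ j *m v); split=> //.
    have hjv i : forall h, h \in U -> W (h *m (z ^+ i *m v)).
      elim: i => [|i ih] h hh; first by rewrite expr0 mul1mx; apply: hv.
      have e : h * z = z * h + br h z by rewrite /br addrC subrK.
      rewrite exprS mxMv -(mxMv h) e mulmxDl mxMv; apply: spD => //; first by apply: zW; apply: ih.
      by apply: ih; apply: hz.
    move=> _ /memv_addP [u hu [_ /vlineP [a ->] ->]]; rewrite mulmxDl.
    apply: spD => //; first exact: hjv.
    by rewrite -scalemxAl; apply: spZ => //; rewrite -mxMv -exprS.
move/hmax; rewrite -dU leqNgt => /negP; case.
rewrite ltn_neqAle dimvS ?addvSl // andbT; apply/negP => /eqP e.
have e2 : U = (U + <[z]>)%VS by apply/eqP; rewrite eqEdim addvSl e leqnn.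
by apply: nz; rewrite e2; apply: (subvP (addvSr _ _)); apply: memv_line.
Qed.

(** N normalizes I, hence preserves each term of the flag of I, while x lowers the flag by one step;
    so x a lowers it too. *)
Lemma nil_ideal_mul I N x a : lie I -> (forall y, I y -> mxnil y) ->
  (forall y z, N y -> I z -> I (br y z)) -> I x -> alg N a -> mxnil (x * a).
Proof.
move=> lI nI hN Ix Na; have full := flag_full (engel lI nI).
have st i b v : alg N b -> flag I i v -> flag I i (b *m v).
  move=> Nb; move: v; apply: (Nb (fun b => forall v, flag I i v -> flag I i (b *m v))).
  - split=> [v _|c y z hy hz v hv]; first by rewrite mul0mx; exact: (sp0 (flag_sp _ _)).
    rewrite mulmxDl -scalemxAl; case: (flag_sp I i) => _; apply; [exact: hy|exact: hz].
  - by move=> y z hy hz v hv; rewrite mxMv; apply: hy; apply: hz.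
  elim: i {Nb} => [|i ih] y Ny v /=; first by move=> ->; rewrite mulmx0.
  move=> hv h Ih; have e : h * y = y * h - br y h by rewrite /br opprB addrC subrK.
  rewrite -(mxMv h) e mulmxBl mxMv; apply: (spB (flag_sp _ _)).
    by apply: ih => //; apply: hv.
  by apply: hv; apply: hN.
exists n; apply: mx_eq0_vec => v.
have h i w : flag I i w -> (x * a) ^+ i *m w = 0.
  elim: i w => [|i ih] w hw; first by rewrite expr0 mul1mx.
  by rewrite exprSr mxMv; apply: ih; rewrite mxMv; apply: (st i.+1 a w Na hw).
by apply: h; apply: full.
Qed.

Lemma nil_ideal_rad I N x : lie I -> (forall y, I y -> mxnil y) ->
  (forall y z, N y -> I z -> I (br y z)) -> I x -> alg N x -> trrad (alg N) x.
Proof.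
by move=> lI nI hN Ix Nx; split=> // a Na; apply: trace_nilp; exact: (nil_ideal_mul lI nI hN Ix Na).
Qed.

Lemma nil_lie_prod I : lie I -> (forall y, I y -> mxnil y) ->
  forall v, flag I n v.
Proof. by move=> lI nI v; apply: flag_full (engel lI nI) _ _ (leqnn n). Qed.

End Lie.

(** * Cartan's criterion *)

(** The Chinese remainder theorem, one prime power at a time: [P] collects the powers already
    treated, and P u is 1 modulo the new one. *)
Lemma hermite_interpolation (s : seq K) (k : nat) (c : K -> K) : uniq s ->
  exists q : {poly K}, forall z, z \in s -> ('X - z%:P) ^+ k %| q - (c z)%:P.
Proof.
elim: s => [|z s ih] /=; first by exists 0.
move=> /andP [zs /ih [q hq]].
pose P := \prod_(y <- s) ('X - y%:P) ^+ k.
have cop : coprimep P (('X - z%:P) ^+ k).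
  rewrite /P big_seq; elim/big_ind: _ => [|u v hu hv|y ys]; first exact: coprime1p.
    by rewrite coprimepMl hu hv.
  rewrite coprimep_expl // coprimep_expr // coprimep_XsubC root_XsubC.
  by apply: contraNneq zs => ->.
have [u [v uv]] := Bezout_eq1 cop.
exists (q + P * u * ((c z)%:P - q)) => y; rewrite inE => /orP [/eqP ->|ys].
  have -> : q + P * u * ((c z)%:P - q) - (c z)%:P = (v * (q - (c z)%:P)) * ('X - z%:P) ^+ k.
    transitivity ((q - (c z)%:P) * (u * P + v * ('X - z%:P) ^+ k) - (P * u) * (q - (c z)%:P)).
      by rewrite uv; ring.
    by ring.
  exact: dvdp_mull.
have -> : q + P * u * ((c z)%:P - q) - (c y)%:P = (q - (c y)%:P) + P * (u * ((c z)%:P - q)) by ring.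
apply: dvdp_add; [exact: hq | apply: dvdp_mulr].
by rewrite /P (big_rem y) //=; apply: dvdp_mulIl.
Qed.

Section AdPolynomials.
Variables (n : nat) (x : 'M[K]_n).
Implicit Types (b : 'M[K]_n) (q : {poly K}).

Definition ad_poly q b := \sum_(i < size q) q`_i *: iter i (br x) b.

Lemma ad_poly_wide q b m : (size q <= m)%N -> ad_poly q b = \sum_(i < m) q`_i *: iter i (br x) b.
Proof.
move=> hm; rewrite /ad_poly (big_ord_widen m (fun i => q`_i *: iter i (br x) b) hm) big_mkcond.
by apply: eq_bigr => i _; case: ltnP => // h; rewrite nth_default // scale0r.
Qed.
Lemma ad_polyD p q b : ad_poly (p + q) b = ad_poly p b + ad_poly q b.
Proof.
rewrite (ad_poly_wide b (size_polyD p q)) (ad_poly_wide b (leq_maxl (size p) (size q))).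
rewrite (ad_poly_wide b (leq_maxr (size p) (size q))) -big_split.
by apply: eq_bigr => i _; rewrite coefD scalerDl.
Qed.
Lemma ad_polyC c b : ad_poly c%:P b = c *: b.
Proof. by rewrite (ad_poly_wide b (size_polyC_leq1 c)) big_ord1 coefC. Qed.
Lemma ad_poly0 b : ad_poly 0 b = 0.
Proof. by rewrite -[0]/(0%:P) ad_polyC scale0r. Qed.
Lemma ad_polyMX q b : ad_poly (q * 'X) b = br x (ad_poly q b).
Proof.
have h : (size (q * 'X)%R <= (size q).+1)%N.
  by have [->|/size_mulX ->//] := eqVneq q 0; rewrite mul0r size_poly0.
rewrite (ad_poly_wide b h) big_ord_recl coefMX /= scale0r add0r /ad_poly.
have lin : forall (r : seq 'I_(size q)) F, br x (\sum_(i <- r) F i) = \sum_(i <- r) br x (F i).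
  move=> r F; elim: r => [|i r ih]; first by rewrite !big_nil br0r.
  by rewrite !big_cons brDr ih.
by rewrite lin; apply: eq_bigr => i _; rewrite coefMX /= brZr.
Qed.
Lemma ad_polyM p q b : ad_poly (p * q) b = ad_poly p (ad_poly q b).
Proof.
elim/poly_ind: p => [|p c ih]; first by rewrite mul0r !ad_poly0.
rewrite mulrDl !ad_polyD ad_polyC -mulrA ['X * q]mulrC mulrA !ad_polyMX ih; congr (_ + _).
elim/poly_ind: q {ih} => [|q d ih]; first by rewrite mulr0 !ad_poly0 scaler0.
by rewrite mulrDr mulrA -polyCM !ad_polyD !ad_polyC !ad_polyMX ih scalerDr scalerA brZr.
Qed.
Lemma ad_poly_lin q : forall (I : Type) (r : seq I) F, ad_poly q (\sum_(i <- r) F i) = \sum_(i <- r) ad_poly q (F i).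
Proof.
move=> I r F; elim/poly_ind: q => [|q c ih].
  by rewrite ad_poly0 big1 // => i _; rewrite ad_poly0.
rewrite ad_polyD ad_polyC ad_polyMX ih scaler_sumr.
rewrite [RHS](eq_bigr (fun i => br x (ad_poly q (F i)) + c *: F i)); last first.
  by move=> i _; rewrite ad_polyD ad_polyC ad_polyMX.
rewrite big_split /=; congr (_ + _).
elim: r {ih} => [|i r ih]; first by rewrite !big_nil br0r.
by rewrite !big_cons brDr ih.
Qed.
Lemma ad_poly_in N q b : lie N -> N x -> N b -> N (ad_poly q b).
Proof.
move=> [hN bN] Nx Nb; apply: sp_sum => // i _; apply: spZ => //.
by elim: (nat_of_ord i) => //= j ih; apply: bN.
Qed.

(** ad x - w is left multiplication by x - z minus right multiplication by x - y. These commute and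
    their k-th powers kill b, so (ad x - w)^(2k) kills b, and modulo that power q is the constant
    conj w. *)
Lemma ad_poly_eigen q w z y k b : w = z - y -> ('X - w%:P) ^+ (k + k) %| q - (conjc w)%:P ->
  (x - z%:M) ^+ k * b = 0 -> b * (x - y%:M) ^+ k = 0 -> ad_poly q b = conjc w *: b.
Proof.
move=> ew /dvdpP [r er] h1 h2.
have -> : q = r * ('X - w%:P) ^+ (k + k) + (conjc w)%:P by rewrite -er subrK.
rewrite ad_polyD ad_polyC ad_polyM; set b' := ad_poly (_ ^+ _) b.
suff -> : b' = 0.
  rewrite (_ : ad_poly r 0 = 0) ?add0r //.
  by have := ad_poly_lin r [::] (fun _ : nat => 0); rewrite !big_nil.
have [u eu] : exists u, u = x - z%:M by eexists.
have [v ev] : exists v, v = x - y%:M by eexists.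
rewrite -eu in h1; rewrite -ev in h2.
have D c : ad_poly ('X - w%:P) c = u * c - c * v.
  rewrite -[- w%:P]polyCN ad_polyD ad_polyC -['X]mul1r ad_polyMX -[1]/(1%:P) ad_polyC scale1r.
  rewrite /br eu ev mulrBl mulrBr mxSl mxSr ew scaleNr scalerBl.
  by move: (z *: c) (y *: c) => zc yc; non_commutative_ring.
(* The span of the u^i b v^j with i + j = m replaces the binomial expansion. *)
have inW m : lspan (fun t => exists i j, (i + j = m)%N /\ t = u ^+ i * b * v ^+ j) (ad_poly (('X - w%:P) ^+ m) b).
  elim: m => [|m ih].
    by apply: lspan_in; exists 0%N, 0%N; rewrite !expr0 mul1r mulr1 -[1]/(1%:P) ad_polyC scale1r.
  rewrite exprS ad_polyM D.
  have := ih (fun t => lspan (fun t => exists i j, (i + j = m.+1)%N /\ t = u ^+ i * b * v ^+ j) (u * t - t * v)).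
  apply.
    split; first by rewrite mulr0 mul0r subrr; apply: sp0; exact: lspan_sp.
    move=> a s t hs ht; rewrite mulrDr mulrDl mxZl mxZr opprD addrACA -scalerBr.
    by case: (lspan_sp (fun t => exists i j, (i + j = m.+1)%N /\ t = u ^+ i * b * v ^+ j)) => _; apply.
  move=> _ [i [j [ij ->]]]; apply: (spB (lspan_sp _)); apply: lspan_in.
    by exists i.+1, j; rewrite addSn ij exprS !mulrA.
  by exists i, j.+1; rewrite addnS ij exprSr !mulrA.
have := inW (k + k)%N (fun t => t = 0); apply.
  by split=> // a s t -> ->; rewrite scaler0 addr0.
move=> _ [i [j [ij ->]]]; case: (leqP k i) => hi.
  by rewrite -(subnK hi) exprD -[_ * _ * b]mulrA h1 mulr0 mul0r.
have hj : (k <= j)%N by lia.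
by rewrite -(subnKC hj) exprD [_ * (_ * _)]mulrA -[_ * _ * _ ^+ k]mulrA h2 mulr0 mul0r.
Qed.
End AdPolynomials.

(** The exponent [size rs] bounds every multiplicity, so divisibility is tested one root at a
    time. *)
Lemma dvd_prod_roots (rs : seq K) (r : {poly K}) :
  (forall z, z \in rs -> ('X - z%:P) ^+ (size rs) %| r) -> \prod_(z <- rs) ('X - z%:P) %| r.
Proof.
move=> h; rewrite -prodr_undup_exp_count /=.
have : forall z, z \in undup rs -> ('X - z%:P) ^+ count_mem z rs %| r.
  by move=> z; rewrite mem_undup => /h; apply: dvdp_trans; apply: dvdp_exp2l; apply: count_size.
elim: (undup rs) (undup_uniq rs) => [|z s ih] /=; first by rewrite big_nil dvd1p.
move=> /andP [zs us] hs; rewrite big_cons Gauss_dvdp.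
  by rewrite hs ?inE ?eqxx //= ih // => y ys; apply: hs; rewrite inE ys orbT.
rewrite coprimep_sym big_seq; elim/big_ind: _ => [|u v hu hv|y ys]; first exact: coprime1p.
  by rewrite coprimepMl hu hv.
apply: coprimep_expl; apply: coprimep_expr; rewrite coprimep_XsubC root_XsubC.
by apply: contraNneq zs => ->.
Qed.

(* x is tested against the operator acting as conj z on each generalized z-eigenspace of x. *)
Lemma cartan_nilpotent n (N : 'M[K]_n -> Prop) x : lie N ->
  (forall y z, N y -> N z -> \tr (y * z) = 0) -> brk N x -> mxnil x.
Proof.
case: n N x => [|n] N x lN tN bx; first by exists 0%N; rewrite [LHS]flatmx0 [RHS]flatmx0.
have Nx := lie_brk lN bx.
have [rs e] := cplx_poly_split (char_poly x).
have m := char_poly_monic x; rewrite (monicP m) scale1r in e.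
have sz : size rs = n.+1.
  by have := size_char_poly x; rewrite e size_prod_XsubC => -[].
pose H := horner_mx x.
have HM : {morph H : p q / p * q} by move=> ? ?; rewrite /H rmorphM.
have HB : {morph H : p q / p - q} by move=> ? ?; rewrite /H rmorphB.
have HC c : H c%:P = c%:M by rewrite /H horner_mx_C.
have HX z : H ('X - z%:P) = x - z%:M by rewrite HB HC /H horner_mx_X.
have HXn z k : H (('X - z%:P) ^+ k) = (x - z%:M) ^+ k by rewrite -HX /H rmorphXn.
pose s := undup rs.
have H0 r : (forall z, z \in s -> ('X - z%:P) ^+ n.+1 %| r) -> H r = 0.
  move=> h; have : char_poly x %| r.
    by rewrite e; apply: dvd_prod_roots => z zr; rewrite sz; apply: h; rewrite mem_undup.
  by move=> /dvdpP [t ->]; rewrite HM [H (char_poly x)]Cayley_Hamilton mulr0.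
(* To order n + 1, [p z] is 1 at z and 0 at the other eigenvalues, so that its value at x projects
   onto the generalized eigenspace of z. *)
have /dep_choice [p hp] : forall z : K, exists pz : {poly K}, forall y, y \in s ->
    ('X - y%:P) ^+ n.+1 %| pz - ((y == z)%:R)%:P.
  by move=> z; apply: hermite_interpolation; apply: undup_uniq.
pose f z := H (p z).
have pz0 z y : y \in s -> y != z -> ('X - y%:P) ^+ n.+1 %| p z.
  by move=> /(hp z) h yz; move: h; rewrite (negbTE yz) subr0.
have f_ker z : (x - z%:M) ^+ n.+1 * f z = 0.
  rewrite -HXn -HM; apply: H0 => y ys; have [->|yz] := eqVneq y z; first exact: dvdp_mulIl.
  by apply: dvdp_mull; apply: pz0.
have ff z : z \in s -> f z * f z = f z.
  move=> zs; apply/eqP; rewrite -subr_eq0 -HM -HB; apply/eqP; apply: H0 => y ys.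
  have -> : p z * p z - p z = p z * (p z - 1) by ring.
  have [->|yz] := eqVneq y z; last by apply: dvdp_mulr; apply: pz0.
  by apply: dvdp_mull; have := hp z z zs; rewrite eqxx.
have sum1 : \sum_(z <- s) f z = 1.
  apply/eqP; rewrite -subr_eq0 -[1](rmorph1 H) /f -rmorph_sum -HB; apply/eqP; apply: H0 => y ys.
  rewrite (big_rem y) //= addrAC; apply: dvdp_add.
    by have := hp y y ys; rewrite eqxx.
  rewrite big_seq; elim/big_ind: _ => [|u v hu hv|z zs]; first exact: dvdp0.
    exact: dvdp_add.
  by apply: pz0 => //; move: zs; rewrite rem_filter ?undup_uniq // mem_filter /= eq_sym => /andP [].
have cH q1 q2 : H q1 * H q2 = H q2 * H q1 by rewrite -!HM mulrC.
have f_kerr z : f z * (x - z%:M) ^+ n.+1 = 0 by rewrite -HXn /f cH -/(f z) HXn f_ker.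
have [q1 hq1] := hermite_interpolation n.+1 conjc (undup_uniq rs).
pose sbar := H q1.
have sf z : sbar * f z = conjc z *: f z.
  apply/eqP; rewrite -subr_eq0 -mxSl -HC -!HM -HB -mulrBl; apply/eqP; apply: H0 => y ys.
  have [<-|yz] := eqVneq y z; first by apply: dvdp_mulr; apply: hq1.
  by apply: dvdp_mull; apply: pz0.
(* At each difference z - y of eigenvalues [q2] is conj z - conj y, hence ad [sbar] = q2(ad x). So
   ad [sbar] preserves N although [sbar] itself may lie outside N, and tr ([u,v] sbar) = tr (u
   [v,sbar]) = 0 for u, v in N. *)
have [q2 hq2] := hermite_interpolation (n.+1 + n.+1) conjc (undup_uniq [seq z - y | z <- s, y <- s]).
have adQ b : ad_poly x q2 b = br sbar b.
  have -> : b = \sum_(z <- s) \sum_(y <- s) f z * b * f y.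
    rewrite -{1}[b]mulr1 -{1}[b]mul1r -sum1 mulr_suml mulr_suml.
    by apply: eq_bigr => z _; rewrite mulr_sumr.
  rewrite ad_poly_lin /br mulr_sumr mulr_suml -sumrB big_seq [RHS]big_seq; apply: eq_bigr => z zs.
  rewrite ad_poly_lin mulr_sumr mulr_suml -sumrB big_seq [RHS]big_seq; apply: eq_bigr => y ys.
  have fs : f y * sbar = conjc y *: f y by rewrite -sf; apply: cH.
  rewrite [sbar * _]mulrA [sbar * _]mulrA sf -[_ * sbar]mulrA fs !mxZl mxZr -scalerBl -conjcB.
  apply: (@ad_poly_eigen _ _ _ _ z y n.+1) => //.
  - by apply: hq2; rewrite mem_undup; apply/allpairsP; exists (z, y).
  - by rewrite mulrA mulrA f_ker !mul0r.
  - rewrite -[LHS]mulrA; transitivity (f z * b * 0); last exact: mulr0.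
    congr (_ * _); exact: f_kerr.
have t0 : \tr (x * sbar) = 0.
  apply: (brk_sub (P := fun x => \tr (x * sbar) = 0)) bx.
    split=> [|a u v hu hv]; first by rewrite mul0r mxtrace0.
    by rewrite mulrDl mxZl linearD linearZ /= hu hv mulr0 addr0.
  move=> u v Nu Nv; rewrite trace_br brN -adQ mulrN linearN /= tN ?oppr0 //.
  exact: ad_poly_in.
have trs : \tr (x * sbar) = \sum_(z <- s) (z * conjc z) *+ \rank (f z).
  rewrite -[x * sbar]mulr1 -sum1 mulr_sumr linear_sum /= big_seq [RHS]big_seq; apply: eq_bigr => z zs.
  rewrite -mulrA sf mxZr linearZ /=.
  have -> : x * f z = (x - z%:M) * f z + z *: f z.
    by rewrite mulrBl mxSl subrK.
  rewrite linearD linearZ /= trace_nilp ?add0r ?trace_idem ?ff //.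
    by rewrite mulrA [_ * z]mulrC mulr_natr.
  exists n.+1; rewrite exprMn_comm; last by rewrite /GRing.comm -HX; apply: cH.
  by rewrite [f z ^+ _]exprS mulrA f_ker mul0r.
have z0 z : z \in s -> f z = 0 \/ z = 0.
  move=> zs; have [fz|fz] := eqVneq (f z) 0; [by left | right].
  move: t0; rewrite trs => /sum_normc_eq0 h; apply: (h z zs).
  by rewrite lt0n mxrank_eq0.
exists n.+1; rewrite -[x ^+ _]mulr1 -sum1 mulr_sumr big_seq big1 // => z /z0 [->|z_0]; first by rewrite mulr0.
by have := f_ker z; rewrite z_0 (_ : 0%:M = 0) ?subr0 //; apply/matrixP => i j; rewrite !mxE mul0rn.
Qed.

(** * Ideals of linear Lie algebras and the trace form *)

(** The form may be degenerate. A functional vanishing on its right kernel lies in the row space of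
    the Gram matrix, which is tested against the cokernel. *)
Lemma riesz_representation n (I : 'M[K]_n -> Prop) (phi : 'M[K]_n -> 'M[K]_n -> K) (l : 'M[K]_n -> K) :
  sp I ->
  (forall a x x' y, phi (a *: x + x') y = a * phi x y + phi x' y) ->
  (forall a x x' y, phi y (a *: x + x') = a * phi y x + phi y x') ->
  (forall a x x', l (a *: x + x') = a * l x + l x') ->
  (forall z, I z -> (forall x, I x -> phi x z = 0) -> l z = 0) ->
  exists x, I x /\ forall z, I z -> l z = phi x z.
Proof.
move=> hI pl pr ll hz; have [U hU] := sp_vspace hI.
have p0 y : phi 0 y = 0 by have := pl (-1) 0 0 y; rewrite scaler0 addr0 mulN1r addNr.
have p0' y : phi y 0 = 0.
  by have := pr (-1) 0 0 y; rewrite scaler0 addr0 mulN1r addNr.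
have l0 : l 0 = 0 by have := ll (-1) 0 0; rewrite scaler0 addr0 mulN1r addNr.
have psum k (c : 'I_k -> K) (f : 'I_k -> 'M[K]_n) y : phi (\sum_i c i *: f i) y = \sum_i c i * phi (f i) y.
  elim: k c f => [|k ih] c f; first by rewrite !big_ord0.
  by rewrite !big_ord_recl pl ih.
have psum' k (c : 'I_k -> K) (f : 'I_k -> 'M[K]_n) y : phi y (\sum_i c i *: f i) = \sum_i c i * phi y (f i).
  elim: k c f => [|k ih] c f; first by rewrite !big_ord0.
  by rewrite !big_ord_recl pr ih.
have lsum k (c : 'I_k -> K) (f : 'I_k -> 'M[K]_n) : l (\sum_i c i *: f i) = \sum_i c i * l (f i).
  elim: k c f => [|k ih] c f; first by rewrite !big_ord0.
  by rewrite !big_ord_recl ll ih.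
pose b := vbasis U.
have bU i : I b`_i.
  case: (ltnP i (size b)) => hi; first by apply/hU; apply: vbasis_mem; apply: mem_nth.
  by rewrite nth_default //; apply: sp0.
pose G := \matrix_(i < \dim U, j < \dim U) phi b`_i b`_j.
pose L := \row_(j < \dim U) l b`_j.
have /submxP [D hD] : (L <= G)%MS.
  rewrite submxE; apply/eqP/rowP => j; rewrite !mxE.
  pose C := cokermx G; have GC : G *m C = 0 by apply: mulmx_coker.
  transitivity (l (\sum_i C i j *: b`_i)).
    by rewrite lsum; apply: eq_bigr => i _; rewrite !mxE mulrC.
  apply: hz => [|x /hU xU]; first by apply: sp_sum => // i _; apply: spZ.
  rewrite (coord_vbasis xU) psum big1 // => i _; rewrite psum'.
  have := congr1 (fun M : 'M_(_, _) => M i j) GC; rewrite !mxE => h.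
  rewrite [X in _ * X](_ : _ = 0) ?mulr0 // -[RHS]h; apply: eq_bigr => t _.
  by rewrite !mxE mulrC.
exists (\sum_i D 0 i *: b`_i); split; first by apply: sp_sum => // i _; apply: spZ.
move=> z /hU zU; rewrite (coord_vbasis zU) lsum psum'; apply: eq_bigr => i _; congr (_ * _).
have := congr1 (fun M : 'M_(_, _) => M 0 i) hD; rewrite !mxE => ->.
by rewrite psum; apply: eq_bigr => j _; rewrite mxE.
Qed.

Lemma separating_functional n (P : 'M[K]_n -> Prop) y : sp P -> ~ P y ->
  exists l : 'M[K]_n -> K, [/\ forall a x x', l (a *: x + x') = a * l x + l x',
    forall x, P x -> l x = 0 & l y != 0].
Proof.
move=> hP ny; have [U hU] := sp_vspace hP.
pose q x := x - projv U x.
have qy : q y != 0.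
  apply/eqP => h; apply: ny; apply/hU; have := memv_proj U y.
  by rewrite (_ : projv U y = y) //; apply/esym/eqP; rewrite -subr_eq0 -/(q y) h.
have [i [j hij]] : exists i j, q y i j != 0.
  apply: NNPP => no; move/eqP: qy; apply; apply/matrixP => i j; rewrite [RHS]mxE.
  by apply/eqP; apply: contraT => h; case: no; exists i, j.
exists (fun x => q x i j); split=> //.
  by move=> a x x'; rewrite /q linearP /= !mxE; ring.
by move=> x /hU xU; rewrite /q projv_id // subrr mxE.
Qed.

Section AlgebraRadical.
Variables (n : nat) (N : 'M[K]_n -> Prop).

Lemma trrad_alg_sp : sp (trrad (alg N)).
Proof. exact: trrad_sp (@alg_sp _ _). Qed.
Lemma trrad_alg_mull x y : alg N x -> trrad (alg N) y -> trrad (alg N) (x * y).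
Proof. exact: trrad_mull (@alg_mc _ _). Qed.
Lemma trrad_alg_mulr x y : trrad (alg N) x -> alg N y -> trrad (alg N) (x * y).
Proof. exact: trrad_mulr (@alg_mc _ _). Qed.
Lemma trrad_alg_nil x : trrad (alg N) x -> mxnil x.
Proof. by apply: trrad_nilp; [exact: alg_sp | exact: alg_mc]. Qed.
Lemma trrad_trace x : trrad (alg N) x -> \tr x = 0.
Proof. by move/trrad_alg_nil; apply: trace_nilp. Qed.
Lemma trrad_trace_eq x y : trrad (alg N) (x - y) -> \tr x = \tr y.
Proof. by move/trrad_trace; rewrite linearB /= => /eqP; rewrite subr_eq0 => /eqP. Qed.
End AlgebraRadical.

Section LieIdeals.
Variables (n : nat) (N : 'M[K]_n -> Prop).
Hypothesis lN : lie N.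
Local Notation R := (alg N).
Local Notation J := (trrad (alg N)).

Let Jsp : sp J := @trrad_alg_sp _ N.
Let Jl x y : R x -> J y -> J (x * y). Proof. exact: trrad_alg_mull. Qed.
Let Jr x y : J x -> R y -> J (x * y). Proof. exact: trrad_alg_mulr. Qed.
Let JR x : J x -> R x. Proof. by case. Qed.
Let trJ x : J x -> \tr x = 0. Proof. exact: trrad_trace. Qed.
Let trJeq x y : J (x - y) -> \tr x = \tr y. Proof. exact: trrad_trace_eq. Qed.

Lemma central_alg c : R c -> (forall y, N y -> J (br c y)) -> forall a, R a -> J (br c a).
Proof.
move=> Rc hc a Ra; suff [] : R a /\ J (br c a) by [].
apply: (Ra (fun a => R a /\ J (br c a))).
- by apply: sp_cap; [exact: alg_sp | apply: br_spr].
- move=> u v [Ru hu] [Rv hv]; split; first exact: alg_mul.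
  by rewrite brMr; apply: (spD Jsp); [apply: Jr | apply: Jl].
- by move=> y Ny; split; [apply: alg_in | apply: hc].
Qed.

(* A nonzero eigenvalue l of x in I cap [N,N] is impossible: the spectral idempotent f commutes
   with N modulo the radical, so l rank f = tr (x f) = 0. *)
Lemma abelian_ideal_rad I : lideal I N -> (forall x y, I x -> I y -> J (br x y)) ->
  forall x, I x -> brk N x -> J x.
Proof.
move=> [hI IN hNI] hab x Ix bx.
have [hN bN] := lN.
pose I0 x := I x /\ brk N x.
have brkN y z : N y -> brk N z -> brk N (br y z).
  by move=> Ny /(lie_brk lN) Nz; apply: brk_in.
suff nil y : I0 y -> mxnil y.
  apply: (@nil_ideal_rad _ I0) => //.
  - split; first by apply: sp_cap => //; exact: brk_sp.
    by move=> y z [Iy By] [Iz Bz]; split; [apply: hNI => //; apply: IN | apply: brkN => //; apply: lie_brk By].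
  - by move=> y z Ny [Iz Bz]; split; [apply: hNI | apply: brkN].
  - by apply: alg_in; apply: IN.
move=> [Iy By] {x Ix bx}; apply: NNPP => ny.
have [l [f [ln0 fn0 ff nf hf]]] := spectral_idem ny.
have If : alg I f by apply: hf; [exact: alg_sp | exact: alg_mc | apply: alg_in].
have IR a : alg I a -> R a by apply: alg_mono => z /IN; apply: alg_in.
have com1 c y' : alg I c -> I y' -> J (br c y').
  move=> Ic Iy'; suff [] : alg I c /\ J (br c y') by [].
  apply: (Ic (fun c => alg I c /\ J (br c y'))).
  - by apply: sp_cap; [exact: alg_sp | apply: br_spl].
  - move=> u v [Iu hu] [Iv hv]; split; first exact: alg_mul.
    by rewrite brMl; apply: (spD Jsp); [apply: Jl => //; apply: IR | apply: Jr => //; apply: IR].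
  - by move=> z Iz; split; [apply: alg_in | apply: hab].
have com c c' : alg I c -> alg I c' -> J (br c c').
  move=> Ic Ic'; suff [] : alg I c' /\ J (br c c') by [].
  apply: (Ic' (fun c' => alg I c' /\ J (br c c'))).
  - by apply: sp_cap; [exact: alg_sp | apply: br_spr].
  - move=> u v [Iu hu] [Iv hv]; split; first exact: alg_mul.
    by rewrite brMr; apply: (spD Jsp); [apply: Jr => //; apply: IR | apply: Jl => //; apply: IR].
  - by move=> z Iz; split; [apply: alg_in | apply: com1].
have fcen z : N z -> J (br z f).
  move=> Nz; pose g := br z f.
  have Ig : alg I g by apply: br_alg => // u Iu; apply: alg_in; apply: hNI.
  have eg : g = f * g + f * g - br f g by rewrite {1}/g -{1}ff brMr -/g /br; non_commutative_ring.
  have Rf := IR _ If.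
  have Jc : J (br f g) by apply: com.
  have fg : J (f * g).
    have -> : f * g = f * br f g.
      have -> : f * br f g = f * f * g - (f * z * (f * f) - f * f * z * f).
        by rewrite /g /br; non_commutative_ring.
      by rewrite ff subrr subr0.
    exact: Jl.
  by rewrite -/g eg; apply: (spB Jsp) => //; apply: (spD Jsp).
have t0 : \tr (y * f) = 0.
  apply: (brk_sub (P := fun u => \tr (u * f) = 0)) By.
    split=> [|a u v hu hv]; first by rewrite mul0r mxtrace0.
    by rewrite mulrDl mxZl linearD linearZ /= hu hv mulr0 addr0.
  by move=> u v Nu Nv; rewrite trace_br; apply: trJ; apply: Jl; [apply: alg_in | apply: fcen].
have := trace_nilp nf; rewrite linearB linearZ /= t0 sub0r => /eqP.
rewrite oppr_eq0 mulf_eq0 (negbTE ln0) /= => /eqP tf.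
by move/eqP: fn0; apply; apply: trace_idem_eq0.
Qed.

(** By Cartan's criterion [I,I] consists of nilpotent matrices; being normalized by N it lies in J,
    so I is abelian modulo J and [abelian_ideal_rad] applies. *)
Lemma traceless_ideal_rad I : lideal I N -> (forall x y, I x -> I y -> \tr (x * y) = 0) ->
  forall x, I x -> brk N x -> J x.
Proof.
move=> lI; have [hI IN hNI] := lI; move=> tI.
have [hN bN] := lN.
have lieI : lie I by split=> // y z Iy Iz; apply: hNI => //; apply: IN.
apply: abelian_ideal_rad => // y z Iy Iz.
apply: (@nil_ideal_rad _ (brk I)) => //.
- split; first exact: brk_sp.
  by move=> u v /(lie_brk lieI) Iu /(lie_brk lieI) Iv; apply: brk_in.
- by move=> u Bu; apply: cartan_nilpotent Bu.
- move=> u v Nu; apply: (brk_sub (P := fun v => brk I (br u v))); first by apply: br_spr; exact: brk_sp.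
  move=> a b Ia Ib; rewrite jacobi; apply: (spD (brk_sp I)).
    by apply: (brk_in (N := I)) => //; exact: hNI.
  by apply: (brk_in (N := I)) => //; exact: hNI.
- exact: brk_in.
- by apply: alg_in; apply: (IN); apply: hNI => //; exact: IN.
Qed.

(** Otherwise a functional separates x from [N,N] plus the radical of the trace form on N. It has
    the form tr (z -) with z in N orthogonal to [N,N], so by hypothesis it vanishes on N. *)
Lemma perfect_mod_radical :
  (forall z, N z -> (forall x y, N x -> N y -> \tr (z * br x y) = 0) -> forall y, N y -> \tr (z * y) = 0) ->
  forall x, N x -> exists u v, [/\ brk N u, N v, forall y, N y -> \tr (v * y) = 0 & x = u + v].
Proof.
move=> h x Nx; have [hN bN] := lN.
pose n0 v := N v /\ forall y, N y -> \tr (v * y) = 0.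
have n0sp : sp n0.
  apply: sp_cap => //; apply: (@sp_all _ _ N (fun y v => \tr (v * y) = 0)) => y _.
  split=> [|a u v hu hv]; first by rewrite mul0r mxtrace0.
  by rewrite mulrDl mxZl linearD linearZ /= hu hv mulr0 addr0.
apply: NNPP => no.
have [|l [ll lP lx]] := @separating_functional _ (sumsp (brk N) n0) x (sumsp_sp (brk_sp _) n0sp).
  by move=> [u [v [Bu [[Nv tv] e]]]]; apply: no; exists u, v.
have [|||z [Nz hz]] := @riesz_representation _ N (fun x y => \tr (x * y)) l hN _ _ ll.
- by move=> a u u' v; rewrite mulrDl mxZl linearD linearZ.
- by move=> a u u' v; rewrite mulrDr mxZr linearD linearZ.
- move=> z Nz hz; apply: lP; apply: (sumspr (brk_sp _)); split=> // y Ny.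
  by rewrite mxtr_mulC; apply: hz.
move/eqP: lx; apply; rewrite hz //; apply: h => // u v Nu Nv.
rewrite -hz; last exact: bN.
by apply: lP; apply: (sumspl n0sp); apply: brk_in.
Qed.

End LieIdeals.

(** * The part cut out by an idempotent that is central modulo the radical *)

Section CentralIdempotent.
Variables (n : nat) (N : 'M[K]_n -> Prop).
Hypothesis lN : lie N.
Local Notation R := (alg N).
Local Notation J := (trrad (alg N)).

Let Jsp : sp J := @trrad_alg_sp _ N.
Let Jl x y : R x -> J y -> J (x * y). Proof. exact: trrad_alg_mull. Qed.
Let Jr x y : J x -> R y -> J (x * y). Proof. exact: trrad_alg_mulr. Qed.
Let JR x : J x -> R x. Proof. by case. Qed.
Let trJ x : J x -> \tr x = 0. Proof. exact: trrad_trace. Qed.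
Let trJeq x y : J (x - y) -> \tr x = \tr y. Proof. exact: trrad_trace_eq. Qed.

Hypothesis perfN : forall x, N x -> exists u v, [/\ brk N u, N v, J v & x = u + v].
Variable eta : 'M[K]_n.
Hypothesis Reta : R eta.
Hypothesis etaC : forall y, N y -> J (br eta y).
Hypothesis eta2 : J (eta * eta - eta).

(** Centrality and idempotence of eta modulo J combine; a -> eta a thus carries the structure of N
    over to eta N + J. *)
Lemma etaM a b : R a -> R b -> J (eta * a * (eta * b) - eta * (a * b)).
Proof.
move=> Ra Rb.
have -> : eta * a * (eta * b) - eta * (a * b) = (eta * eta - eta) * (a * b) - eta * br eta a * b.
  by rewrite /br; non_commutative_ring.
apply: (spB Jsp); first by apply: Jr => //; apply: alg_mul.
by apply: Jr => //; apply: Jl => //; apply: central_alg.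
Qed.

(* Cartan's criterion is applied to the ideal eta I + J of the Lie algebra eta N + J. *)
Lemma traceless_ideal_eta I : lideal I N ->
  (forall x y, I x -> I y -> \tr (eta * (x * y)) = 0) -> forall x, I x -> J (eta * x).
Proof.
move=> lI; have [hI IN hNI] := lI; move=> tI x Ix; have [hN bN] := lN.
pose C (I : 'M[K]_n -> Prop) z := exists y, I y /\ J (z - eta * y).
have Csp I' : sp I' -> sp (C I').
  move=> hI'; split; first by exists 0; rewrite mulr0 subr0; split; apply: sp0.
  move=> a u v [y [Iy hy]] [z [Iz hz]]; exists (a *: y + z); split; first by case: hI' => _; apply.
  by rewrite mulrDr mxZr opprD addrACA -scalerBr; case: Jsp => _; apply.
have RN y : N y -> R y by apply: alg_in.
have Cbr y z u v : N y -> N z -> J (u - eta * y) -> J (v - eta * z) -> J (br u v - eta * br y z).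
  move=> /RN Ny /RN Nz hu hv.
  have -> : br u v - eta * br y z = (eta * y * (eta * z) - eta * (y * z)) - (eta * z * (eta * y) - eta * (z * y))
     + ((u - eta * y) * v - v * (u - eta * y)) + (eta * y * (v - eta * z) - (v - eta * z) * (eta * y)).
    by rewrite /br; non_commutative_ring.
  have Rv : R v by rewrite -[v](subrK (eta * z)); apply: (spD (alg_sp _)); [apply: JR | apply: alg_mul].
  have Ry : R (eta * y) by apply: alg_mul.
  apply: (spD Jsp); first apply: (spD Jsp).
  - by apply: (spB Jsp); apply: etaM.
  - by apply: (spB Jsp); [apply: Jr | apply: Jl].
  - by apply: (spB Jsp); [apply: Jl | apply: Jr].
have lL : lie (C N).
  split; first exact: Csp.
  by move=> u v [y [Ny hu]] [z [Nz hv]]; exists (br y z); split; [apply: bN | apply: Cbr].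
have IL : lideal (C I) (C N).
  split; first exact: Csp.
  - by move=> u [y [/IN Ny hy]]; exists y.
  - move=> u v [y [Ny hu]] [z [Iz hv]]; exists (br y z); split; [exact: hNI | apply: Cbr => //; exact: IN].
have CR u : C N u -> R u.
  by move=> [y [/RN Ry h]]; rewrite -[u](subrK (eta * y)); apply: (spD (alg_sp _)); [apply: JR | apply: alg_mul].
have tIL u v : C I u -> C I v -> \tr (u * v) = 0.
  move=> hu hv; have [y [Iy hy]] := hu; have [z [Iz hz]] := hv.
  rewrite (trJeq (y := eta * (y * z))); first exact: tI.
  have -> : u * v - eta * (y * z) = (u - eta * y) * v + eta * y * (v - eta * z) + (eta * y * (eta * z) - eta * (y * z)).
    by non_commutative_ring.
  have Ry := RN _ (IN _ Iy); have Rz := RN _ (IN _ Iz).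
  apply: (spD Jsp); first apply: (spD Jsp).
  - by apply: Jr => //; apply: CR; exists z; split=> //; apply: IN.
  - by apply: Jl => //; apply: alg_mul.
  - exact: etaM.
(* The criterion asks for elements of the derived algebra. Brackets lift, since eta [y,z] is
   [eta y, eta z] modulo J, and [perfN] writes x as a sum of brackets up to J. *)
have lift w : brk N w -> exists u, brk (C N) u /\ J (eta * w - u).
  apply: (brk_sub (P := fun w => exists u, brk (C N) u /\ J (eta * w - u))).
    split; first by exists 0; rewrite mulr0 subr0; split; apply: sp0 => //; exact: brk_sp.
    move=> a u v [u' [hu1 hu2]] [v' [hv1 hv2]]; exists (a *: u' + v').
    split; first by case: (brk_sp (C N)) => _; apply.
    by rewrite mulrDr mxZr opprD addrACA -scalerBr; case: Jsp => _; apply.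
  move=> y z Ny Nz; exists (br (eta * y) (eta * z)); split.
    by apply: brk_in; [exists y | exists z]; rewrite subrr; split=> //; apply: sp0.
  by apply: (spBC Jsp); apply: Cbr => //; rewrite subrr; apply: sp0.
have [w [v [Bw Nv Jv ex]]] := perfN (IN _ Ix).
have [u [Bu Ju]] := lift w Bw.
have hux : J (u - eta * x).
  rewrite (_ : u - eta * x = - (eta * w - u) - eta * v); last by rewrite ex; non_commutative_ring.
  by apply: (spB Jsp); [apply: spN | apply: Jl].
have [_ tu] : trrad (alg (C N)) u.
  apply: (traceless_ideal_rad lL IL tIL) => //; exists x; split=> //.
have JC j : J j -> alg (C N) j.
  by move=> Jj; apply: alg_in; exists 0; rewrite mulr0 subr0; split=> //; apply: sp0.
(* The radical found so far belongs to the algebra of eta N + J. It contains eta R, which transfers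
   the orthogonality to R. *)
have algC a : R a -> alg (C N) (eta * a).
  move=> Ra; suff [] : R a /\ alg (C N) (eta * a) by [].
  apply: (Ra (fun a => R a /\ alg (C N) (eta * a))).
  - by apply: sp_cap; [exact: alg_sp | apply: mul_spr; exact: alg_sp].
  - move=> a1 a2 [R1 h1] [R2 h2]; split; first exact: alg_mul.
    have -> : eta * (a1 * a2) = eta * a1 * (eta * a2) - (eta * a1 * (eta * a2) - eta * (a1 * a2)) by rewrite opprB addrC subrK.
    by apply: (spB (alg_sp _)); [apply: alg_mul | apply: JC; apply: etaM].
  - move=> y Ny; split; first exact: RN.
    by apply: alg_in; exists y; rewrite subrr; split=> //; apply: sp0.
have Rx := RN _ (IN _ Ix).
split; first exact: alg_mul.
move=> a Ra; rewrite -[RHS](tu _ (algC a Ra)).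
apply: trJeq; rewrite -mulrA.
have -> : eta * (x * a) - u * (eta * a) = - (eta * x * (eta * a) - eta * (x * a)) - (u - eta * x) * (eta * a).
  by non_commutative_ring.
by apply: (spB Jsp); [apply: spN => //; apply: etaM | apply: Jr => //; apply: alg_mul].
Qed.
End CentralIdempotent.

(** * Whitehead's lemma modulo the radical *)

Section Whitehead.
Variables (n : nat) (N : 'M[K]_n -> Prop).
Hypothesis lN : lie N.
Local Notation R := (alg N).
Local Notation J := (trrad (alg N)).

Let Jsp : sp J := @trrad_alg_sp _ N.
Let Jl x y : R x -> J y -> J (x * y). Proof. exact: trrad_alg_mull. Qed.
Let Jr x y : J x -> R y -> J (x * y). Proof. exact: trrad_alg_mulr. Qed.
Let JR x : J x -> R x. Proof. by case. Qed.
Let trJ x : J x -> \tr x = 0. Proof. exact: trrad_trace. Qed.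
Let trJeq x y : J (x - y) -> \tr x = \tr y. Proof. exact: trrad_trace_eq. Qed.
Let RN y : N y -> R y. Proof. exact: alg_in. Qed.
Let RM x y : R x -> R y -> R (x * y). Proof. exact: alg_mul. Qed.

Variable h : 'M[K]_n.
Hypothesis perfN : forall x, N x -> exists u v, [/\ brk N u, N v, J v & x = u + v].
Hypothesis Rh : R h.
Hypothesis hl : forall r, R r -> J (h * r - r).
Hypothesis hr : forall r, R r -> J (r * h - r).

Let hC y : R y -> J (br h y).
Proof.
move=> Ry; have -> : br h y = (h * y - y) - (y * h - y) by rewrite /br; non_commutative_ring.
by apply: (spB Jsp); [apply: hl | apply: hr].
Qed.

(** The case eta = h of [traceless_ideal_eta], as h is a unit modulo J. *)
Lemma traceless_ideal_J I : lideal I N ->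
  (forall x y, I x -> I y -> \tr (x * y) = 0) -> forall x, I x -> J x.
Proof.
move=> lI tI x Ix; have [hI IN hNI] := lI.
have Rx : R x by apply: RN; apply: (IN).
apply: (sp_of_sub Jsp (y := h * x)); first by apply: (spBC Jsp); apply: hl.
apply: (traceless_ideal_eta lN perfN Rh _ _ lI) => //.
- by move=> y Ny; apply: hC; apply: RN.
- exact: hl.
- move=> y z Iy Iz; rewrite -[RHS](tI y z Iy Iz); apply: trJeq; apply: hl.
  by apply: RM; apply: RN; apply: (IN).
Qed.

Lemma mult_by_N_J eta : R eta -> (forall y, N y -> J (eta * y)) -> forall a, R a -> J (eta * a).
Proof.
move=> Re he a Ra; suff [] : R a /\ J (eta * a) by [].
apply: (Ra (fun a => R a /\ J (eta * a))).
- by apply: sp_cap; [exact: alg_sp | apply: mul_spr].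
- by move=> u v [Ru hu] [Rv hv]; split; [exact: RM | rewrite mulrA; apply: Jr].
- by move=> y Ny; split; [apply: RN | apply: he].
Qed.

Section Casimir.
Variable eta : 'M[K]_n.
Hypothesis Reta : R eta.
Hypothesis etaC : forall y, N y -> J (br eta y).
Hypothesis eta2 : J (eta * eta - eta).
Hypothesis etaN : ~ (forall y, N y -> J (eta * y)).

(** [I] is the kernel of N acting on the eta-part modulo J, [I'] its orthogonal complement for the
    trace form, [n'] the radical on [I'] of the form tr (z eta x). The Casimir element lives on the
    quotient of [I'] by [n'], where this form is nondegenerate. *)
Let I x := N x /\ J (eta * x).
Let I' x := N x /\ forall z, I z -> \tr (x * z) = 0.
Let n' z := I' z /\ forall x, I' x -> \tr (z * (eta * x)) = 0.

Let trsp (f : 'M[K]_n -> 'M[K]_n) : (forall a x y, f (a *: x + y) = a *: f x + f y) -> sp (fun x => \tr (f x) = 0).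
Proof.
move=> lf; split.
  by have := lf (-1) 0 0; rewrite scaler0 addr0 scaleN1r addNr => ->; rewrite mxtrace0.
by move=> a x y hx hy; rewrite lf linearD linearZ /= hx hy mulr0 addr0.
Qed.

Let Isp : sp I.
Proof. by apply: sp_cap; [case: lN | apply: mul_spr]. Qed.
Let lI : lideal I N.
Proof.
split=> [||x y Nx [Ny hy]]; [exact: Isp | by move=> x [] |].
split; first by case: lN => _; apply.
have -> : eta * br x y = x * (eta * y) + br eta x * y - eta * y * x by rewrite /br; non_commutative_ring.
apply: (spB Jsp); last by apply: Jr => //; apply: RN.
by apply: (spD Jsp); [apply: Jl => //; apply: RN | apply: Jr; [apply: etaC | apply: RN]].
Qed.
Let I'sp : sp I'.
Proof.
apply: sp_cap; first by case: lN.
apply: (@sp_all _ _ I (fun z x => \tr (x * z) = 0)) => z _.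
by apply: trsp => a x y; rewrite mulrDl mxZl.
Qed.
Let I'ideal x y : N x -> I' y -> I' (br x y).
Proof.
move=> Nx [Ny hy]; split; first by case: lN => _; apply.
move=> z Iz; rewrite brN mulNr linearN /= trace_br hy ?oppr0 //.
by case: lI => _ _; apply.
Qed.
Let n'sp : sp n'.
Proof.
apply: sp_cap => //.
apply: (@sp_all _ _ I' (fun x z => \tr (z * (eta * x)) = 0)) => x _.
by apply: trsp => a y z; rewrite mulrDl mxZl.
Qed.

(** The elements of I orthogonal to I form a traceless ideal. *)
Let I_I'_J x : I x -> (forall z, I z -> \tr (x * z) = 0) -> J x.
Proof.
move=> Ix hx; pose I0 x := I x /\ forall z, I z -> \tr (x * z) = 0.
apply: (@traceless_ideal_J I0) => //.
- split=> [||y z Ny [Iz hz]].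
  + apply: sp_cap => //; apply: (@sp_all _ _ I (fun z x => \tr (x * z) = 0)) => z _.
    by apply: trsp => a u v; rewrite mulrDl mxZl.
  + by move=> y [[]].
  + split; first by case: lI => _ _; apply.
    move=> t It; rewrite brN mulNr linearN /= trace_br hz ?oppr0 //.
    by case: lI => _ _; apply.
- by move=> y z [Iy hy] [Iz _]; apply: hy.
Qed.

(** The trace form on I is nondegenerate modulo J, so tr (y -) on I is represented by some x in I,
    and y - x lies in [I']. *)
Let decomp y : N y -> exists x x', [/\ I x, I' x' & y = x + x'].
Proof.
move=> Ny.
have [||||x [Ix hx]] := @riesz_representation _ I (fun x y => \tr (x * y)) (fun z => \tr (y * z)) Isp.
- by move=> a u u' v; rewrite mulrDl mxZl linearD linearZ.
- by move=> a u u' v; rewrite mulrDr mxZr linearD linearZ.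
- by move=> a u u'; rewrite mulrDr mxZr linearD linearZ.
- move=> z Iz hz; apply: trJ; apply: Jl; first exact: RN.
  by apply: I_I'_J => // t It; rewrite mxtr_mulC; apply: hz.
exists x, (y - x); split=> //; last by rewrite addrC subrK.
split; first by apply: spB => //; [case: lN | case: Ix].
by move=> z Iz; rewrite mulrBl linearB /= hx // subrr.
Qed.

(** z is orthogonal to eta I' by definition and to eta I because eta I lies in J, hence to eta N. So
    eta z is in J, which puts z into both I and [I']. *)
Let n'J z : n' z -> J z.
Proof.
move=> [[Nz hz] hz']; have Rz := RN Nz.
pose Z z := N z /\ forall y, N y -> \tr (z * (eta * y)) = 0.
have Zz : Z z.
  split=> // y /decomp [x [x' [[Nx Ix] Ix' ->]]].
  rewrite !mulrDr linearD /= (hz' _ Ix') addr0; apply: trJ; exact: Jl.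
have lZ : lideal Z N.
  split=> [||x y Nx [Ny hy]].
  - apply: sp_cap; first by case: lN.
    apply: (@sp_all _ _ N (fun x z => \tr (z * (eta * x)) = 0)) => x _.
    by apply: trsp => a u v; rewrite mulrDl mxZl.
  - by move=> x [].
  - have bN := proj2 lN; split; first exact: bN.
    move=> t Nt; have [[Rx Ry] Rt] := ((RN Nx, RN Ny), RN Nt).
    have e : \tr (br x y * (eta * t)) = \tr (y * (eta * br t x)) + \tr (y * br eta x * t).
      transitivity (\tr (y * (eta * t) * x - y * x * (eta * t))).
        by rewrite {1}/br mulrBl !linearB /= -[x * y * _]mulrA mxtr_mulC.
      by rewrite -linearD /=; congr (\tr _); rewrite /br; non_commutative_ring.
    rewrite e hy ?add0r; last exact: bN.
    by apply: trJ; apply: Jr => //; apply: Jl => //; apply: etaC.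
have Jez : J (eta * z).
  apply: (traceless_ideal_eta lN perfN Reta etaC eta2 lZ) => //.
  move=> u v [Nu hu] [Nv _]; rewrite -[RHS](hu v Nv); apply: trJeq.
  have -> : eta * (u * v) - u * (eta * v) = br eta u * v by rewrite /br; non_commutative_ring.
  by apply: Jr; [apply: etaC | apply: RN].
by apply: I_I'_J.
Qed.

(* The Casimir element of I' for the form tr (x eta y), in coordinates: [H] is the inverse
   Gram matrix of a basis of I' modulo the radical n'. *)
Lemma casimir : exists k (x : 'I_k -> 'M[K]_n) (H : 'M[K]_k),
  [/\ (0 < k)%N, forall i, N (x i),
      \sum_i \sum_j H i j * \tr (x i * (eta * x j)) = k%:R &
      forall (S : 'M[K]_n -> Prop) (F : 'M[K]_n -> 'M[K]_n -> 'M[K]_n) y, sp S -> N y ->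
        (forall a u u' v, F (a *: u + u') v = a *: F u v + F u' v) ->
        (forall a u u' v, F v (a *: u + u') = a *: F v u + F v u') ->
        (forall z i, N z -> J z -> S (F z (x i)) /\ S (F (x i) z)) ->
        S (\sum_i \sum_j H i j *: (F (br (x i) y) (x j) + F (x i) (br (x j) y)))].
Proof.
have [U hU] := sp_vspace I'sp; have [W hW] := sp_vspace n'sp.
pose U'' := (U :\: W)%VS; pose k := \dim U''; pose X := vbasis U''.
pose x (i : 'I_k) := X`_i.
have WU : (W <= U)%VS by apply/subvP => z /hW [/hU].
have U''U : (U'' <= U)%VS by apply: diffvSl.
have xU i : x i \in U'' by apply: vbasis_mem; apply: mem_nth; rewrite size_tuple.
have xI i : I' (x i) by apply/hU; apply: (subvP U''U).
have xN i : N (x i) by case: (xI i).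
have coords z : I' z -> exists (c : 'I_k -> K) w, [/\ N w, J w & z = \sum_i c i *: x i + w].
  move=> /hU; have -> : U = (U'' + W)%VS.
    apply/eqP; rewrite eqEsubv subv_add U''U WU !andbT.
    by rewrite -{1}(addv_diff_cap U W); apply: addvS => //; apply: capvSr.
  move=> /memv_addP [u uU [w /hW nw ->]]; exists (fun i => coord X i u), w.
  by split; [case: nw => -[] | exact: n'J | rewrite {1}(coord_vbasis uU)].
have RNx i : R (x i) by apply: RN.
pose G := \matrix_(i, j) \tr (x i * (eta * x j)).
have Gsym i j : \tr (x i * (eta * x j)) = \tr (x j * (eta * x i)).
  rewrite mxtr_mulC; apply: trJeq.
  have -> : eta * x j * x i - x j * (eta * x i) = br eta (x j) * x i by rewrite /br; non_commutative_ring.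
  by apply: Jr => //; apply: etaC.
have Gu : G \in unitmx.
  rewrite -row_free_unit; apply: inj_row_free => v hv.
  pose z := \sum_i v 0 i *: x i.
  have zU : z \in U'' by apply: memv_suml => i _; apply: memvZ.
  have zI : I' z by apply/hU; apply: (subvP U''U).
  have zx j : \tr (z * (eta * x j)) = 0.
    have := congr1 (fun M : 'rV_k => M 0 j) hv; rewrite !mxE => h0; rewrite -[RHS]h0.
    rewrite mulr_suml linear_sum; apply: eq_bigr => i _.
    by rewrite mxZl linearZ mxE.
  have zW : z \in W.
    apply/hW; split=> // t /coords [c [w [Nw Jw ->]]].
    rewrite !mulrDr linearD /= [\tr (z * (eta * w))]trJ ?addr0; last first.
      by apply: Jl; [apply: RN; case: zI | apply: Jl].
    rewrite mulr_sumr mulr_sumr linear_sum big1 // => i _.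
    by rewrite !mxZr linearZ /= zx mulr0.
  have z0 : z = 0.
    by apply/eqP; rewrite -memv0 -(capv_diff U W) memv_cap zU zW.
  have fr : free X := basis_free (vbasisP U'').
  have /freeP := fr => /(_ (fun i => v 0 i) z0) hv0.
  by apply/rowP => i; rewrite hv0 mxE.
exists k, x, (invmx G); split=> //.
(* With k = 0 all of [I'] would lie in J, and then so would eta N. *)
- rewrite lt0n; apply/eqP => k0; apply: etaN => y /decomp [u [v [[Nu Iu] Iv ->]]].
  rewrite mulrDr; apply: (spD Jsp) => //; apply: Jl => //.
  have [c [w [_ Jw ->]]] := coords v Iv.
  by rewrite big1 ?add0r // => i _; have := ltn_ord i; rewrite {2}k0.
- transitivity (\tr (invmx G *m G)); last by rewrite mulVmx // mxtrace1.
  apply: eq_bigr => i _; rewrite mxE; apply: eq_bigr => j _.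
  by rewrite mxE Gsym.
move=> S F y hS Ny Fl Fr FJ.
have /dep_choice [A /dep_choice [w hw]] : forall i, exists (c : 'I_k -> K) w,
    [/\ N w, J w & br (x i) y = \sum_j c j *: x j + w].
  move=> i; apply: coords; rewrite brN; apply: spN => //; exact: I'ideal.
have F0l u : F 0 u = 0.
  by have := Fl (-1) 0 0 u; rewrite scaler0 addr0 scaleN1r addNr.
have F0r u : F u 0 = 0.
  by have := Fr (-1) 0 0 u; rewrite scaler0 addr0 scaleN1r addNr.
have Fsl m (c : 'I_m -> K) (g : 'I_m -> 'M[K]_n) u w' : F (\sum_i c i *: g i + w') u = \sum_i c i *: F (g i) u + F w' u.
  elim: m c g => [|m ih] c g; first by rewrite !big_ord0 !add0r.
  by rewrite !big_ord_recl -addrA Fl ih addrA.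
have Fsr m (c : 'I_m -> K) (g : 'I_m -> 'M[K]_n) u w' : F u (\sum_i c i *: g i + w') = \sum_i c i *: F u (g i) + F u w'.
  elim: m c g => [|m ih] c g; first by rewrite !big_ord0 !add0r.
  by rewrite !big_ord_recl -addrA Fr ih addrA.
pose B := \matrix_(i, j) A i j.
(* Invariance of the form tr (u eta v) under bracketing with y, in coordinates. Multiplying by the
   inverse Gram matrix on both sides gives [HA], the invariance of the Casimir tensor. *)
have AG : B *m G + G *m B^T = 0.
  apply/matrixP => i l; rewrite !mxE.
  have e1 : \tr (br (x i) y * (eta * x l)) = \sum_j B i j * G j l.
    have [_ Jw ->] := hw i; rewrite mulrDl linearD /= [\tr (w i * _)]trJ ?addr0; last first.
      by apply: Jr => //; apply: RM.
    rewrite mulr_suml linear_sum; apply: eq_bigr => j _.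
    by rewrite mxZl linearZ /= !mxE.
  have e2 : \tr (x i * (eta * br (x l) y)) = \sum_j G i j * B^T j l.
    have [Nw Jw ->] := hw l; rewrite !mulrDr linearD /= [\tr (x i * (eta * w l))]trJ ?addr0; last first.
      by apply: Jl => //; apply: Jl.
    rewrite mulr_sumr mulr_sumr linear_sum; apply: eq_bigr => j _.
    by rewrite !mxZr linearZ /= !mxE mulrC.
  rewrite -e1 -e2 -linearD /=.
  have Ry := RN Ny.
  have -> : br (x i) y * (eta * x l) + x i * (eta * br (x l) y)
      = br (x i * (eta * x l)) y - x i * br eta y * x l.
    by rewrite /br; non_commutative_ring.
  rewrite linearB /= [\tr (_ * x l)]trJ ?subr0; last first.
    by apply: Jr => //; apply: Jl => //; apply: etaC.
  by rewrite /br linearB /= mxtr_mulC subrr.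
have HA : invmx G *m B + B^T *m invmx G = 0.
  have := congr1 (fun M => invmx G *m M *m invmx G) AG.
  rewrite mulmxDr mulmxDl mulmx0 mul0mx !mulmxA mulVmx // mul1mx -mulmxA mulmxV // mulmx1.
  by rewrite addrC.
have main : \sum_i \sum_j invmx G i j *: (F (\sum_l A i l *: x l) (x j) + F (x i) (\sum_l A j l *: x l)) = 0.
  pose T1 := \sum_l \sum_j (B^T *m invmx G) l j *: F (x l) (x j).
  pose T2 := \sum_i \sum_l (invmx G *m B) i l *: F (x i) (x l).
  transitivity (T1 + T2).
    transitivity (\sum_i \sum_j (\sum_l (invmx G i j * A i l) *: F (x l) (x j)
                    + \sum_l (invmx G i j * A j l) *: F (x i) (x l))).
      apply: eq_bigr => i _; apply: eq_bigr => j _; rewrite scalerDr; congr (_ + _).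
        have := Fsl k (A i) x (x j) 0; rewrite addr0 F0l addr0 => ->.
        by rewrite scaler_sumr; apply: eq_bigr => l _; rewrite scalerA.
      have := Fsr k (A j) x (x i) 0; rewrite addr0 F0r addr0 => ->.
      by rewrite scaler_sumr; apply: eq_bigr => l _; rewrite scalerA.
    under eq_bigr do rewrite big_split /=.
    rewrite big_split /=; congr (_ + _).
      rewrite /T1; under [RHS]eq_bigr do under eq_bigr do rewrite mxE scaler_suml.
      rewrite exchange_big /= [RHS]exchange_big /=; apply: eq_bigr => j _.
      rewrite exchange_big /=; apply: eq_bigr => l _; apply: eq_bigr => i _.
      by rewrite !mxE mulrC.
    rewrite /T2; apply: eq_bigr => i _; rewrite exchange_big /=; apply: eq_bigr => l _.
    by rewrite mxE scaler_suml; apply: eq_bigr => j _; rewrite !mxE.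
  rewrite /T1 /T2 -big_split /= big1 // => i _; rewrite -big_split /= big1 // => j _.
  rewrite -scalerDl; have := congr1 (fun M : 'M_k => M i j) HA; rewrite !mxE addrC => ->.
  by rewrite scale0r.
have -> : \sum_i \sum_j invmx G i j *: (F (br (x i) y) (x j) + F (x i) (br (x j) y))
   = \sum_i \sum_j invmx G i j *: (F (w i) (x j) + F (x i) (w j)).
  transitivity (\sum_i \sum_j invmx G i j *: (F (\sum_l A i l *: x l) (x j) + F (x i) (\sum_l A j l *: x l))
      + \sum_i \sum_j invmx G i j *: (F (w i) (x j) + F (x i) (w j))); last by rewrite main add0r.
  rewrite -big_split /=; apply: eq_bigr => i _.
  rewrite -big_split /=; apply: eq_bigr => j _.
  have [_ _ ei] := hw i; have [_ _ ej] := hw j.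
  have := Fsl k (A i) x (x j) 0; rewrite addr0 F0l addr0 => e1.
  have := Fsr k (A j) x (x i) 0; rewrite addr0 F0r addr0 => e2.
  by rewrite -scalerDr e1 e2 ei ej Fsl Fsr addrACA.
apply: sp_sum => // i _; apply: sp_sum => // j _; apply: spZ => //; apply: spD => //.
  by have [Nw Jw _] := hw i; case: (FJ (w i) j Nw Jw).
by have [Nw Jw _] := hw j; case: (FJ (w j) i Nw Jw).
Qed.
End Casimir.

Variables (Q : 'M[K]_n -> Prop) (beta : 'M[K]_n -> 'M[K]_n).
Hypothesis Qsp : sp Q.
Hypothesis Qr : forall q r, Q q -> R r -> Q (q * r).
Hypothesis QRJ : forall r j, R r -> J j -> Q (r * j).
Hypothesis Rbeta : forall x, N x -> R (beta x).
Hypothesis beta_lin : forall a x y, beta (a *: x + y) = a *: beta x + beta y.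
Hypothesis beta_cocycle : forall x y, N x -> N y -> Q (beta (br x y) - beta x * y + beta y * x).
Hypothesis beta_J : forall x, N x -> J x -> Q (beta x).

Let betaD x y : beta (x + y) = beta x + beta y.
Proof. by rewrite -[x]scale1r beta_lin !scale1r. Qed.

(** The c in R that are central modulo J and for which the cocycle y -> beta y c is a coboundary
    modulo Q form an algebra [Om]. A largest idempotent e of [Om] leaves eta = h - e. If eta N were
    not in J, the Casimir element c of eta would be in [Om] with trace k > 0, while c - e c is
    nilpotent and e c is in J. So eta is in J, and beta itself is a coboundary. *)
Theorem whitehead : exists b, R b /\ forall y, N y -> Q (beta y - b * y).
Proof.
pose Om c := R c /\ (forall y, N y -> J (br c y)) /\
  exists b, R b /\ forall y, N y -> Q (beta y * c - b * y).
have Omsp : sp Om.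
  split.
    split; first exact: sp0 (alg_sp _).
    split; first by move=> y _; rewrite br0l; apply: sp0.
    exists 0; split; first exact: sp0 (alg_sp _).
    by move=> y _; rewrite mulr0 mul0r subr0; apply: sp0.
  move=> a u v [Ru [hu [b [Rb hb]]]] [Rv [hv [c [Rc hc]]]]; split.
    by case: (@alg_sp _ N) => _; apply.
  split; first by move=> y Ny; rewrite brDl brZl; case: Jsp => _; apply; [apply: hu | apply: hv].
  exists (a *: b + c); split; first by case: (@alg_sp _ N) => _; apply.
  move=> y Ny; rewrite mulrDr mulrDl mxZr mxZl opprD addrACA -scalerBr.
  by case: Qsp => _; apply; [apply: hb | apply: hc].
have Ommc : mulclosed Om.
  move=> u v [Ru [hu [b [Rb hb]]]] [Rv [hv _]]; split; first exact: RM.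
  split.
    by move=> y Ny; rewrite brMl; apply: (spD Jsp); [apply: Jl => //; apply: hv | apply: Jr => //; apply: hu].
  exists (b * v); split; first exact: RM.
  move=> y Ny.
  have -> : beta y * (u * v) - b * v * y = (beta y * u - b * y) * v - b * br v y.
    by rewrite /br; non_commutative_ring.
  by apply: spB => //; [apply: Qr => //; apply: hb | apply: QRJ => //; apply: hv].
have [e [Ome ee he]] := idem_mod_nil Omsp Ommc.
have [Re [eC [b0 [Rb0 hb0]]]] := Ome.
pose eta := h - e.
have Reta : R eta by apply: (spB (alg_sp _)).
have etaC y : N y -> J (br eta y).
  by move=> Ny; rewrite brBl; apply: (spB Jsp); [apply: hC; apply: RN | apply: eC].
have Jhe : J (eta * e).
  have -> : eta * e = (h * e - e) + (e - e * e) by rewrite /eta; non_commutative_ring.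
  by rewrite ee subrr addr0; apply: hl.
have Jeh : J (e * eta).
  have -> : e * eta = (e * h - e) + (e - e * e) by rewrite /eta; non_commutative_ring.
  by rewrite ee subrr addr0; apply: hr.
have eta2 : J (eta * eta - eta).
  have -> : eta * eta - eta = (h * eta - eta) - e * eta by rewrite {1}/eta; non_commutative_ring.
  by apply: (spB Jsp) => //; apply: hl.
have Jeta : J eta.
  have [etaN|etaN] := classic (forall y, N y -> J (eta * y)).
    apply: (sp_of_sub Jsp (y := eta * h)); first by apply: (spBC Jsp); apply: hr.
    exact: mult_by_N_J.
  have [k [x [H [k0 xN trc inv]]]] := casimir Reta etaC eta2 etaN.
  have xR i := RN (xN i).
  pose c := \sum_i \sum_j H i j *: (x i * (eta * x j)).
  have Rterm i j : R (x i * (eta * x j)) by apply: RM => //; apply: RM.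
  have Rc : R c.
    rewrite /c; apply: (sp_sum _ (alg_sp N)) => i _; apply: (sp_sum _ (alg_sp N)) => j _.
    exact: (spZ _ (alg_sp N)).
  have Omc : Om c.
    split=> //; split.
      move=> y Ny; have Ry := RN Ny.
      have := inv J (fun a b => a * (eta * b)) y Jsp Ny.
      move=> hinv; have {hinv} : J (\sum_i \sum_j H i j *: (br (x i) y * (eta * x j) + x i * (eta * br (x j) y))).
        apply: hinv.
        - by move=> a u u' v; rewrite mulrDl mxZl.
        - by move=> a u u' v; rewrite !mulrDr !mxZr.
        - move=> z i Nz Jz; split; first by apply: Jr => //; apply: RM.
          by apply: Jl => //; apply: Jl.
      apply: sp_of_sub => //.
      have -> : br c y = \sum_i \sum_j H i j *: br (x i * (eta * x j)) y.
        rewrite /br /c mulr_suml mulr_sumr -sumrB; apply: eq_bigr => i _.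
        rewrite mulr_suml mulr_sumr -sumrB; apply: eq_bigr => j _.
        by rewrite mxZl mxZr scalerBr.
      rewrite -sumrB; apply: sp_sum => // i _; rewrite -sumrB; apply: sp_sum => // j _.
      rewrite -scalerBr; apply: spZ => //.
      rewrite (_ : _ - _ = x i * br eta y * x j); last by rewrite /br; non_commutative_ring.
      by apply: Jr => //; apply: Jl => //; apply: etaC.
    (* The primitive arises by applying beta to the left factors of the Casimir element. *)
    pose b := \sum_i \sum_j H i j *: (beta (x i) * (eta * x j)).
    have Rb : R b.
      rewrite /b; apply: (sp_sum _ (alg_sp N)) => i _; apply: (sp_sum _ (alg_sp N)) => j _; apply: (spZ _ (alg_sp N)).
      by apply: RM; [apply: Rbeta | apply: RM].
    exists b; split=> // y Ny; have Ry := RN Ny.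
    have hinv : Q (\sum_i \sum_j H i j *: (beta (br (x i) y) * (eta * x j) + beta (x i) * (eta * br (x j) y))).
      apply: (inv Q (fun a b => beta a * (eta * b)) y) => //.
      - by move=> a u u' v; rewrite beta_lin mulrDl mxZl.
      - by move=> a u u' v; rewrite !mulrDr !mxZr.
      - move=> z i Nz Jz; split; first by apply: Qr; [apply: beta_J | apply: RM].
        by apply: QRJ; [apply: Rbeta | apply: Jl].
    have -> : beta y * c - b * y = \sum_i \sum_j H i j *: (beta y * (x i * (eta * x j)) - beta (x i) * (eta * x j) * y).
      rewrite /c /b mulr_suml mulr_sumr -sumrB; apply: eq_bigr => i _.
      rewrite mulr_suml mulr_sumr -sumrB; apply: eq_bigr => j _.
      by rewrite mxZl mxZr scalerBr.
    apply: (sp_of_sub Qsp (y := - \sum_i \sum_j H i j *: (beta (br (x i) y) * (eta * x j) + beta (x i) * (eta * br (x j) y)))); last exact: spN.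
    rewrite opprK -big_split /=; apply: sp_sum => // i _; rewrite -big_split /=; apply: sp_sum => // j _.
    rewrite -scalerDr; apply: spZ => //.
    have e1 u v w z : beta y * (u * (eta * v)) - w * (eta * v) * y + (z * (eta * v) + w * (eta * br v y))
        = (z - w * y + beta y * u) * (eta * v) - w * (br eta y * v) by rewrite /br; non_commutative_ring.
    rewrite e1.
    apply: spB => //; first by apply: Qr; [apply: beta_cocycle | apply: RM].
    by apply: QRJ; [apply: Rbeta | apply: Jr => //; apply: etaC].
  have tc : \tr c = k%:R.
    rewrite -trc linear_sum; apply: eq_bigr => i _; rewrite linear_sum; apply: eq_bigr => j _.
    by rewrite linearZ.
  have tec : \tr (e * c) = 0.
    apply: trJ; rewrite mulr_sumr; apply: sp_sum => // i _; rewrite mulr_sumr; apply: sp_sum => // j _.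
    rewrite mxZr; apply: spZ => //.
    have -> : e * (x i * (eta * x j)) = x i * (e * eta * x j) + br e (x i) * (eta * x j).
      by rewrite /br; non_commutative_ring.
    apply: (spD Jsp); first by apply: Jl => //; apply: Jr.
    by apply: Jr; [apply: eC | apply: RM].
  have := trace_nilp (he c Omc); rewrite linearB /= tec subr0 tc => /eqP.
  by rewrite cplx_char0 => /eqP k00; rewrite k00 in k0.
(* Up to Q, the cocycle identity ends beta of a bracket in a right factor from N, on which h acts as
   a unit modulo J. *)
have betah y : N y -> Q (beta y - beta y * h).
  move=> Ny; have [u [v [Bu Nv Jv ->]]] := perfN Ny.
  rewrite betaD mulrDl opprD addrACA; apply: spD => //; last first.
    by apply: spB => //; [apply: beta_J | apply: Qr => //; apply: beta_J].
  apply: (brk_sub (P := fun u => Q (beta u - beta u * h))) Bu.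
    split.
      have b0' : beta 0 = 0 by have := beta_lin (-1) 0 0; rewrite scaler0 addr0 scaleN1r addNr.
      by rewrite b0' mul0r subr0; apply: sp0.
    move=> a s t hs ht; rewrite beta_lin mulrDl mxZl opprD addrACA -scalerBr.
    by case: Qsp => _; apply.
  move=> s t Ns Nt; have [Rs Rt] := (RN Ns, RN Nt).
  set q := beta (br s t) - beta s * t + beta t * s.
  have Qq : Q q by apply: beta_cocycle.
  have -> : beta (br s t) - beta (br s t) * h = q - q * h - beta s * (t * h - t) + beta t * (s * h - s).
    by rewrite /q; non_commutative_ring.
  apply: spD => //; last by apply: QRJ; [apply: Rbeta | apply: hr].
  apply: spB => //; last by apply: QRJ; [apply: Rbeta | apply: hr].
  by apply: spB => //; apply: Qr.
exists b0; split=> // y Ny.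
have -> : beta y - b0 * y = (beta y - beta y * h) + (beta y * e - b0 * y) + beta y * eta.
  by rewrite /eta; non_commutative_ring.
by apply: spD => //; [apply: spD => //; [apply: betah | apply: hb0] | apply: QRJ => //; apply: Rbeta].
Qed.
End Whitehead.

(** * A Levi subalgebra containing a prescribed subspace *)

Section DerivedSeries.
Variable n : nat.
Fixpoint dser k (I : 'M[K]_n -> Prop) := if k is k'.+1 then brk (dser k' I) else I.

Lemma dser_ideal k I S : lideal I S -> lie S -> lideal (dser k I) S.
Proof.
move=> lI lS; elim: k => //= k [Dsp DS Dbr]; split; first exact: brk_sp.
  by move=> x; apply: (brk_sub (P := S)); [case: lS | move=> u v Du Dv; apply: (DS); apply: Dbr => //; apply: (DS)].
move=> x y Sx; apply: (brk_sub (P := fun y => brk (dser k I) (br x y))).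
  by apply: br_spr; exact: brk_sp.
move=> u v Du Dv; rewrite jacobi; apply: (spD (brk_sp (dser k I))).
  by apply: (brk_in (N := dser k I)) => //; apply: Dbr.
by apply: (brk_in (N := dser k I)) => //; apply: Dbr.
Qed.
End DerivedSeries.

Section LeviSubalgebra.
Variables (n : nat) (star : 'M[K]_n -> 'M[K]_n).
Hypothesis star_lin : forall a x y, star (a *: x + y) = a *: star x + star y.
Hypothesis starM : forall x y, star (x * y) = star y * star x.
Hypothesis starK : forall x, star (star x) = x.
Hypothesis star_tr : forall x, \tr (star x) = \tr x.

Let star0 : star 0 = 0.
Proof. by have := star_lin (-1) 0 0; rewrite scaler0 addr0 scaleN1r addNr. Qed.
Let starD x y : star (x + y) = star x + star y.
Proof. by rewrite -[x]scale1r star_lin !scale1r. Qed.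
Let starN x : star (- x) = - star x.
Proof. by rewrite -[- x]scaleN1r -[_ *: x]addr0 star_lin star0 addr0 scaleN1r. Qed.
Let starB x y : star (x - y) = star x - star y.
Proof. by rewrite starD starN. Qed.

Variables (N M J0 : 'M[K]_n -> Prop).
Local Notation A := (alg N).
Local Notation Jh := (trrad (alg N)).
Definition unit_ext (P : 'M[K]_n -> Prop) a := exists c b, P b /\ a = c%:M + b.
Local Notation A1 := (unit_ext (alg N)).

Hypothesis lN : lie N.
Hypothesis skewN : forall x, N x -> star x = - x.
Hypothesis Mbrk : forall m, M m -> brk N m.
Hypothesis J0sp : sp J0.
Hypothesis J0l : forall a j, A a -> J0 j -> J0 (a * j).
Hypothesis J0r : forall j a, J0 j -> A a -> J0 (j * a).
Hypothesis J0star : forall j, J0 j -> J0 (star j).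
Hypothesis J0rad : forall j, J0 j -> Jh j.
Hypothesis J0M : forall a,
  lspan (fun z => M z \/ exists m c m', [/\ M m, A1 c, M m' & z = m * c * m']) a -> Jh a -> J0 a.

Let Jhsp : sp Jh. Proof. exact: trrad_alg_sp. Qed.
Let Jhl x y : A x -> Jh y -> Jh (x * y). Proof. exact: trrad_alg_mull. Qed.
Let Jhr x y : Jh x -> A y -> Jh (x * y). Proof. exact: trrad_alg_mulr. Qed.
Let AM x y : A x -> A y -> A (x * y). Proof. exact: alg_mul. Qed.
Let AN x : N x -> A x. Proof. exact: alg_in. Qed.
Let MN m : M m -> N m. Proof. by move/Mbrk; apply: lie_brk. Qed.

Let A1l (P : 'M[K]_n -> Prop) c y : sp P -> (forall a x, A a -> P x -> P (a * x)) -> A1 c -> P y -> P (c * y).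
Proof.
move=> hP h [d [b [Ab ->]]] Py; rewrite mulrDl mxSl.
by apply: (spD hP); [apply: spZ | apply: h].
Qed.
Let A1r (P : 'M[K]_n -> Prop) c y : sp P -> (forall a x, A a -> P x -> P (x * a)) -> A1 c -> P y -> P (y * c).
Proof.
move=> hP h [d [b [Ab ->]]] Py; rewrite mulrDr mxSr.
by apply: (spD hP); [apply: spZ | apply: h].
Qed.
Let A1_in a : A a -> A1 a.
Proof.
by move=> Aa; exists 0, a; split=> //; rewrite (_ : 0%:M = 0) ?add0r //; apply/matrixP => i j; rewrite !mxE mul0rn.
Qed.
Let A1_1 : A1 1.
Proof. by exists 1, 0; split; [exact: sp0 (alg_sp _) | rewrite addr0]. Qed.
Let A1Ml a c : A a -> A1 c -> A1 (a * c).
Proof. by move=> Aa A1c; apply: A1_in; apply: (A1r (alg_sp _)) => // *; apply: AM. Qed.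
Let A1Mr a c : A a -> A1 c -> A1 (c * a).
Proof. by move=> Aa A1c; apply: A1_in; apply: (A1l (alg_sp _)) => // *; apply: AM. Qed.

Let T := lspan (fun z => exists a m b, [/\ A1 a, M m, A1 b & z = a * m * b]).
Let Tsp : sp T. Proof. exact: lspan_sp. Qed.
Let TA t : T t -> A t.
Proof.
move=> Tt; apply: (Tt A); first exact: alg_sp.
move=> _ [a [m [b [ha Mm hb ->]]]].
have Am : A m by apply: AN; apply: MN.
apply: (A1r (alg_sp _)) => // [*|]; first exact: AM.
by apply: (A1l (alg_sp _)) => // *; apply: AM.
Qed.
Let Tl a t : A a -> T t -> T (a * t).
Proof.
move=> Aa Tt; apply: (Tt (fun t => T (a * t))); first exact: mul_spr.
move=> _ [c [m [b [hc Mm hb ->]]]]; apply: lspan_in; exists (a * c), m, b.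
by split; rewrite ?mulrA //; apply: A1Ml.
Qed.
Let Tr a t : A a -> T t -> T (t * a).
Proof.
move=> Aa Tt; apply: (Tt (fun t => T (t * a))); first exact: mul_spl.
move=> _ [c [m [b [hc Mm hb ->]]]]; apply: lspan_in; exists c, m, (b * a).
by split; rewrite ?mulrA //; apply: A1Mr.
Qed.
(** Between two elements of M the factor b j a' lies in the radical [Jh], an ideal of A. The product
    is therefore both in [Jh] and in M A1 M, where [J0M] applies. *)
Let TJT t j t' : T t -> Jh j -> T t' -> J0 (t * j * t').
Proof.
move=> Tt Jj Tt'.
apply: (Tt (fun t => J0 (t * j * t'))); first exact: (mul_spl j (mul_spl t' J0sp)).
move=> _ [a [m [b [ha Mm hb ->]]]].
apply: (Tt' (fun t' => J0 (a * m * b * j * t'))); first by apply: mul_spr.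
move=> _ [a' [m' [b' [ha' Mm' hb' ->]]]].
have -> : a * m * b * j * (a' * m' * b') = a * (m * (b * j * a') * m') * b' by rewrite !mulrA.
apply: (A1r J0sp (fun a x Aa h => J0r h Aa)) => //.
apply: (A1l J0sp (fun a x Aa h => J0l Aa h)) => //.
have Jc : Jh (b * j * a').
  apply: (A1r Jhsp (fun a x Aa h => Jhr h Aa)) => //.
  exact: (A1l Jhsp (fun a x Aa h => Jhl Aa h)).
apply: J0M.
  apply: lspan_in; right; exists m, (b * j * a'), m'; split=> //.
  by apply: A1_in; case: Jc.
by apply: Jhr; [apply: Jhl => //; apply: AN; apply: MN | apply: AN; apply: MN].
Qed.

Let N' x := [/\ N x, T x & brk N x].
Let lN'N : lideal N' N.
Proof.
have [hN bN] := lN; split=> [|x [] //|x y Nx [Ny Ty By]].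
  split; first by split; apply: sp0 => //; exact: brk_sp.
  move=> a x y [h1 h2 h3] [h4 h5 h6].
  by split; [case: hN => _; apply | case: Tsp => _; apply | case: (brk_sp N) => _; apply].
split; [exact: bN | | exact: brk_in].
by apply: (spB Tsp); [apply: Tl => //; apply: AN | apply: Tr => //; apply: AN].
Qed.
Let N'sp : sp N'. Proof. by case: lN'N. Qed.
Let N'N x : N' x -> N x. Proof. by case. Qed.
Let lN' : lie N'.
Proof. by split=> // x y hx hy; case: lN'N => _ _; apply => //; apply: N'N. Qed.
Let MN' m : M m -> N' m.
Proof.
move=> Mm; split; [exact: MN | | exact: Mbrk].
by apply: lspan_in; exists 1, m, 1; rewrite mul1r mulr1.
Qed.

Local Notation R := (alg N').
Local Notation J := (trrad (alg N')).
Let Jsp : sp J. Proof. exact: trrad_alg_sp. Qed.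
Let Rsp : sp R. Proof. exact: alg_sp. Qed.
Let Jl x y : R x -> J y -> J (x * y). Proof. exact: trrad_alg_mull. Qed.
Let Jr x y : J x -> R y -> J (x * y). Proof. exact: trrad_alg_mulr. Qed.
Let JR x : J x -> R x. Proof. by case. Qed.
Let RM x y : R x -> R y -> R (x * y). Proof. exact: alg_mul. Qed.
Let RN x : N' x -> R x. Proof. exact: alg_in. Qed.
Let RT x : R x -> T x.
Proof. by move=> Rx; apply: (Rx T) => // [x' y Tx Ty|y []//]; apply: Tl => //; apply: TA. Qed.
Let RA x : R x -> A x. Proof. by move/RT/TA. Qed.

(** N' is an ideal of N, so ad N preserves the algebra R and its trace radical J; nilpotent matrices
    forming a Lie algebra normalized by N fall into the radical of A. *)
Let JJh x : J x -> Jh x.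
Proof.
move=> Jx; apply: (@nil_ideal_rad _ J N) => //; last exact: RA (JR Jx).
- split=> // u v Ju Jv; apply: (spB Jsp); apply: Jl => //; exact: JR.
- by move=> y; apply: trrad_alg_nil.
- move=> y z Ny [Rz hz].
  have RyR r : R r -> R (br y r).
    by apply: br_alg => u N'u; apply: RN; case: lN'N => _ _; apply.
  split; first exact: RyR.
  move=> r Rr; rewrite brN mulNr linearN /= trace_br hz ?oppr0 //.
  exact: RyR.
Qed.
Let JhJ x : R x -> Jh x -> J x.
Proof. by move=> Rx [_ h]; split=> // y /RA; apply: h. Qed.
Let RJR r j r' : R r -> J j -> R r' -> J0 (r * j * r').
Proof. by move=> /RT Tr1 /JJh Jj /RT Tr2; apply: TJT. Qed.

(** The radical of the trace form on N' is a traceless ideal of N contained in [N,N]. *)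
Let N'rad_J x : N' x -> (forall y, N' y -> \tr (x * y) = 0) -> J x.
Proof.
move=> N'x tx; apply: JhJ; first exact: RN.
pose Z x := N' x /\ forall y, N' y -> \tr (x * y) = 0.
apply: (@traceless_ideal_rad _ N lN Z) => //; last by case: N'x.
- split=> [|z [/N'N]//|y z Ny [N'z hz]].
    apply: sp_cap => //; apply: (@sp_all _ _ N' (fun y x => \tr (x * y) = 0)) => y _.
    split=> [|a u v hu hv]; first by rewrite mul0r mxtrace0.
    by rewrite mulrDl mxZl linearD linearZ /= hu hv mulr0 addr0.
  split; first by case: lN'N => _ _; apply.
  move=> u N'u; rewrite brN mulNr linearN /= trace_br hz ?oppr0 //.
  by case: lN'N => _ _; apply.
- by move=> y z [_ hy] [N'z _]; apply: hy.
Qed.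

(** An element of N' orthogonal to [N',N'] is central in N' modulo [Jh]. Such elements form an ideal
    of N inside [N,N] that is abelian modulo [Jh], hence lies in [Jh]. *)
Let perfN' x : N' x -> exists u v, [/\ brk N' u, N' v, J v & x = u + v].
Proof.
move=> N'x; have [|u [v [Bu N'v tv e]]] := perfect_mod_radical lN' _ N'x.
  move=> z N'z tz y N'y; apply: (@trrad_trace _ N).
  apply: Jhr; last by apply: AN; apply: N'N.
  pose Z z := N' z /\ forall x, N' x -> Jh (br z x).
  apply: (@abelian_ideal_rad _ N lN Z) => //.
  - split=> [|u [/N'N]//|u v Nu [N'v hv]].
      by apply: sp_cap => //; apply: (@sp_all _ _ N' (fun x z => Jh (br z x))) => u _; apply: br_spl.
    split; first by case: lN'N => _ _; apply.
    move=> t N't; have -> : br (br u v) t = br u (br v t) - br v (br u t).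
      by rewrite /br; non_commutative_ring.
    apply: (spB Jhsp); last by apply: hv; case: lN'N => _ _; apply.
    by apply: (spB Jhsp); [apply: Jhl; [apply: AN | apply: hv] | apply: Jhr; [apply: hv | apply: AN]].
  - by move=> u v [_ hu] [N'v _]; apply: hu.
  - split=> // u N'u; apply: JJh; apply: N'rad_J; first by case: lN' => _; apply.
    by move=> v N'v; rewrite trace_br; apply: tz.
  - by case: N'z.
by exists u, v; split=> //; apply: N'rad_J.
Qed.

Let starR x : R x -> R (star x).
Proof.
move=> Rx; apply: (Rx (fun x => R (star x))).
- split=> [|a u v]; first by rewrite star0; apply: sp0.
  by rewrite star_lin => hu hv; case: Rsp => _; apply.
- by move=> u v hu hv; rewrite starM; apply: RM.
- by move=> y N'y; rewrite (skewN (N'N N'y)); apply: (spN Rsp); apply: RN.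
Qed.
Let starJ x : J x -> J (star x).
Proof.
move=> [Rx hx]; split; first exact: starR.
move=> y Ry; rewrite -(starK y) -starM star_tr mxtr_mulC; apply: hx; exact: starR.
Qed.

(** 1 - h = (1 - star g) (1 - g) is symmetric, with 1 - g = (1 - e0) (1 - e). Here e0 is a left unit
    of R modulo J, and e is one for the right ideal generated by M; as e m then stays in M A1 M, the
    error m - e m is in J0 and not only in J. *)
Let approximate_unit : exists e h, [/\ R e /\ R h,
  lspan (fun z => exists m r, [/\ M m, unit_ext R r & z = m * r]) e,
  (forall m, M m -> J0 (m - e * m)) /\ (forall m, M m -> J0 (h * m - m)), star h = h &
  forall r, R r -> J (h * r - r)].
Proof.
have Rmc : mulclosed R by exact: alg_mc.
pose F := lspan (fun z => exists m r, [/\ M m, unit_ext R r & z = m * r]).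
have Fsp : sp F by exact: lspan_sp.
have FR x : F x -> R x.
  move=> Fx; apply: (Fx R) => // _ [m [r [Mm [c [b [Rb ->]]] ->]]].
  have Rm := RN (MN' Mm).
  by rewrite mulrDr mxSr; apply: (spD Rsp); [apply: (spZ _ Rsp) | apply: RM].
have Fr x y : F x -> R y -> F (x * y).
  move=> Fx Ry; apply: (Fx (fun x => F (x * y))); first exact: mul_spl.
  move=> _ [m [r [Mm [c [b [Rb ->]]] ->]]]; apply: lspan_in.
  exists m, ((c%:M + b) * y); split=> //; last by rewrite mulrA.
  exists 0, (c *: y + b * y); split; first by apply: (spD Rsp); [apply: (spZ _ Rsp) | apply: RM].
  rewrite mulrDl mxSl (_ : 0%:M = 0) ?add0r //; apply/matrixP => i j; by rewrite !mxE mul0rn.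
have [e [Fe ee he]] := right_ideal_idem Rsp Rmc Fsp FR Fr.
have [e0 [Re0 ee0 he0]] := right_ideal_idem Rsp Rmc Rsp (fun _ h => h) (fun x y h1 h2 => RM h1 h2).
have Re := FR e Fe.
have FM m : M m -> F m.
  move=> Mm; apply: lspan_in; exists m, 1; split=> //; last by rewrite mulr1.
  by exists 1, 0; split; [exact: sp0 | rewrite addr0].
have hme m : M m -> J0 (m - e * m).
  move=> Mm; apply: J0M; last by apply: JJh; apply: he; apply: FM.
  apply: (spB (lspan_sp _)); first by apply: lspan_in; left.
  apply: (Fe (fun e => lspan (fun z => M z \/ exists m c m', [/\ M m, A1 c, M m' & z = m * c * m']) (e * m))).
    by apply: mul_spl; exact: lspan_sp.
  move=> _ [m' [r [Mm' [c [b [Rb ->]]] ->]]]; apply: lspan_in; right.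
  by exists m', (c%:M + b), m; split=> //; exists c, b; split=> //; apply: RA.
pose g := e + e0 - e0 * e; pose h := g + star g - star g * g.
have Rg : R g by apply: (spB Rsp); [apply: (spD Rsp) | apply: RM].
have Rsg := starR Rg.
have Rh : R h by apply: (spB Rsp); [apply: (spD Rsp) | apply: RM].
have hE x : h * x - x = star g * (x - e * x - e0 * (x - e * x)) - (x - e * x - e0 * (x - e * x)).
  by rewrite /h /g; move: (star _) => sg; non_commutative_ring.
exists e, h; split=> //.
- split=> // m Mm; rewrite hE.
  have h1 : J0 (m - e * m - e0 * (m - e * m)).
    by apply: spB => //; [apply: hme | apply: J0l; [apply: RA | apply: hme]].
  by apply: spB => //; apply: J0l => //; apply: RA.
- by rewrite /h starB starD starM starK [star g + g]addrC.
- move=> r Rr; rewrite hE.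
  have h1 : J (r - e * r - e0 * (r - e * r)) by apply: he0; apply: (spB Rsp) => //; apply: RM.
  by apply: (spB Jsp) => //; apply: Jl.
Qed.

Let nn x := N' x /\ J x.
Let nnsp : sp nn. Proof. exact: sp_cap. Qed.
Let nnbr x y : N' x -> nn y -> nn (br x y).
Proof.
move=> N'x [N'y Jy]; split; first by case: lN' => _; apply.
by apply: (spB Jsp); [apply: Jl => //; apply: RN | apply: Jr => //; apply: RN].
Qed.

(** N' is perfect modulo [nn], so brackets of a covering set still cover. This allows conditions to
    be improved by passing to brackets. *)
Let covers_brackets (P P' : 'M[K]_n -> Prop) : sp P' ->
  (forall x, P x -> N' x) -> (forall x y, P x -> P y -> P' (br x y)) ->
  (forall y, N' y -> exists s, P s /\ nn (y - s)) ->
  forall y, N' y -> exists s, P' s /\ nn (y - s).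
Proof.
move=> P'sp PN' Pbr cov y /perfN' [u [v [Bu N'v Jv ->]]].
suff [s [Ps hs]] : exists s, P' s /\ nn (u - s).
  exists s; split=> //; rewrite addrAC; apply: (spD nnsp) => //.
apply: (brk_sub (P := fun u => exists s, P' s /\ nn (u - s))) Bu.
  split; first by exists 0; rewrite subr0; split; apply: sp0.
  move=> a x z [s [Ps hs]] [t [Pt ht]]; exists (a *: s + t).
  split; first by case: P'sp => _; apply.
  by rewrite opprD addrACA -scalerBr; case: nnsp => _; apply.
move=> a b /[dup] N'a /cov [s [Ps hs]] /[dup] N'b /cov [t [Pt ht]].
exists (br s t); split; first exact: Pbr.
have -> : br a b - br s t = br a (b - t) - br t (a - s) by rewrite /br; non_commutative_ring.
by apply: (spB nnsp); apply: nnbr => //; apply: PN'.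
Qed.

(** S consists of the x in N' that equal [lam x] = (h + b') x (h + c) modulo J0, a twisted corner
    with b' in J and c = star b'. If such an x is in J, then [lam x] lies in R J R, hence in J0, and
    so does x: this is semisimplicity modulo J0. The twist comes from Whitehead's lemma for the
    cocycle y -> (1 - h) y. *)
Lemma levi_subalgebra : exists S, [/\ lie S, forall x, S x -> N x /\ brk N x,
  forall m, M m -> S m &
  forall I k, lideal I S -> (forall x, dser k I x -> Jh x) -> forall x, I x -> J0 x].
Proof.
have [e [h [[Re Rh] Fe [hme hhm] hstar hl]]] := approximate_unit.
have hr r : R r -> J (r * h - r).
  move=> Rr; rewrite -[r * h - r]starK starB starM hstar.
  by apply: starJ; apply: hl; apply: starR.
have hmh m : M m -> J0 (m * h - m).
  move=> Mm; rewrite -[m * h - m]starK; apply: J0star.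
  rewrite starB starM hstar (skewN (MN Mm)) (_ : _ - _ = - (h * m - m)); last by non_commutative_ring.
  by apply: spN => //; apply: hhm.
(* The permitted changes of the cocycle: after multiplication by h, J0 and the corners (1 - h) v h
   with v in [nn]. The latter amount to replacing y by y - v. *)
pose Q q := R q /\ exists v, nn v /\ J0 (q * h - (v - h * v) * h).
have Qsp : sp Q.
  split.
    split; first exact: sp0.
    by exists 0; split; [exact: sp0 | rewrite !(mul0r, mulr0, subr0); apply: sp0].
  move=> a q q' [Rq [v [nv hv]]] [Rq' [v' [nv' hv']]]; split; first by case: Rsp => _; apply.
  exists (a *: v + v'); split; first by case: nnsp => _; apply.
  have -> : (a *: q + q') * h - (a *: v + v' - h * (a *: v + v')) * h =
     a *: (q * h - (v - h * v) * h) + (q' * h - (v' - h * v') * h).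
    rewrite (_ : (a *: q) = a%:M * q); last by rewrite mxSl.
    rewrite (_ : (a *: v) = a%:M * v); last by rewrite mxSl.
    rewrite -mxSl (_ : h * (a%:M * v + v') = a%:M * (h * v) + h * v'); last by rewrite mulrDr !mxSl mxZr.
    by move: (a%:M) => am; non_commutative_ring.
  by case: J0sp => _; apply.
have QJ0 q : R q -> J0 q -> Q q.
  move=> Rq Jq; split=> //; exists 0; split; first exact: sp0.
  by rewrite mulr0 subr0 mul0r subr0; apply: J0r => //; apply: RA.
have QRJ r j : R r -> J j -> Q (r * j).
  move=> Rr Jj; split; first by apply: RM => //; apply: JR.
  exists 0; split; first exact: sp0.
  by rewrite mulr0 subr0 mul0r subr0; apply: RJR.
have Qr q r : Q q -> R r -> Q (q * r).
  move=> Qq Rr; suff [] : R r /\ forall q, Q q -> Q (q * r) by move=> _; apply.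
  apply: (Rr (fun r => R r /\ forall q, Q q -> Q (q * r))).
  - by apply: sp_cap => //; apply: (@sp_all _ _ Q (fun q r => Q (q * r))) => t _; apply: mul_spr.
  - by move=> u v [Ru hu] [Rv hv]; split; [exact: RM | move=> t Qt; rewrite mulrA; apply: hv; apply: hu].
  move=> y N'y; have Ry := RN N'y; split=> // {q Qq} q [Rq [v [[N'v Jv] hv]]].
  have Rv := JR Jv.
  split; first exact: RM.
  (* q y has the corner (1 - h) v y h; the other half (1 - h) y v h of the bracket lies in R J R. *)
  exists (br v y); split; first by rewrite brN; apply: (spN nnsp); apply: nnbr.
  have -> : q * y * h - (br v y - h * br v y) * h =
      (q * h - (v - h * v) * h) * (y * h) - q * (h * y - y) * h + (v - h * v) * (h * y - y) * h
      + y * v * h - h * y * v * h.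
    by rewrite /br; non_commutative_ring.
  apply: spB => //; last by apply: RJR => //; apply: RM.
  apply: spD => //; last exact: RJR.
  apply: spD => //; last first.
    by apply: RJR => //; [apply: (spB Rsp) => //; apply: RM | apply: hl].
  apply: spB => //; last by apply: RJR => //; apply: hl.
  by apply: J0r => //; apply: RA; apply: RM.
have [b [Rb hb]] : exists b, R b /\ forall y, N' y -> Q (y - h * y - b * y).
  apply: (whitehead lN' perfN' Rh hl hr Qsp Qr QRJ (beta := fun y => y - h * y)).
  - by move=> x N'x; apply: (spB Rsp); [apply: RN | apply: RM => //; apply: RN].
  - by move=> a x y; rewrite mulrDr mxZr opprD addrACA -scalerBr.
  - move=> x y N'x N'y; rewrite (_ : _ + _ = 0); first exact: sp0.
    by rewrite /br; non_commutative_ring.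
  - move=> x N'x Jx; split; first by apply: (spB Rsp); [apply: RN | apply: RM => //; apply: RN].
    by exists x; split=> //; rewrite subrr; apply: sp0.
(* Correcting b by b e, which lies in Q, makes it vanish on M modulo J0. *)
have Qbe : Q (b * e).
  apply: (Fe (fun e => Q (b * e))); first exact: mul_spr.
  move=> _ [m [r [Mm [c [r' [Rr' ->]]] ->]]].
  have N'm := MN' Mm; have Rm := RN N'm.
  have Qbm : Q (b * m).
    have -> : b * m = - (m - h * m - b * m) - (h * m - m) by non_commutative_ring.
    apply: spB => //; first by apply: spN => //; apply: hb.
    by apply: QJ0; [apply: (spB Rsp) => //; apply: RM | apply: hhm].
  rewrite mulrA mulrDr mxSr; apply: spD => //; first exact: spZ.
  exact: Qr.
pose b1 := b - b * e.
have Rb1 : R b1 by apply: (spB Rsp) => //; apply: RM.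
have hb1 y : N' y -> Q (y - h * y - b1 * y).
  move=> N'y; have -> : y - h * y - b1 * y = (y - h * y - b * y) + b * e * y.
    by rewrite /b1; non_commutative_ring.
  by apply: spD => //; [apply: hb | apply: Qr => //; apply: RN].
(* The cut (1 - h) b1 h is in J because h is a unit modulo J; its image under [star] corrects the
   opposite corner. *)
have [b' eb'] : exists b', b' = (b1 - h * b1) * h by eexists.
have Jb1 : J (b1 - h * b1) by apply: (spBC Jsp); apply: hl.
have Jb' : J b' by rewrite eb'; apply: Jr.
have Rb' := JR Jb'.
have b'm m : M m -> J0 (b' * m).
  move=> Mm; have -> : b' * m = (b1 - h * b1) * (h * m - m) + (b - h * b) * (m - e * m).
    by rewrite eb' /b1; non_commutative_ring.
  apply: spD => //; first by apply: J0l; [apply: RA; apply: JR | apply: hhm].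
  by apply: J0l; [apply: RA; apply: (spB Rsp) => //; apply: RM | apply: hme].
have [c ec] : exists c, c = star b' by exists (star b').
have Jc : J c by rewrite ec; apply: starJ.
have Rc := JR Jc.
pose lam x := (h + b') * x * (h + c).
have Rhb : R (h + b') by apply: (spD Rsp).
have Rhc : R (h + c) by apply: (spD Rsp).
have Rlam x : R x -> R (lam x) by move=> Rx; apply: RM => //; apply: RM.
pose gam x := x - lam x.
have gamE a x y : gam (a *: x + y) = a *: gam x + gam y.
  rewrite /gam /lam; move: (h + b') (h + c) => s t.
  by rewrite mulrDr mxZr mulrDl mxZl scalerBr opprD addrACA.
have Rgam x : R x -> R (gam x) by move=> Rx; apply: (spB Rsp) => //; apply: Rlam.
have stc : star c = b' by rewrite ec starK.
have star_lam x : N' x -> star (lam x) = - lam x.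
  move=> N'x; rewrite /lam !starM !starD hstar stc -ec (skewN (N'N N'x)).
  by rewrite mulrA mulrN mulNr.
have star_gam x : N' x -> star (gam x) = - gam x.
  by move=> N'x; rewrite /gam starB star_lam // (skewN (N'N N'x)) opprB opprK addrC.
(* This fixes the corner (1 - h) x h; skewness of x turns it into the same condition on h x (1 - h),
   with c in place of b'. *)
pose St x := N' x /\ J0 ((x - h * x) * h - b' * x * h).
have Stcov y : N' y -> exists s, St s /\ nn (y - s).
  move=> N'y; have Ry := RN N'y.
  have [_ [v [[N'v Jv] hv]]] := hb1 y N'y; have Rv := JR Jv.
  have N'yv : N' (y - v) by apply: (spB N'sp).
  exists (y - v); split; last by rewrite opprB addrC subrK.
  split=> //.
  pose X := (y - h * y - b1 * y) * h - (v - h * v) * h.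
  have -> : (y - v - h * (y - v)) * h - b' * (y - v) * h =
     X - h * X + h * (y - h * y) * h - h * (v - h * v) * h + (b1 - h * b1) * (y - h * y) * h + b' * v * h.
    by rewrite /X eb'; non_commutative_ring.
  have Jy : J (y - h * y) by apply: (spBC Jsp); apply: hl.
  have JJv : J (v - h * v) by apply: (spBC Jsp); apply: hl.
  apply: spD => //; last exact: RJR.
  apply: spD => //; last by apply: RJR => //; apply: JR.
  apply: spB => //; last exact: RJR.
  apply: spD => //; last exact: RJR.
  by apply: spB => //; apply: J0l => //; apply: RA.
(* Modulo J0 the remaining part gam0 of x in St kills everything on both sides but other gam0. *)
have Stgam x : St x -> J (gam x) /\ forall y, N' y -> J0 (gam x * lam y).
  move=> [N'x hx]; have Rx := RN N'x.
  pose g0 := (x - h * x) * (1 - h) - b' * x * c.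
  have Jx : J (x - h * x) by apply: (spBC Jsp); apply: hl.
  have Jg0 : J g0.
    have -> : g0 = (x - h * x) - (x - h * x) * h - b' * x * c by rewrite /g0; non_commutative_ring.
    apply: (spB Jsp); first by apply: (spB Jsp) => //; apply: Jr.
    by apply: Jl => //; apply: RM.
  have dg : J0 (gam x - g0).
    have hx' : J0 (h * (x - x * h) - h * x * c).
      have := J0star hx; rewrite starB !starM starB starM hstar (skewN (N'N N'x)) -ec.
      move=> hh; suff -> : h * (x - x * h) - h * x * c = - (h * (- x - - x * h) - h * (- x * c)) by apply: spN.
      by non_commutative_ring.
    have -> : gam x - g0 = ((x - h * x) * h - b' * x * h) + (h * (x - x * h) - h * x * c).
      by rewrite /gam /lam /g0; non_commutative_ring.
    exact: spD.
  have Rg := Rgam x Rx.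
  split.
    have -> : gam x = (gam x - g0) + g0 by rewrite subrK.
    apply: (spD Jsp) => //; apply: JhJ; last exact: J0rad.
    by apply: (spB Rsp) => //; apply: JR.
  move=> y N'y; have Ry := RN N'y.
  have -> : gam x * lam y = (gam x - g0) * lam y + (x - h * x) * (h - h * h) * (y * (h + c))
     - b' * x * c * (h * y * (h + c)) + g0 * b' * (y * (h + c)).
    by rewrite /lam /g0; non_commutative_ring.
  apply: spD => //; last by apply: RJR => //; [apply: JR | apply: RM].
  apply: spB => //; last by apply: RJR => //; [apply: RM | apply: RM => //; apply: RM].
  apply: spD => //; first by apply: J0r => //; apply: RA; apply: Rlam.
  by apply: RJR; [apply: JR | apply: (spBC Jsp); apply: hl | apply: RM].
(* (h + c) (h + b') y is y modulo J, and the error stands between (h + b') x and h + c. *)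
have lamM x y : N' x -> N' y -> J0 (lam x * lam y - (h + b') * (x * y) * (h + c)).
  move=> N'x N'y; have [Rx Ry] := (RN N'x, RN N'y).
  have -> : lam x * lam y - (h + b') * (x * y) * (h + c) =
     (h + b') * x * (h * (h * y - y) + (h * y - y) + h * b' * y + c * (h * y) + c * b' * y) * (h + c).
    by rewrite /lam; non_commutative_ring.
  apply: RJR => //; first exact: RM.
  have Jy : J (h * y - y) by apply: hl.
  apply: (spD Jsp); last by apply: Jr => //; apply: Jl.
  apply: (spD Jsp); last by apply: Jr => //; apply: RM.
  apply: (spD Jsp); last by apply: Jr => //; apply: Jl.
  by apply: (spD Jsp) => //; apply: Jl.
have gam_br x y : N' x -> N' y -> J0 (gam (br x y) -
   (lam x * gam y + gam x * lam y + gam x * gam y - (lam y * gam x + gam y * lam x + gam y * gam x))).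
  move=> N'x N'y.
  have -> : gam (br x y) -
     (lam x * gam y + gam x * lam y + gam x * gam y - (lam y * gam x + gam y * lam x + gam y * gam x)) =
     (lam x * lam y - (h + b') * (x * y) * (h + c)) - (lam y * lam x - (h + b') * (y * x) * (h + c)).
    rewrite /gam {1}/lam /br; move: (lam x) (lam y) => lx ly; non_commutative_ring.
  by apply: spB => //; apply: lamM.
(* Brackets of [St] leave products of two elements of J, which are only killed by R on either side;
   one more bracket moves them into J0. *)
pose kills z := forall r, R r -> J0 (z * r) /\ J0 (r * z).
pose S2 x := N' x /\ kills (gam x).
pose S x := N' x /\ J0 (gam x).
have killsB u v : kills u -> kills v -> kills (u - v).
  move=> hu hv r Rr; have [h1 h2] := hu r Rr; have [h3 h4] := hv r Rr.
  by rewrite mulrBl mulrBr; split; apply: spB.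
have killsD u v : kills u -> kills v -> kills (u + v).
  move=> hu hv r Rr; have [h1 h2] := hu r Rr; have [h3 h4] := hv r Rr.
  by rewrite mulrDl mulrDr; split; apply: spD.
have killsJ0 u : J0 u -> kills u.
  by move=> hu r /RA Ar; split; [apply: J0r | apply: J0l].
have S2sp : sp S2.
  have gam0 : gam 0 = 0 by rewrite /gam /lam mulr0 mul0r subrr.
  split; first by split; [exact: sp0 | rewrite gam0; apply: killsJ0; exact: sp0].
  move=> a x y [N'x hx] [N'y hy]; split; first by case: N'sp => _; apply.
  move=> r Rr; have [h1 h2] := hx r Rr; have [h3 h4] := hy r Rr.
  by rewrite gamE mulrDl mulrDr mxZl mxZr; split; case: J0sp => _; apply.
have Ssp : sp S.
  have gam0 : gam 0 = 0 by rewrite /gam /lam mulr0 mul0r subrr.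
  split; first by split; [exact: sp0 | rewrite gam0; exact: sp0].
  move=> a x y [N'x hx] [N'y hy]; split; first by case: N'sp => _; apply.
  by rewrite gamE; case: J0sp => _; apply.
have N'br x y : N' x -> N' y -> N' (br x y) by case: lN' => _; apply.
have lamgam x y : N' x -> St y -> J0 (lam x * gam y).
  move=> N'x Sty; have [N'y _] := Sty; have [_ /(_ x N'x) hh] := Stgam y Sty.
  have := J0star hh; rewrite starM star_lam // star_gam // mulrN mulNr opprK //.
have StS2 x y : St x -> St y -> S2 (br x y).
  move=> Sx Sy; have [N'x _] := Sx; have [N'y _] := Sy; split; first exact: N'br.
  have [Jx gx] := Stgam x Sx; have [Jy gy] := Stgam y Sy.
  have kJJ u v : J u -> J v -> kills (u * v).
    move=> Ju Jv r Rr; split; first by apply: RJR => //; apply: JR.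
    by rewrite mulrA; apply: RJR => //; apply: JR.
  rewrite -[gam (br x y)](subrK (lam x * gam y + gam x * lam y + gam x * gam y - (lam y * gam x + gam y * lam x + gam y * gam x))).
  apply killsD; first by apply killsJ0; apply: gam_br.
  apply killsB; (apply killsD; last exact: kJJ); apply killsD; apply killsJ0.
  - exact: lamgam.
  - exact: gx.
  - exact: lamgam.
  - exact: gy.
have gambr_S x y : N' x -> N' y -> kills (gam x) -> kills (gam y) -> S (br x y).
  move=> N'x N'y kx ky; have [Rx Ry] := (RN N'x, RN N'y); split; first exact: N'br.
  apply: (sp_of_sub J0sp (gam_br x y N'x N'y)).
  have [Rlx Rly] := (Rlam x Rx, Rlam y Ry); have [Rgx Rgy] := (Rgam x Rx, Rgam y Ry).
  have [a1 a2] := kx _ Rly; have [a3 a4] := ky _ Rlx; have [a5 a6] := kx _ Rgy.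
  by apply: spB => //; apply: spD => //; apply: spD.
have Scov : forall y, N' y -> exists s, S s /\ nn (y - s).
  apply: (@covers_brackets S2 S) => //; first by move=> x [].
    by move=> x y [N'x kx] [N'y ky]; apply: gambr_S.
  apply: (@covers_brackets St S2) => // x; by case.
have lS : lie S.
  by split=> // x y [N'x hx] [N'y hy]; apply: gambr_S => //; apply: killsJ0.
exists S; split=> //.
- by move=> x [[Nx _ Bx] _].
- move=> m Mm; split; first exact: MN'.
  have Am : A m by apply: AN; apply: MN.
  have mc : J0 (m * c).
    have := J0star (b'm m Mm); rewrite starM -ec (skewN (MN Mm)) mulNr => /(spN J0sp).
    by rewrite opprK.
  have -> : gam m = - (h * m - m) - h * (m * h - m) - h * (m * c) - b' * m * (h + c).
    by rewrite /gam /lam; non_commutative_ring.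
  apply: spB => //; last by apply: J0r; [apply: b'm | apply: RA].
  apply: spB => //; last by apply: J0l => //; apply: RA.
  by apply: spB => //; [apply: spN => //; apply: hhm | apply: J0l; [apply: RA | apply: hmh]].
move=> I k lI hk x Ix.
have [Isp IS Ibr] := lI.
suff hJ : J x.
  have [N'x hx] := IS x Ix.
  have -> : x = gam x + lam x by rewrite subrK.
  by apply: spD => //; apply: RJR.
have DN' j y : dser j I y -> S y by case: (dser_ideal j lI lS) => _ + _; apply.
(* Thickened by [nn], the j-th derived ideal of I becomes an ideal of N', because S covers N' modulo
   [nn]. It is abelian modulo J as soon as the next derived ideal lies in J. *)
have step j : (forall y, dser j.+1 I y -> J y) -> forall y, dser j I y -> J y.
  move=> hj y Dy; have [Dsp DS Dbr] := dser_ideal j lI lS.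
  pose D' y := N' y /\ exists d, dser j I d /\ nn (y - d).
  have D'sp : sp D'.
    split; first by split; [exact: sp0 | exists 0; rewrite subr0; split; apply: sp0].
    move=> a u v [N'u [d [Dd hd]]] [N'v [d' [Dd' hd']]]; split; first by case: N'sp => _; apply.
    exists (a *: d + d'); split; first by case: Dsp => _; apply.
    by rewrite opprD addrACA -scalerBr; case: nnsp => _; apply.
  have lD' : lideal D' N'.
    split=> [||u v N'u [N'v [d [Dd hd]]]] //; first by move=> u [].
    split; first exact: N'br.
    have [s [Ss hs]] := Scov u N'u.
    exists (br s d); split; first exact: Dbr.
    have -> : br u v - br s d = br u (v - d) - br d (u - s) by rewrite /br; non_commutative_ring.
    by apply: (spB nnsp); apply: nnbr => //; case: (DS d Dd).
  have D'J : forall u v, D' u -> D' v -> J (br u v).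
    move=> u v [N'u [d [Dd hd]]] [N'v [d' [Dd' hd']]].
    have -> : br u v = br d d' + (br u (v - d') - br d' (u - d)) by rewrite /br; non_commutative_ring.
    apply: (spD Jsp); first by apply: hj; apply: brk_in.
    have N'd' : N' d' by case: (DS d' Dd').
    suff [] : nn (br u (v - d') - br d' (u - d)) by [].
    by apply: (spB nnsp); apply: nnbr.
  have [N'y _] := DS y Dy.
  have [u [v [Bu N'v Jv ey]]] := perfN' N'y.
  have D'u : D' u.
    split; first by apply: lie_brk Bu.
    exists y; split=> //; rewrite ey opprD addrA subrr add0r.
    by apply: (spN nnsp).
  rewrite ey; apply: (spD Jsp) => //.
  exact: (abelian_ideal_rad lN' lD' D'J).
have all j : (forall y, dser j I y -> J y) -> forall y, I y -> J y.
  by elim: j => //= j ih hj; apply: ih; apply: step.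
apply: (all k) => // y Dy; apply: JhJ; last exact: hk.
by apply: RN; case: (DN' k y Dy).
Qed.
End LeviSubalgebra.

(** * Operators and tensors *)

Lemma In_mem (T : eqType) (x : T) s : List.In x s <-> x \in s.
Proof.
elim: s => //= y s ih; rewrite inE; split=> [[->|/ih ->]|/orP [/eqP ->|/ih]]; rewrite ?eqxx ?orbT //; by [left | right].
Qed.

Section Operators.
Variable V : lmodType K.
Implicit Types (S T Q : opset V) (f h u : V -> V).

Lemma op_ext f h : (forall x, f x = h x) -> f = h.
Proof. exact: functional_extensionality. Qed.

Lemma opadd0 f : opadd f (@opzero V) = f.
Proof. by apply: op_ext => x; rewrite /opadd /opzero addr0. Qed.
Lemma opscale1 f : opscale 1 f = f.
Proof. by apply: op_ext => x; rewrite /opscale scale1r. Qed.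
Lemma opsub0 f h : opadd f (opscale (-1) h) = @opzero V -> f = h.
Proof.
move=> e; apply: op_ext => x; have := congr1 (fun t => t x) e.
by rewrite /opadd /opscale /opzero scaleN1r => /eqP; rewrite subr_eq0 => /eqP.
Qed.
Lemma subspaceP S : subspace S ->
  [/\ S (@opzero V), forall f h, S f -> S h -> S (opadd f h),
      forall c f, S f -> S (opscale c f) & forall f h, S f -> S h -> S (opadd f (opscale (-1) h))].
Proof. by case=> S0 [Sa Ss]; split=> // f h Sf Sh; apply: (Sa) => //; apply: Ss. Qed.

Lemma span_min S Q f : subspace Q -> (forall f, S f -> Q f) -> span S f -> Q f.
Proof.
move=> [Q0 [Qa Qs]] h [s [hs ->]]; elim: s hs => [|q s ih] hs //=.
apply: (Qa); first by apply: (Qs); apply: h; apply: hs; left.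
by apply: ih => t ts; apply: hs; right.
Qed.
Lemma span_in S f : S f -> span S f.
Proof.
move=> Sf; exists [:: (1, f)]; split=> [q [<-|[]] //|] /=.
by rewrite opscale1 opadd0.
Qed.
Lemma opsum_cat s t : opsum (s ++ t) = opadd (opsum s) (opsum t) :> (V -> V).
Proof.
elim: s => [|a s ih] /=; first by apply: op_ext => x; rewrite /opadd /opzero add0r.
by rewrite ih; apply: op_ext => x; rewrite /opadd addrA.
Qed.
Lemma span_subspace S : subspace (span S).
Proof.
split; first by exists [::].
split=> [_ _ [s [hs ->]] [t [ht ->]]|c _ [s [hs ->]]].
  exists (s ++ t); split; last by rewrite map_cat opsum_cat.
  by move=> q /List.in_app_iff [/hs|/ht].
exists [seq (c * q.1, q.2) | q <- s]; split.
  by move=> q /List.in_map_iff [q' [<- /hs]].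
elim: s hs => [|q s ih] hs /=; apply: op_ext => x; first by rewrite /opscale /opzero scaler0.
rewrite /opadd -ih => [|t ts]; last by apply: hs; right.
by rewrite /opscale scalerDr scalerA.
Qed.
Lemma derived_in S a b : S a -> S b -> derived S (opbr a b).
Proof. by move=> Sa Sb; apply: span_in; exists a, b. Qed.
Lemma derived_min S Q f : subspace Q -> (forall a b, S a -> S b -> Q (opbr a b)) -> derived S f -> Q f.
Proof. by move=> hQ h; apply: span_min => // _ [a [b [Sa [Sb ->]]]]; apply: h. Qed.
Lemma derived_mono S T f : incl S T -> derived S f -> derived T f.
Proof.
move=> h; apply: derived_min; first exact: span_subspace.
by move=> a b /h Ta /h Tb; apply: derived_in.
Qed.
Lemma derived_series_mono S T n : incl S T -> incl (derived_series n S) (derived_series n T).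
Proof. by move=> h; elim: n => //= n ih f; apply: derived_mono. Qed.
Lemma solvable_mono S T : incl S T -> solvable T -> solvable S.
Proof. by move=> h [n hn]; exists n => f /(derived_series_mono h)/hn. Qed.
Lemma gen_subalgebra (l : seq (V -> V)) : subalgebra (gen l).
Proof.
split; [split; [|split]|].
- by move=> T [[T0 _] _] _.
- move=> f h hf hh T hT hl; have [[_ [Ta _]] _] := hT; apply: Ta; [exact: hf | exact: hh].
- move=> c f hf T hT hl; have [[_ [_ Ts]] _] := hT; apply: Ts; exact: hf.
- move=> f h hf hh T hT hl; have [_ Tb] := hT; apply: Tb; [exact: hf | exact: hh].
Qed.
Lemma gen_in (l : seq (V -> V)) f : List.In f l -> gen l f.
Proof. by move=> fl T _; apply. Qed.

Definition oplinear u := forall a x y, u (a *: x + y) = a *: u x + u y.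
Lemma oplinear0 u : oplinear u -> u 0 = 0.
Proof. by move=> h; have := h (-1) 0 0; rewrite scaler0 addr0 scaleN1r addNr. Qed.
Lemma oplinearD u x y : oplinear u -> u (x + y) = u x + u y.
Proof. by move=> h; rewrite -[x]scale1r h !scale1r. Qed.
Lemma oplinearZ u a x : oplinear u -> u (a *: x) = a *: u x.
Proof. by move=> h; rewrite -[a *: x]addr0 h oplinear0 // addr0. Qed.
Lemma oplinear_sum u I (r : seq I) F : oplinear u -> u (\sum_(i <- r) F i) = \sum_(i <- r) u (F i).
Proof.
move=> h; elim: r => [|i r ih]; first by rewrite !big_nil oplinear0.
by rewrite !big_cons oplinearD // ih.
Qed.

Lemma finite_basis n (phi : 'M[K]_n -> V -> V) S :
  (forall c a b, phi (c *: a + b) = opadd (opscale c (phi a)) (phi b)) -> subspace S ->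
  exists l : seq (V -> V), (forall f, List.In f l -> S f) /\
    (forall a, S (phi a) -> span (fun f => List.In f l) (phi a)).
Proof.
move=> lphi [S0 [Sa Ss]].
have phi0 : phi 0 = @opzero V.
  have := lphi (-1) 0 0; rewrite scaler0 addr0 => ->; apply: op_ext => x.
  by rewrite /opadd /opscale scaleN1r addNr.
have hP : sp (fun a => S (phi a)).
  by split; [rewrite phi0 | move=> c a b ha hb; rewrite lphi; apply: Sa => //; apply: Ss].
have [U hU] := sp_vspace hP.
exists [seq phi a | a <- vbasis U]; split.
  by move=> _ /List.in_map_iff [a [<- /In_mem aU]]; apply/hU; apply: vbasis_mem.
move=> a /hU aU; rewrite (coord_vbasis aU).
set l := [seq phi a | a <- vbasis U].
have [s0 [sa ss]] := span_subspace (fun f => List.In f l).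
elim/big_ind: _ => [|x y hx hy|i _]; first by rewrite phi0.
  by rewrite -[x]scale1r lphi; apply: (sa) => //; apply: ss.
rewrite -[_ *: _]addr0 lphi phi0 opadd0; apply: (ss); apply: span_in.
apply: List.in_map; apply/In_mem; apply: mem_nth; by rewrite size_tuple.
Qed.
End Operators.

(** * Finite dual systems and their matrix models *)

Section DualSystems.
Variables (V W : lmodType K) (p : V -> W -> K).
Hypothesis hbil : bilinear_pairing p.

Let pl a v v' w : p (a *: v + v') w = a * p v w + p v' w. Proof. by case: hbil. Qed.
Let pr a v w w' : p v (a *: w + w') = a * p v w + p v w'. Proof. by case: hbil. Qed.
Lemma pairing0l w : p 0 w = 0.
Proof. by have := pl (-1) 0 0 w; rewrite scaler0 addr0 mulN1r addNr. Qed.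
Lemma pairing0r v : p v 0 = 0.
Proof. by have := pr (-1) v 0 0; rewrite scaler0 addr0 mulN1r addNr. Qed.
Lemma pairingDl v v' w : p (v + v') w = p v w + p v' w.
Proof. by rewrite -[v]scale1r pl mul1r scale1r. Qed.
Lemma pairingDr v w w' : p v (w + w') = p v w + p v w'.
Proof. by rewrite -[w]scale1r pr mul1r scale1r. Qed.
Lemma pairingZl a v w : p (a *: v) w = a * p v w.
Proof. by rewrite -[a *: v]addr0 pl pairing0l addr0. Qed.
Lemma pairingZr a v w : p v (a *: w) = a * p v w.
Proof. by rewrite -[a *: w]addr0 pr pairing0r addr0. Qed.
Lemma pairing_suml I (r : seq I) F w : p (\sum_(i <- r) F i) w = \sum_(i <- r) p (F i) w.
Proof.
elim: r => [|i r ih]; first by rewrite !big_nil pairing0l.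
by rewrite !big_cons pairingDl ih.
Qed.
Lemma pairing_sumr I (r : seq I) F v : p v (\sum_(i <- r) F i) = \sum_(i <- r) p v (F i).
Proof.
elim: r => [|i r ih]; first by rewrite !big_nil pairing0r.
by rewrite !big_cons pairingDr ih.
Qed.

Definition rep (s : seq (V * W)) (x : V -> V) := forall y, x y = \sum_(q <- s) p y q.2 *: q.1.

Lemma rep_linear s x : rep s x -> oplinear x.
Proof.
move=> h a y z; rewrite !h scaler_sumr -big_split; apply: eq_bigr => q _.
by rewrite pl scalerDl scalerA.
Qed.
Lemma repD s t x y : rep s x -> rep t y -> rep (s ++ t) (opadd x y).
Proof. by move=> hx hy z; rewrite big_cat /= -hx -hy. Qed.
Lemma repZ s x c : rep s x -> rep [seq (c *: q.1, q.2) | q <- s] (opscale c x).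
Proof.
move=> hx z; rewrite /opscale hx big_map scaler_sumr; apply: eq_bigr => q _ /=.
by rewrite !scalerA mulrC.
Qed.
Lemma rep_compl s x u : rep s x -> oplinear u -> rep [seq (u q.1, q.2) | q <- s] (fun z => u (x z)).
Proof.
move=> hx lu z; rewrite hx oplinear_sum // big_map; apply: eq_bigr => q _ /=.
by rewrite oplinearZ.
Qed.

Section Model.
Variables (n : nat) (e : 'I_n -> V) (f : 'I_n -> W).
Definition dual_system := forall i j, p (e i) (f j) = (i == j)%:R.
Definition in_spanl v := v = \sum_i p v (f i) *: e i.
Definition in_spanr w := w = \sum_i p (e i) w *: f i.
Definition op (a : 'M[K]_n) : V -> V := fun x => \sum_i \sum_j (a i j * p x (f j)) *: e i.
(** Compression to the model, defined for every operator u; words in g are compressed even when they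
    leave the model. *)
Definition rho (u : V -> V) : 'M[K]_n := \matrix_(i, j) p (u (e j)) (f i).
Definition in_op x := x = op (rho x).

Lemma op_lin c a b : op (c *: a + b) = opadd (opscale c (op a)) (op b).
Proof.
apply: op_ext => x; rewrite /opadd /opscale /op scaler_sumr -big_split; apply: eq_bigr => i _.
rewrite scaler_sumr -big_split; apply: eq_bigr => j _.
by rewrite !mxE mulrDl scalerDl scalerA mulrA.
Qed.
Lemma op0 : op 0 = @opzero V.
Proof. by apply: op_ext => x; rewrite /op big1 // => i _; rewrite big1 // => j _; rewrite mxE mul0r scale0r. Qed.
Lemma opD a b : op (a + b) = opadd (op a) (op b).
Proof. by rewrite -[a]scale1r op_lin scale1r opscale1. Qed.
Lemma opZ c a : op (c *: a) = opscale c (op a).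
Proof. by rewrite -[_ *: _]addr0 op_lin op0 opadd0. Qed.
Lemma op_rep (a : 'M[K]_n) : rep [seq (a i j *: e i, f j) | i <- enum 'I_n, j <- enum 'I_n] (op a).
Proof.
move=> y; rewrite /op big_allpairs_dep big_enum /=; apply: eq_bigr => i _.
by rewrite big_enum /=; apply: eq_bigr => j _; rewrite scalerA mulrC.
Qed.
Lemma rhoD u u' : rho (opadd u u') = rho u + rho u'.
Proof. by apply/matrixP => i j; rewrite !mxE pairingDl. Qed.

Lemma in_op_rep s x : rep s x -> (forall q, List.In q s -> in_spanl q.1 /\ in_spanr q.2) -> in_op x.
Proof.
move=> hx; have -> : x = fun y => \sum_(q <- s) p y q.2 *: q.1 by apply: op_ext.
move=> {x hx}; elim: s => [|[v w] s ih] h.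
  apply: op_ext => y; rewrite big_nil; rewrite (_ : rho _ = 0) ?op0 //.
  by apply/matrixP => i j; rewrite !mxE big_nil pairing0l.
have -> : (fun y => \sum_(q <- (v, w) :: s) p y q.2 *: q.1) =
   opadd (fun y => p y w *: v) (fun y => \sum_(q <- s) p y q.2 *: q.1).
  by apply: op_ext => y; rewrite big_cons.
rewrite /in_op rhoD opD -ih; last by move=> q qs; apply: h; right.
congr (opadd _ _); apply: op_ext => y.
have [/= hv hw] := h (v, w) (or_introl erefl).
rewrite /op {1}hv scaler_sumr; apply: eq_bigr => i _.
rewrite {1}hw pairing_sumr scalerA mulr_suml scaler_suml; apply: eq_bigr => j _.
by rewrite !mxE pairingZl pairingZr; congr (_ *: _); rewrite mulrAC.
Qed.

(** The tensor of z is supported in the model, so compressing u loses nothing, and the right side no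
    longer mentions the model. *)
Lemma trace_rep s z u : rep s z -> (forall q, List.In q s -> in_spanl q.1 /\ in_spanr q.2) ->
  oplinear u -> \tr (rho z * rho u) = \sum_(q <- s) p (u q.1) q.2.
Proof.
move=> hz; have -> : z = fun y => \sum_(q <- s) p y q.2 *: q.1 by apply: op_ext.
move=> {z hz} h lu; elim: s h => [|[v w] s ih] h.
  rewrite big_nil (_ : rho _ = 0) ?mul0r ?mxtrace0 //.
  by apply/matrixP => i j; rewrite !mxE big_nil pairing0l.
have -> : (fun y => \sum_(q <- (v, w) :: s) p y q.2 *: q.1) =
   opadd (fun y => p y w *: v) (fun y => \sum_(q <- s) p y q.2 *: q.1).
  by apply: op_ext => y; rewrite big_cons.
rewrite rhoD mulrDl linearD /= big_cons ih; last by move=> q qs; apply: h; right.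
congr (_ + _); have [/= hv hw] := h (v, w) (or_introl erefl).
rewrite {2}hw pairing_sumr mxtrace_mulC.
apply: eq_bigr => k _; rewrite !mxE pairingZr.
rewrite (eq_bigr (fun i => p (e k) w * (p v (f i) * p (u (e i)) (f k)))); last first.
  by move=> i _; rewrite !mxE pairingZl; ring.
rewrite -mulr_sumr; congr (_ * _).
by rewrite {2}hv oplinear_sum // pairing_suml; apply: eq_bigr => i _; rewrite oplinearZ // pairingZl.
Qed.

Hypothesis de : dual_system.

Lemma dual_spanl i : in_spanl (e i).
Proof.
rewrite /in_spanl (bigD1 i) //= de eqxx scale1r big1 ?addr0 // => j ji.
by rewrite de eq_sym (negbTE ji) scale0r.
Qed.
Lemma dual_spanr i : in_spanr (f i).
Proof.
rewrite /in_spanr (bigD1 i) //= de eqxx scale1r big1 ?addr0 // => j ji.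
by rewrite de (negbTE ji) scale0r.
Qed.
Lemma op_e a j : op a (e j) = \sum_i a i j *: e i.
Proof.
apply: eq_bigr => i _; rewrite (bigD1 j) //= de eqxx mulr1 big1 ?addr0 // => k kj.
by rewrite de eq_sym (negbTE kj) mulr0 scale0r.
Qed.
Lemma p_op a x i : p (op a x) (f i) = \sum_j a i j * p x (f j).
Proof.
rewrite pairing_suml (bigD1 i) //= pairing_suml [X in _ + X]big1 ?addr0; last first.
  move=> k ki; rewrite pairing_suml big1 // => j _.
  by rewrite pairingZl de (negbTE ki) mulr0.
by apply: eq_bigr => j _; rewrite pairingZl de eqxx mulr1.
Qed.
Lemma opK a : rho (op a) = a.
Proof.
apply/matrixP => i j; rewrite mxE p_op (bigD1 j) //= de eqxx mulr1 big1 ?addr0 // => k kj.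
by rewrite de eq_sym (negbTE kj) mulr0.
Qed.
Lemma op_inj : injective op. Proof. exact: can_inj opK. Qed.
Lemma opM a b : op (a * b) = fun x => op a (op b x).
Proof.
apply: op_ext => x; apply: eq_bigr => i _.
transitivity ((\sum_j a i j * p (op b x) (f j)) *: e i); last by rewrite scaler_suml.
rewrite -scaler_suml; congr (_ *: _).
transitivity (\sum_j \sum_k a i k * (b k j * p x (f j))).
  by apply: eq_bigr => j _; rewrite mxE mulr_suml; apply: eq_bigr => k _; rewrite mulrA.
by rewrite exchange_big /=; apply: eq_bigr => k _; rewrite p_op mulr_sumr.
Qed.
Lemma op_br a b : op (br a b) = opbr (op a) (op b).
Proof.
rewrite /br -[- _]scaleN1r opD opZ !opM; apply: op_ext => x.
by rewrite /opadd /opscale scaleN1r.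
Qed.
Lemma rho_compl a u : rho (fun x => op a (u x)) = a * rho u.
Proof. by apply/matrixP => i j; rewrite !mxE p_op; apply: eq_bigr => k _; rewrite mxE. Qed.
Lemma rho_compr a u : oplinear u -> rho (fun x => u (op a x)) = rho u * a.
Proof.
move=> lu; apply/matrixP => i j; rewrite !mxE op_e oplinear_sum // pairing_suml.
by apply: eq_bigr => k _; rewrite mxE oplinearZ // pairingZl mulrC.
Qed.
Lemma op_rep_span (a : 'M[K]_n) q : List.In q [seq (a i j *: e i, f j) | i <- enum 'I_n, j <- enum 'I_n] ->
  in_spanl q.1 /\ in_spanr q.2.
Proof.
move=> h; suff : exists i j, q = (a i j *: e i, f j).
  move=> [i [j ->]] /=; split; last exact: dual_spanr.
  rewrite /in_spanl {1}[e i]dual_spanl scaler_sumr; apply: eq_bigr => k _.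
  by rewrite pairingZl scalerA.
have gen s1 s2 : List.In q [seq (a i j *: e i, f j) | i <- s1, j <- s2] -> exists i j, q = (a i j *: e i, f j).
  elim: s1 => //= i s1 ih; rewrite List.in_app_iff => -[|//] hq.
  by have [j [<- _]] := proj1 (List.in_map_iff _ _ _) hq; exists i, j.
exact: gen h.
Qed.
Lemma in_op_op a : in_op (op a). Proof. by rewrite /in_op opK. Qed.
End Model.

Hypothesis hnd : nondegenerate_pairing p.

(** A Gram-Schmidt step: subtract from v its projection, use nondegeneracy to find w0 pairing with
    the remainder, then normalize w0 and make it orthogonal to the old e i. *)
Lemma dual_extend n (e : 'I_n -> V) (f : 'I_n -> W) v : dual_system e f ->
  exists m (e' : 'I_m -> V) (f' : 'I_m -> W), [/\ dual_system e' f', in_spanl e' f' v,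
    forall x, in_spanl e f x -> in_spanl e' f' x & forall y, in_spanr e f y -> in_spanr e' f' y].
Proof.
move=> de; pose v' := v - \sum_i p v (f i) *: e i.
have pv' j : p v' (f j) = 0.
  rewrite /v' -scaleN1r pairingDl pairingZl pairing_suml mulN1r; apply/eqP; rewrite subr_eq0; apply/eqP.
  rewrite (bigD1 j) //= pairingZl de eqxx mulr1 big1 ?addr0 // => i ij.
  by rewrite pairingZl de (negbTE ij) mulr0.
have [v0|vn0] := eqVneq v' 0.
  by exists n, e, f; split=> //; apply/eqP; rewrite -subr_eq0 -/v' v0.
have [w0 hw0] : exists w, p v' w != 0.
  apply: NNPP => no; move/eqP: vn0; apply; case: hnd => h _; apply: h => w.
  by apply/eqP; apply: contraT => hw; case: no; exists w.
pose w' := (p v' w0)^-1 *: (w0 - \sum_i p (e i) w0 *: f i).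
have pw' j : p (e j) w' = 0.
  rewrite pairingZr -scaleN1r pairingDr pairingZr pairing_sumr mulN1r.
  rewrite (bigD1 j) //= pairingZr de eqxx mulr1 big1 ?addr0 ?subrr ?mulr0 // => i ij.
  by rewrite pairingZr de eq_sym (negbTE ij) mulr0.
have pvw : p v' w' = 1.
  rewrite pairingZr -scaleN1r pairingDr pairingZr pairing_sumr big1 ?mulr0 ?addr0 ?mulVf //.
  by move=> i _; rewrite pairingZr pv' mulr0.
pose e' (i : 'I_n.+1) := if unlift ord0 i is Some j then e j else v'.
pose f' (i : 'I_n.+1) := if unlift ord0 i is Some j then f j else w'.
have e0 : e' ord0 = v' by rewrite /e' unlift_none.
have f0 : f' ord0 = w' by rewrite /f' unlift_none.
have eS i : e' (lift ord0 i) = e i by rewrite /e' liftK.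
have fS i : f' (lift ord0 i) = f i by rewrite /f' liftK.
exists n.+1, e', f'; split.
- move=> i j; case: (unliftP ord0 i) => [i' ->|->]; case: (unliftP ord0 j) => [j' ->|->].
  + by rewrite eS fS de (inj_eq (lift_inj (h:=ord0))).
  + by rewrite eS f0 pw'.
  + by rewrite e0 fS pv'.
  + by rewrite e0 f0 pvw eqxx.
- rewrite /in_spanl big_ord_recl e0 f0.
  under eq_bigr do rewrite eS fS.
  have -> : p v w' = 1.
    have {1}-> : v = v' + \sum_i p v (f i) *: e i by rewrite subrK.
    by rewrite pairingDl pvw pairing_suml big1 ?addr0 // => i _; rewrite pairingZl pw' mulr0.
  by rewrite scale1r subrK.
- move=> x hx; rewrite /in_spanl big_ord_recl e0 f0.
  under eq_bigr do rewrite eS fS.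
  have -> : p x w' = 0 by rewrite hx pairing_suml big1 // => i _; rewrite pairingZl pw' mulr0.
  by rewrite scale0r add0r.
- move=> y hy; rewrite /in_spanr big_ord_recl e0 f0.
  under eq_bigr do rewrite eS fS.
  have -> : p v' y = 0 by rewrite hy pairing_sumr big1 // => i _; rewrite pairingZr pv' mulr0.
  by rewrite scale0r add0r.
Qed.
End DualSystems.

(** * Models containing prescribed operators and vectors *)

Section Mackey.
Variables (V W : lmodType K) (p : V -> W -> K).
Hypothesis hbil : bilinear_pairing p.
Hypothesis hnd : nondegenerate_pairing p.

Lemma exists_dual_system (lv : seq V) (lw : seq W) : exists n (e : 'I_n -> V) (f : 'I_n -> W),
  [/\ dual_system p e f, forall v, List.In v lv -> in_spanl p e f v & forall w, List.In w lw -> in_spanr p e f w].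
Proof.
elim: lw => [|w lw [n [e [f [de hv hw]]]]].
  elim: lv => [|v lv [n [e [f [de hv hw]]]]].
    by exists 0%N, (fun _ => 0), (fun _ => 0); split=> // -[].
  have [m [e' [f' [de' h1 h2 h3]]]] := dual_extend hbil hnd v de.
  by exists m, e', f'; split=> // x [<-//|/hv]; apply: h2.
(* Vectors of W are adjoined by the same extension for the transposed pairing. *)
pose q w v := p v w.
have qbil : bilinear_pairing q by case: hbil => h1 h2; split=> *; [apply: h2 | apply: h1].
have qnd : nondegenerate_pairing q by case: hnd => h1 h2; split.
have dq : dual_system q f e by move=> i j; rewrite /q de eq_sym.
have [m [f' [e' [de' h1 h2 h3]]]] := dual_extend qbil qnd w dq.
exists m, e', f'; split.
- by move=> i j; have := de' j i; rewrite /q eq_sym.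
- by move=> v /hv h; exact: (h3 v h).
- by move=> y [<-//|/hw h]; exact: (h2 y h).
Qed.

Lemma exists_model (ops : seq (V -> V)) (lv : seq V) (lw : seq W) : (forall x, List.In x ops -> gl p x) ->
  exists n (e : 'I_n -> V) (f : 'I_n -> W), [/\ dual_system p e f,
    forall x, List.In x ops -> in_op p e f x, forall v, List.In v lv -> in_spanl p e f v &
    forall w, List.In w lw -> in_spanr p e f w].
Proof.
move=> hops.
have [L hL] : exists L : seq (V * W), forall x, List.In x ops -> exists s, rep p s x /\ forall q, List.In q s -> List.In q L.
  elim: ops hops => [|x ops ih] h; first by exists [::].
  have [|L hL] := ih; first by move=> y yo; apply: h; right.
  have [s hs] := h x (or_introl erefl).
  exists (s ++ L) => y [<-|/hL [t [ht tL]]].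
    by exists s; split=> // q qs; apply/List.in_app_iff; left.
  by exists t; split=> // q /tL qL; apply/List.in_app_iff; right.
have [n [e [f [de hv hw]]]] := exists_dual_system (map fst L ++ lv) (map snd L ++ lw).
exists n, e, f; split=> //.
- move=> x /hL [s [hs sL]]; apply: (in_op_rep hbil hs) => q /sL qL.
  by split; [apply: hv | apply: hw]; apply/List.in_app_iff; left; apply: List.in_map.
- by move=> v vl; apply: hv; apply/List.in_app_iff; right.
- by move=> w wl; apply: hw; apply/List.in_app_iff; right.
Qed.

(** The tensor s may use vectors outside the model. It is compared with the tensor read off from the
    matrix of z inside a larger model containing the vectors of both. *)
Lemma trace_rep_indep n (e : 'I_n -> V) (f : 'I_n -> W) s z u : dual_system p e f ->
  in_op p e f z -> rep p s z -> oplinear u ->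
  \tr (rho p e f z * rho p e f u) = \sum_(q <- s) p (u q.1) q.2.
Proof.
move=> de hz hs lu.
set t := [seq (rho p e f z i j *: e i, f j) | i <- enum 'I_n, j <- enum 'I_n].
have ht : rep p t z by rewrite {1}hz; apply: op_rep.
have tsp q : List.In q t -> in_spanl p e f q.1 /\ in_spanr p e f q.2 by apply: op_rep_span.
rewrite (trace_rep hbil ht tsp lu).
have [m [e' [f' [de' hv hw]]]] := exists_dual_system (map fst (s ++ t)) (map snd (s ++ t)).
rewrite -(trace_rep hbil (e := e') (f := f') ht _ lu); last first.
  by move=> q qt; split; [apply: hv | apply: hw]; apply: List.in_map; apply/List.in_app_iff; right.
apply: (trace_rep hbil hs _ lu) => q qs.
by split; [apply: hv | apply: hw]; apply: List.in_map; apply/List.in_app_iff; left.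
Qed.
End Mackey.

(** * Finite-dimensional families of finitary operators *)

Section Solvability.
Variables (V W : lmodType K) (p : V -> W -> K).
Hypothesis hbil : bilinear_pairing p.
Hypothesis hnd : nondegenerate_pairing p.

Section Model.
Variables (n : nat) (e : 'I_n -> V) (f : 'I_n -> W).
Hypothesis de : dual_system p e f.
Local Notation op := (op p e f).
Local Notation rho := (rho p e f).
Local Notation in_op := (in_op p e f).

Lemma in_opP x : in_op x <-> exists a, x = op a.
Proof. by split=> [h|[a ->]]; [exists (rho x) | exact: in_op_op]. Qed.
Lemma in_op_subspace : subspace in_op.
Proof.
split; first by apply/in_opP; exists 0; rewrite op0.
split=> [x y|c x] /in_opP [a ->]; last by apply/in_opP; exists (c *: a); rewrite opZ.
by move=> /in_opP [b ->]; apply/in_opP; exists (a + b); rewrite opD.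
Qed.
Lemma in_op_subalgebra : subalgebra in_op.
Proof.
split; first exact: in_op_subspace.
by move=> x y /in_opP [a ->] /in_opP [b ->]; apply/in_opP; exists (br a b); rewrite op_br.
Qed.
Lemma pull_sp S : subspace S -> sp (fun a => S (op a)).
Proof.
move=> [S0 [Sa Ss]]; split; first by rewrite op0.
by move=> c a b ha hb; rewrite op_lin; apply: Sa => //; apply: Ss.
Qed.
Lemma pull_lie S : subalgebra S -> lie (fun a => S (op a)).
Proof.
by move=> [hS Sb]; split; [exact: pull_sp | move=> a b ha hb; rewrite op_br //; apply: Sb].
Qed.

Lemma derived_op (S : opset V) P x : (forall x, S x -> exists a, x = op a /\ P a) ->
  derived S x -> exists a, x = op a /\ brk P a.
Proof.
move=> h; apply: (derived_min (Q := fun x => exists a, x = op a /\ brk P a)).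
  split; first by exists 0; rewrite op0; split=> //; apply: sp0; exact: brk_sp.
  split=> [y z|c y] [a [-> ha]].
    by move=> [b [-> hb]]; exists (a + b); rewrite opD; split=> //; apply: (spD (brk_sp P)).
  by exists (c *: a); rewrite opZ; split=> //; apply: (spZ _ (brk_sp P)).
move=> y z /h [a [-> Pa]] /h [b [-> Pb]]; exists (br a b); rewrite op_br //; split=> //.
exact: brk_in.
Qed.
Lemma derived_series_op k (S : opset V) P x : (forall x, S x -> exists a, x = op a /\ P a) ->
  derived_series k S x -> exists a, x = op a /\ dser k P a.
Proof. by move=> h; elim: k x => [|k ih] x /=; [exact: h | apply: derived_op]. Qed.
Lemma brk_derived (S : opset V) P a : (forall a, P a -> S (op a)) -> brk P a -> derived S (op a).
Proof.
move=> h; apply: (brk_sub (P := fun a => derived S (op a))).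
  by apply: pull_sp; exact: span_subspace.
by move=> u v Pu Pv; rewrite op_br //; apply: derived_in; apply: h.
Qed.
Lemma dser_derived_series k (S : opset V) P a : (forall a, P a -> S (op a)) ->
  dser k P a -> derived_series k S (op a).
Proof. by move=> h; elim: k a => [|k ih] a /=; [exact: h | apply: brk_derived]. Qed.

(** By Cartan's criterion the derived algebra consists of nilpotent matrices, so Engel's flag
    exhausts the space, and the k-th derived algebra lowers that flag by k steps. *)
Lemma traceless_solvable S : subalgebra S -> incl S in_op ->
  (forall x y, S x -> S y -> \tr (rho x * rho y) = 0) -> solvable S.
Proof.
move=> aS Sop tS; pose N a := S (op a).
have lN : lie N by apply: pull_lie.
have tN a b : N a -> N b -> \tr (a * b) = 0.
  by move=> Na Nb; have := tS _ _ Na Nb; rewrite !opK.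
have nB y : brk N y -> mxnil y by apply: cartan_nilpotent.
have lB : lie (brk N).
  split; first exact: brk_sp.
  by move=> y z /(lie_brk lN) Ny /(lie_brk lN) Nz; apply: brk_in.
have full v := nil_lie_prod lB nB v.
have fsp i := @flag_sp n (brk N) i.
have desc k a : dser k.+1 N a -> forall i v, flag (brk N) i v -> flag (brk N) (i - k.+1) (a *m v).
  elim: k a => [|k ih] a /=.
    move=> Ba [|i] v /=; first by move=> ->; rewrite mulmx0.
    by rewrite subn1 /=; apply.
  apply: (brk_sub (P := fun a => forall i v, flag (brk N) i v -> flag (brk N) (i - k.+2) (a *m v))).
    split=> [i v _|c x y hx hy i v hv]; first by rewrite mul0mx; apply: sp0.
    by rewrite mulmxDl -scalemxAl; case: (fsp (i - k.+2)%N) => _; apply; [apply: hx | apply: hy].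
  move=> x y hx hy i v hv; rewrite mulmxBl !mxMv; apply: (spB (fsp _)).
    apply: (@flag_le _ _ (i - k.+1 - k.+1)); last by apply ih => //; apply ih.
    by lia.
  apply: (@flag_le _ _ (i - k.+1 - k.+1)); last by apply ih => //; apply ih.
  by lia.
exists n.+1 => x /(derived_series_op (P := N)) [].
  by move=> y Sy; exists (rho y); split; [exact: Sop | rewrite /N -(Sop y Sy)].
move=> a [-> Da]; rewrite (_ : a = 0) ?op0 //.
apply: mx_eq0_vec => v; have := desc n a Da n v (full v).
by rewrite (_ : (n - n.+1)%N = 0%N) //; lia.
Qed.

(** Inside a model S is spanned by finitely many elements, so it lies in the Lie algebra they
    generate. *)
Lemma locally_solvable_solvable (r S : opset V) : locally_solvable r -> subspace S -> incl S r ->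
  incl S in_op -> solvable S.
Proof.
move=> hr hS Sr Sop.
have [l [lS hl]] := finite_basis (@op_lin _ _ p n e f) hS.
apply: (@solvable_mono _ _ (gen l)); last by apply: hr => x /lS/Sr.
move=> x Sx; have := hl (rho x); rewrite -(Sop x Sx) => /(_ Sx).
by apply: (span_min (Q := gen l)); [case: (gen_subalgebra l) | move=> y; apply: gen_in].
Qed.
End Model.

Lemma fin_dim_model (S : opset V) : fin_dim S -> incl S (gl p) -> exists n (e : 'I_n -> V) (f : 'I_n -> W),
  dual_system p e f /\ incl S (in_op p e f).
Proof.
move=> [l [lS hl]] Sgl.
have [|n [e [f [de hop _ _]]]] := exists_model hbil hnd (ops := l) [::] [::].
  by move=> x /lS/Sgl.
exists n, e, f; split=> // x /hl; apply: (span_min (Q := in_op p e f)); first exact: in_op_subspace.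
exact: hop.
Qed.

(** The trace form of a model is nondegenerate on S, as its radical is a solvable ideal. An element
    orthogonal to all brackets is then central and spans a solvable ideal, so it vanishes. *)
Lemma semisimple_perfect (S : opset V) : subalgebra S -> fin_dim S -> semisimple S -> incl S (gl p) ->
  incl S (derived S).
Proof.
move=> aS fS ss Sgl x Sx; have [n [e [f [de Sop]]]] := fin_dim_model fS Sgl.
have [sS bS] := aS.
pose N a := S (op p e f a).
have lN : lie N by apply: pull_lie.
have [hN bN] := lN.
have SN y : S y -> N (rho p e f y) by move=> Sy; rewrite /N -(Sop y Sy).
pose I y := S y /\ forall z, S z -> \tr (rho p e f y * rho p e f z) = 0.
have subI : subspace I.
  have [S0 [Sa Ss]] := sS.
  split; first by split=> // z _; rewrite -(op0 p e f) opK // mul0r mxtrace0.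
  split=> [y z|c y] [Sy hy].
    move=> [Sz hz]; split; first exact: Sa.
    by move=> t St; rewrite rhoD // mulrDl linearD /= hy // hz // addr0.
  split; first exact: Ss.
  move=> z Sz; have -> : rho p e f (opscale c y) = c *: rho p e f y.
    by apply/matrixP => i j; rewrite !mxE pairingZl.
  by rewrite mxZl linearZ /= hy // mulr0.
have rho_br y z : S y -> S z -> rho p e f (opbr y z) = br (rho p e f y) (rho p e f z).
  by move=> /Sop hy /Sop hz; rewrite {1}hy {1}hz -op_br // opK.
have idI : ideal I S.
  split=> //; split; first by move=> y [].
  move=> y z Sy [Sz hz]; split; first exact: bS.
  move=> t St; rewrite rho_br // brN mulNr linearN /= trace_br -rho_br // hz ?oppr0 //.
  exact: bS.
have I0 y : I y -> y = @opzero V.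
  apply: ss => //; apply: (traceless_solvable de).
  - by split=> // y1 z [Sy hy] Iz; case: idI => _ [_]; apply.
  - by move=> y1 [/Sop].
  - by move=> y1 z [_ hy] [Sz _]; apply: hy.
have N0 a : N a -> (forall b, N b -> \tr (a * b) = 0) -> a = 0.
  move=> Na ha; apply: (op_inj hbil de); rewrite op0; apply: I0; split=> // z /SN Nz.
  by rewrite opK //; apply: ha.
have [|u [v [Bu Nv tv eu]]] := perfect_mod_radical lN _ (SN x Sx).
  move=> z Nz hz y Ny.
  have central t : N t -> br z t = 0.
    move=> Nt; apply: N0; first exact: bN.
    by move=> b Nb; rewrite trace_br; apply: hz.
  suff -> : z = 0 by rewrite mul0r mxtrace0.
  pose C t := exists c, t = op p e f (c *: z).
  have Czero t : C t -> t = @opzero V.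
    apply: ss.
      split; last split.
      - split; first by exists 0; rewrite scale0r op0.
        split=> [t1 t2 [c1 ->] [c2 ->]|c t1 [c1 ->]].
          by exists (c1 + c2); rewrite scalerDl opD.
        by exists (c * c1); rewrite -scalerA [RHS]opZ.
      - by move=> _ [c ->]; apply: (spZ _ hN).
      - move=> y1 _ Sy1 [c ->]; exists 0.
        rewrite [in LHS](Sop y1 Sy1) -op_br // brZr brN central ?oppr0 ?scaler0 ?scale0r //.
        exact: SN.
    exists 1%N => t1; apply: (derived_min (Q := fun t => t = @opzero V)).
      split=> //; split=> [a1 a2 -> ->|c a1 ->]; apply: op_ext => w.
        by rewrite /opadd /opzero addr0.
      by rewrite /opscale /opzero scaler0.
    move=> _ _ [c1 ->] [c2 ->]; rewrite -op_br // brZl brZr.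
    by rewrite /br subrr !scaler0 op0.
  apply: (op_inj hbil de); rewrite op0; apply: Czero; exists 1; by rewrite scale1r.
have v0 : v = 0 by apply: N0.
rewrite [x](Sop x Sx) eu v0 addr0; exact: (@brk_derived _ _ _ de S N u (fun a h => h) Bu).
Qed.
End Solvability.

(** * The double of a finite-dimensional model *)

(** Picks finitely many members of an infinite family without losing its span; the family used later
    is that of the compressions of all words in g. *)
Lemma finite_spanning_family (L : vectType K) (T : Type) (C : T -> Prop) (phi : T -> L) :
  exists ts : seq T, (forall t, List.In t ts -> C t) /\
    forall t, C t -> forall Q, sp Q -> (forall t', List.In t' ts -> Q (phi t')) -> Q (phi t).
Proof.
pose P k := exists ts : seq T, (forall t, List.In t ts -> C t) /\ \dim <<map phi ts>>%VS = k.
have [||k [[ts [tsC dk]] hmax]] := @bounded_max P (\dim {: L}).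
- by exists (\dim <<map phi [::]>>%VS), [::].
- by move=> k [ts [_ <-]]; apply: dimvS; apply: subvf.
exists ts; split=> // t Ct Q hQ hts.
have : P (\dim <<map phi (t :: ts)>>%VS).
  by exists (t :: ts); split=> // t' [<-//|/tsC].
move=> /hmax; rewrite -dk => hle.
have e : <<map phi ts>>%VS = <<map phi (t :: ts)>>%VS.
  by apply/eqP; rewrite eqEdim hle andbT /= span_cons addvSr.
have h : phi t \in <<in_tuple (map phi ts)>>%VS by rewrite /= e; apply: memv_span; rewrite inE eqxx.
rewrite (coord_span h); apply: sp_sum => // i _; apply: spZ => //.
have : (map phi ts)`_i \in map phi ts by apply: mem_nth.
by move=> /In_mem /List.in_map_iff [t' [<- /hts]].
Qed.

Lemma derived_finite (V : lmodType K) (S : opset V) m : derived S m ->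
  exists bs : seq (V -> V), (forall b, List.In b bs -> S b) /\ derived (fun x => List.In x bs) m.
Proof.
apply: (derived_min (Q := fun m => exists bs : seq (V -> V), (forall b, List.In b bs -> S b) /\ derived (fun x => List.In x bs) m)).
  split; first by exists [::]; split=> //; case: (span_subspace (fun h => exists a b : V -> V, List.In a [::] /\ List.In b [::] /\ h = opbr a b)).
  split=> [f h|c f] [bs [hbs df]].
    move=> [cs [hcs dh]]; exists (bs ++ cs); split.
      by move=> b /List.in_app_iff [/hbs|/hcs].
    have [_ [Sa _]] := span_subspace (fun h => exists a b : V -> V, List.In a (bs ++ cs) /\ List.In b (bs ++ cs) /\ h = opbr a b).
    apply: Sa; [apply: derived_mono df | apply: derived_mono dh] => x xs; apply/List.in_app_iff; by [left | right].
  exists bs; split=> //.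
  by have [_ [_ Ss]] := span_subspace (fun h => exists a b : V -> V, List.In a bs /\ List.In b bs /\ h = opbr a b); apply: Ss.
move=> a b Sa Sb; exists [:: a; b]; split; first by move=> x [<-|[<-|[]]].
by apply: derived_in => /=; [left | right; left].
Qed.

(* The diagonal embedding of x acting on V and on its dual; on it the antiautomorphism [star]
   exchanging the two blocks acts by -1. *)
Section Double.
Variable n : nat.
Implicit Types (a b : 'M[K]_n).

(** The second argument is stored transposed: its multiplication is reversed, and [star] merely
    exchanges the two arguments. *)
Definition ht a b : 'M[K]_(n + n) := block_mx a 0 0 b^T.
Definition hat a := ht a (- a).
Definition swap_mx : 'M[K]_(n + n) := block_mx 0 1%:M 1%:M 0.
Definition star (x : 'M[K]_(n + n)) : 'M[K]_(n + n) := swap_mx *m x^T *m swap_mx.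

Lemma swap_mxK : swap_mx *m swap_mx = 1%:M.
Proof. by rewrite mulmx_block !(mul0mx, mulmx0, mul1mx, add0r, addr0) -scalar_mx_block. Qed.
Lemma swap_mxT : swap_mx^T = swap_mx.
Proof. by rewrite tr_block_mx !trmx0 !trmx1. Qed.
Lemma star_lin c x y : star (c *: x + y) = c *: star x + star y.
Proof. by rewrite /star linearP /= mulmxDr mulmxDl -scalemxAr -scalemxAl. Qed.
Lemma starM (x y : 'M[K]_(n + n)) : star (x * y) = star y * star x.
Proof.
rewrite /star [(x * y)^T]trmx_mul -[RHS]/(_ *m _) !mulmxA.
by rewrite -[_ *m swap_mx *m swap_mx]mulmxA swap_mxK mulmx1.
Qed.
Lemma starK x : star (star x) = x.
Proof.
rewrite /star !trmx_mul trmxK swap_mxT !mulmxA swap_mxK mul1mx.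
by rewrite -mulmxA swap_mxK mulmx1.
Qed.
Lemma star_tr x : \tr (star x) = \tr x.
Proof. by rewrite /star mxtrace_mulC mulmxA swap_mxK mul1mx mxtrace_tr. Qed.
Lemma star_ht a b : star (ht a b) = ht b a.
Proof.
rewrite /star /ht tr_block_mx trmxK !trmx0 !mulmx_block.
by rewrite !(mul0mx, mulmx0, mul1mx, mulmx1, add0r, addr0).
Qed.
Lemma htM a b a' b' : ht a b * ht a' b' = ht (a * a') (b' * b).
Proof.
rewrite /ht -[LHS]/(_ *m _) mulmx_block !(mul0mx, mulmx0, add0r, addr0).
by rewrite -[(b' * b)]/(b' *m b) trmx_mul.
Qed.
Lemma ht_lin c a b a' b' : ht (c *: a + a') (c *: b + b') = c *: ht a b + ht a' b'.
Proof. by rewrite /ht scale_block_mx add_block_mx linearP /= !scaler0 !addr0. Qed.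
Lemma tr_ht a b : \tr (ht a b) = \tr a + \tr b.
Proof. by rewrite /ht mxtrace_block mxtrace_tr. Qed.
Lemma ht11 : ht 1 1 = 1.
Proof. by rewrite /ht trmx1 -scalar_mx_block. Qed.
Lemma htZ c a b : c *: ht a b = ht (c *: a) (c *: b).
Proof. by rewrite /ht scale_block_mx !scaler0 linearZ. Qed.
Lemma htB a b a' b' : ht a b - ht a' b' = ht (a - a') (b - b').
Proof. by rewrite /ht opp_block_mx add_block_mx !oppr0 !addr0 linearB. Qed.

Lemma hat_lin c a b : hat (c *: a + b) = c *: hat a + hat b.
Proof. by rewrite /hat -ht_lin opprD scalerN. Qed.
Lemma star_hat a : star (hat a) = - hat a.
Proof. by rewrite /hat star_ht -[- ht _ _]scaleN1r htZ !scaleN1r opprK. Qed.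
Lemma hat_inj : injective hat.
Proof. by move=> a b; rewrite /hat /ht => /eq_block_mx [-> _ _ _]. Qed.
Lemma hat_br a b : hat (br a b) = br (hat a) (hat b).
Proof.
rewrite /hat /br !htM htB; congr (ht _ _); non_commutative_ring.
Qed.

Definition hats (P : 'M[K]_n -> Prop) (y : 'M[K]_(n + n)) := exists a, P a /\ y = hat a.
Lemma hatsE P a : hats P (hat a) <-> P a.
Proof. by split=> [[b [Pb /hat_inj ->]]//|Pa]; exists a. Qed.
Lemma hat0 : hat 0 = 0.
Proof. by have := hat_lin (-1) 0 0; rewrite scaler0 addr0 scaleN1r addNr. Qed.
Lemma hats_sp P : sp P -> sp (hats P).
Proof.
move=> hP; split; first by exists 0; rewrite hat0; split=> //; apply: sp0.
move=> c _ _ [a [Pa ->]] [b [Pb ->]]; exists (c *: a + b); rewrite hat_lin; split=> //.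
by case: hP => _; apply.
Qed.
Lemma hats_lie P : lie P -> lie (hats P).
Proof.
move=> [hP bP]; split; first exact: hats_sp.
by move=> _ _ [a [Pa ->]] [b [Pb ->]]; exists (br a b); rewrite hat_br; split=> //; apply: bP.
Qed.
Lemma hats_brk P y : brk (hats P) y -> hats (brk P) y.
Proof.
apply: (brk_sub (P := hats (brk P))); first by apply: hats_sp; exact: brk_sp.
by move=> _ _ [a [Pa ->]] [b [Pb ->]]; exists (br a b); rewrite hat_br; split=> //; apply: brk_in.
Qed.
Lemma brk_hats P a : brk P a -> brk (hats P) (hat a).
Proof.
apply: (brk_sub (P := fun a => brk (hats P) (hat a))).
  split; first by rewrite hat0; apply: sp0; exact: brk_sp.
  by move=> c u v hu hv; rewrite hat_lin; case: (brk_sp (hats P)) => _; apply.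
by move=> u v Pu Pv; rewrite hat_br; apply: brk_in; apply/hatsE.
Qed.
Lemma hats_dser k P y : dser k (hats P) y -> hats (dser k P) y.
Proof.
elim: k y => //= k ih y hy; apply: hats_brk; move: hy.
apply: (brk_sub (P := brk (hats (dser k P)))); first exact: brk_sp.
by move=> u v /ih hu /ih hv; apply: brk_in.
Qed.
Lemma hats_lideal I N : lideal I N -> lideal (hats I) (hats N).
Proof.
move=> [hI IN hNI]; split; first exact: hats_sp.
  by move=> _ [a [Ia ->]]; apply/hatsE; apply: IN.
by move=> _ _ [a [Na ->]] [b [Ib ->]]; rewrite -hat_br; apply/hatsE; apply: hNI.
Qed.
End Double.

Section Words.
Variable V : lmodType K.

(* word2 is the transpose of the action of the word on the dual, where x acts by minus its transpose. *)
Fixpoint word1 (w : seq (V -> V)) : V -> V := if w is x :: w' then fun y => x (word1 w' y) else id.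
Fixpoint word2 (w : seq (V -> V)) : V -> V := if w is x :: w' then fun y => - word2 w' (x y) else id.

Variable g : opset V.
Hypothesis glin : forall x, g x -> oplinear x.
Definition word_in w := forall x, List.In x w -> g x.

Lemma word1_linear w : word_in w -> oplinear (word1 w).
Proof.
elim: w => [|x w ih] h //= a y z.
rewrite ih; last by move=> t tw; apply: h; right.
by apply: glin; apply: h; left.
Qed.
Lemma word2_linear w : word_in w -> oplinear (word2 w).
Proof.
elim: w => [|x w ih] h //= a y z.
rewrite glin; last by apply: h; left.
rewrite ih; last by move=> t tw; apply: h; right.
by rewrite opprD scalerN.
Qed.
Lemma word_in_rcons w x : word_in w -> g x -> word_in (rcons w x).
Proof. by move=> h gx y; rewrite -cats1 => /List.in_app_iff [/h|[<-|[]]]. Qed.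
Lemma word_in_cons w x : word_in w -> g x -> word_in (x :: w).
Proof. by move=> h gx y [<-|/h]. Qed.
Lemma word_in_rev w : word_in w -> word_in (rev w).
Proof.
elim: w => //= x w ih h; rewrite rev_cons; apply: word_in_rcons; last by apply: h; left.
by apply: ih => y yw; apply: h; right.
Qed.
Lemma word1_rcons w x y : word1 (rcons w x) y = word1 w (x y).
Proof. by elim: w => //= z w ->. Qed.
Lemma word2_rcons w x y : g x -> word2 (rcons w x) y = - x (word2 w y).
Proof.
move=> gx; elim: w y => //= z w ih y.
by have := oplinearZ (-1) (word2 w (z y)) (glin gx); rewrite !scaleN1r => ->; rewrite ih.
Qed.
(** The scalar is the sign given by the length. It lets [star] send a word to a multiple of its
    reverse, which makes J0 stable under [star]. *)
Lemma word_rev w : word_in w -> exists c : K, forall y,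
  word2 w y = c *: word1 (rev w) y /\ word1 w y = c *: word2 (rev w) y.
Proof.
elim: w => [|x w ih] h; first by exists 1 => y; rewrite /rev /= scale1r.
have gx : g x by apply: h; left.
have [|c hc] := ih; first by move=> y yw; apply: h; right.
exists (- c) => y; rewrite rev_cons word1_rcons word2_rcons //=.
have [-> _] := hc (x y); have [_ ->] := hc y.
by rewrite (oplinearZ _ _ (glin gx)) scaleNr scalerN scaleNr opprK.
Qed.
End Words.

(** * Orthogonality to words and the choice of a large finite piece of g *)

Section LeviModel.
Variables (V W : lmodType K) (p : V -> W -> K).
Hypothesis hbil : bilinear_pairing p.
Hypothesis hnd : nondegenerate_pairing p.
Variable g : opset V.
Hypothesis hg : subalgebra g.
Hypothesis hgl : incl g (gl p).

Let glin x : g x -> oplinear x.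
Proof. by move=> /hgl [s hs]; apply: (rep_linear hbil hs). Qed.

(* The difference of the two sums is the trace of x w on the direct sum of V and its dual. *)
Definition word_orthogonal x := derived g x /\ exists s, rep p s x /\
  forall w, word_in g w -> \sum_(q <- s) p (word1 w q.1) q.2 = \sum_(q <- s) p (word2 w q.1) q.2.

Section Model.
Variables (n : nat) (e : 'I_n -> V) (f : 'I_n -> W).
Hypothesis de : dual_system p e f.
Local Notation op := (op p e f).
Local Notation rho := (rho p e f).
Local Notation in_op := (in_op p e f).
Local Notation N := (fun a => g (op a)).

Definition word_mx w := ht (rho (word1 w)) (rho (word2 w)).
(** The space J0 inside the double. The words run over all of g, with letters that may lie outside
    the model. *)
Definition word_radical y := alg (hats N) y /\ forall w, word_in g w -> \tr (y * word_mx w) = 0.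

Let rhoN u : rho (fun y => - u y) = - rho u.
Proof. by apply/matrixP => i j; rewrite !mxE -scaleN1r pairingZl // mulN1r. Qed.
Let rhoZ c u : rho (fun y => c *: u y) = c *: rho u.
Proof. by apply/matrixP => i j; rewrite !mxE pairingZl. Qed.

Lemma word_mx_nil : word_mx [::] = 1.
Proof.
rewrite /word_mx /= -ht11; suff -> : rho id = 1 by [].
by apply/matrixP => i j; rewrite !mxE de eq_sym.
Qed.
(** Compression is multiplicative here, whatever the letters of w, because [op a] both starts and
    ends in the model. *)
Lemma word_mx_cons a w : N a -> word_in g w -> word_mx (op a :: w) = hat a * word_mx w.
Proof.
move=> Na gw; rewrite /hat htM /word_mx /= rho_compl //.
by rewrite rhoN rho_compr ?mulrN //; apply: word2_linear gw.
Qed.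
Lemma word_mx_rcons a w : N a -> word_in g w -> word_mx (rcons w (op a)) = word_mx w * hat a.
Proof.
move=> Na gw; rewrite /hat htM /word_mx; congr ht.
  rewrite -rho_compr //; last exact: word1_linear gw.
  by congr rho; apply: op_ext => y; rewrite word1_rcons.
rewrite mulNr -rho_compl // -rhoN; congr rho; apply: op_ext => y.
by rewrite (word2_rcons glin).
Qed.
Lemma star_word_mx w : word_in g w -> exists c : K, star (word_mx w) = c *: word_mx (rev w).
Proof.
move=> gw; have [c hc] := word_rev glin gw; exists c.
rewrite star_ht htZ -!rhoZ; congr ht; congr rho; apply: op_ext => y; by case: (hc y).
Qed.

Lemma word_radical_sp : sp word_radical.
Proof.
apply: sp_cap; first exact: alg_sp.
apply: (@sp_all _ _ (word_in g) (fun w y => \tr (y * word_mx w) = 0)) => w _.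
split=> [|c x y hx hy]; first by rewrite mul0r mxtrace0.
by rewrite mulrDl mxZl linearD linearZ /= hx hy mulr0 addr0.
Qed.
Lemma word_radical_l a y : alg (hats N) a -> word_radical y -> word_radical (a * y).
Proof.
move=> Aa; move: y.
apply: (Aa (fun a => forall y, word_radical y -> word_radical (a * y))).
- split=> [y _|c u v hu hv y hy]; first by rewrite mul0r; exact: (sp0 word_radical_sp).
  by rewrite mulrDl mxZl; case: word_radical_sp => _; apply; [apply: hu | apply: hv].
- by move=> u v hu hv y hy; rewrite -mulrA; apply: hu; apply: hv.
- move=> _ [c [Nc ->]] y [Ay hy]; split; first by apply: alg_mul => //; apply: alg_in; apply/hatsE.
  move=> w gw; rewrite -mulrA mxtr_mulC -mulrA -word_mx_rcons //.
  by apply: hy; apply: word_in_rcons.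
Qed.
Lemma word_radical_r y a : word_radical y -> alg (hats N) a -> word_radical (y * a).
Proof.
move=> hy Aa; move: y hy.
apply: (Aa (fun a => forall y, word_radical y -> word_radical (y * a))).
- split=> [y _|c u v hu hv y hy]; first by rewrite mulr0; exact: (sp0 word_radical_sp).
  by rewrite mulrDr mxZr; case: word_radical_sp => _; apply; [apply: hu | apply: hv].
- by move=> u v hu hv y hy; rewrite mulrA; apply: hv; apply: hu.
- move=> _ [c [Nc ->]] y [Ay hy]; split; first by apply: alg_mul => //; apply: alg_in; apply/hatsE.
  move=> w gw; rewrite -mulrA -word_mx_cons //.
  by apply: hy; apply: word_in_cons.
Qed.
Lemma word_radical_star y : word_radical y -> word_radical (star y).
Proof.
move=> [Ay hy]; split.
  apply: (Ay (fun y => alg (hats N) (star y))).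
  - split=> [|c u v hu hv]; last by rewrite star_lin; case: (alg_sp (hats N)) => _; apply.
    have := star_lin (-1) (0 : 'M[K]_(n + n)) 0; rewrite scaler0 addr0 scaleN1r addNr => ->.
    by apply: sp0; exact: alg_sp.
  - by move=> u v hu hv; rewrite starM; apply: alg_mul.
  - move=> _ [c [Nc ->]]; rewrite star_hat; apply: (spN (alg_sp _)); apply: alg_in; exact/hatsE.
move=> w gw; have [c hc] := star_word_mx gw.
rewrite -(starK (word_mx w)) -starM star_tr hc mxZl linearZ /= mxtr_mulC hy ?mulr0 //.
exact: word_in_rev.
Qed.
Lemma word_radical_rad y : word_radical y -> trrad (alg (hats N)) y.
Proof.
move=> hy; split; first by case: hy.
move=> b Ab; suff h : forall y, word_radical y -> word_radical (y * b) /\ \tr (y * b) = 0 by case: (h y hy).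
apply: (Ab (fun b => forall y, word_radical y -> word_radical (y * b) /\ \tr (y * b) = 0)).
- split=> [z hz|c u v hu hv z hz].
    by rewrite mulr0 mxtrace0; split=> //; exact: (sp0 word_radical_sp).
  have [h1 h2] := hu z hz; have [h3 h4] := hv z hz.
  rewrite mulrDr mxZr linearD linearZ /= h2 h4 mulr0 addr0; split=> //.
  by case: word_radical_sp => _; apply.
- move=> u v hu hv z hz; rewrite mulrA; have [h1 _] := hu z hz; exact: hv.
- move=> _ [c [Nc ->]] z hz; split.
    by apply: word_radical_r => //; apply: alg_in; apply/hatsE.
  have gw : word_in g [:: op c] by move=> x [<-|[]].
  by have [_ /(_ _ gw)] := hz; rewrite word_mx_cons ?word_mx_nil ?mulr1.
Qed.

Lemma word_radical_orthogonal a : derived g (op a) -> word_radical (hat a) -> word_orthogonal (op a).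
Proof.
move=> da [_ ha]; split=> //.
exists [seq (a i j *: e i, f j) | i <- enum 'I_n, j <- enum 'I_n]; split; first exact: op_rep.
move=> w gw; have := ha w gw.
have ta u : oplinear u -> \tr (a * rho u) = \sum_(q <- [seq (a i j *: e i, f j) | i <- enum 'I_n, j <- enum 'I_n]) p (u q.1) q.2.
  move=> lu; rewrite -{1}(opK hbil de a).
  by apply: (trace_rep hbil (@op_rep _ _ p n e f a) _ lu); apply: op_rep_span.
have l1 := word1_linear glin gw; have l2 := word2_linear glin gw.
by rewrite /hat htM tr_ht mulrN linearN /= [\tr (_ * a)]mxtr_mulC !ta // => /eqP; rewrite subr_eq0 => /eqP.
Qed.

(* Traces of u against operators in the span of the v_i (x) w_j see u only through the p (u v_i) w_j. *)
Section Corner.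
Variables (r : nat) (v : 'I_r -> V) (w : 'I_r -> W).
Hypothesis hv : forall i, in_spanl p e f (v i).
Hypothesis hw : forall j, in_spanr p e f (w j).
Let Vm : 'M[K]_(n, r) := \matrix_(k, i) p (v i) (f k).
Let Wm : 'M[K]_(r, n) := \matrix_(j, k) p (e k) (w j).
Definition compress (u : V -> V) : 'M[K]_r := \matrix_(j, i) p (u (v i)) (w j).

Lemma compressE u : oplinear u -> compress u = Wm *m rho u *m Vm.
Proof.
move=> lu; apply/matrixP => j i; rewrite !mxE.
rewrite {1}(hv i) oplinear_sum // pairing_suml //; apply: eq_bigr => l _.
rewrite oplinearZ // pairingZl // !mxE mulrC; congr (_ * _).
rewrite {1}(hw j) pairing_sumr //; apply: eq_bigr => k _.
by rewrite pairingZr // !mxE.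
Qed.

Definition corner y := exists C1 C2 : 'M[K]_r, y = ht (Vm *m C1 *m Wm) (Vm *m C2 *m Wm).

Lemma corner_sp : sp corner.
Proof.
split.
  exists 0, 0; rewrite !mulmx0 !mul0mx.
  by have := ht_lin (-1) (0 : 'M[K]_n) 0 0 0; rewrite !scaler0 !addr0 scaleN1r addNr.
move=> c _ _ [C1 [C2 ->]] [D1 [D2 ->]]; exists (c *: C1 + D1), (c *: C2 + D2).
by rewrite -ht_lin !mulmxDr !mulmxDl -!scalemxAr -!scalemxAl.
Qed.
Lemma corner_mid y a b z : corner y -> corner z -> corner (y * ht a b * z).
Proof.
move=> [C1 [C2 ->]] [D1 [D2 ->]].
exists (C1 *m Wm *m a *m Vm *m D1), (D2 *m Wm *m b *m Vm *m C2).
by rewrite !htM; congr ht; rewrite -!mulmxE !mulmxA.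
Qed.
Lemma corner_hat x (C : 'M[K]_r) : (forall y, x y = \sum_i \sum_j (C i j * p y (w j)) *: v i) -> corner (hat (rho x)).
Proof.
move=> hx; suff -> : rho x = Vm *m C *m Wm.
  by exists C, (- C); rewrite /hat mulmxN mulNmx.
apply/matrixP => k l; rewrite !mxE hx pairing_suml //.
transitivity (\sum_i \sum_j p (v i) (f k) * C i j * p (e l) (w j)).
  apply: eq_bigr => i _; rewrite pairing_suml //; apply: eq_bigr => j _.
  by rewrite pairingZl //; ring.
rewrite exchange_big /=; apply: eq_bigr => j _; rewrite !mxE mulr_suml.
by apply: eq_bigr => i _; rewrite !mxE.
Qed.

(** The trace of y against a word is linear in the compressed word, which reduces the test to [ws].
    The letters of these words lie in the model, so their matrices are in the algebra of N, or equal
    1 for the empty word, where nilpotency of y gives trace zero. *)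
Lemma corner_radical (ws : seq (seq (V -> V))) y :
  (forall t, List.In t ws -> word_in g t /\ forall x, List.In x t -> in_op x) ->
  (forall t, word_in g t -> forall Q : 'M[K]_(r, r + r) -> Prop, sp Q ->
     (forall t', List.In t' ws -> Q (row_mx (compress (word1 t')) (compress (word2 t')))) ->
     Q (row_mx (compress (word1 t)) (compress (word2 t)))) ->
  corner y -> trrad (alg (hats N)) y -> word_radical y.
Proof.
move=> hws span [C1 [C2 ey]] hy; have [Ay ty] := hy; split=> // t gt.
pose Q (X : 'M[K]_(r, r + r)) := \tr (C1 *m lsubmx X) + \tr (C2 *m rsubmx X) = 0.
have Qsp : sp Q.
  split; first by rewrite /Q !linear0 /= ?mulmx0 ?mxtrace0 ?addr0.
  move=> a X Y; rewrite /Q !linearP /= => hX hY.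
  by rewrite addrACA hY addr0 -mulrDr hX mulr0.
have QE t' : word_in g t' -> Q (row_mx (compress (word1 t')) (compress (word2 t'))) <-> \tr (y * word_mx t') = 0.
  move=> gt'; rewrite /Q row_mxKl row_mxKr ey htM tr_ht.
  rewrite !compressE; [|exact: word2_linear gt'|exact: word1_linear gt'].
  have tE C u : \tr (C *m (Wm *m rho u *m Vm)) = \tr (Vm *m C *m Wm * rho u).
    by rewrite -mulmxE mulmxA mxtrace_mulC !mulmxA.
  by rewrite !tE [\tr (rho _ * _)]mxtr_mulC.
apply/QE => //; apply: span => // t' /hws [gt' opt']; apply/QE => //.
have : t' = [::] \/ alg (hats N) (word_mx t').
  elim: t' gt' opt' => [|x t' ih] gt' opt'; [by left | right].
  have gx : g x by apply: gt'; left.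
  have gt1 : word_in g t' by move=> z zt; apply: gt'; right.
  have xop : x = op (rho x) by apply: opt'; left.
  have Nx : N (rho x) by rewrite -xop.
  rewrite xop word_mx_cons //.
  have Ax : alg (hats N) (hat (rho x)) by apply: alg_in; apply/hatsE.
  case: ih => [//|z zt|->|At]; first by apply: opt'; right.
    by rewrite word_mx_nil mulr1.
  exact: alg_mul.
case=> [->|]; last exact: ty.
rewrite word_mx_nil mulr1; exact: trrad_trace hy.
Qed.
End Corner.
End Model.

(** The existential J hides the double: it is the part of the radical of the algebra of N lying on
    the diagonal embedding. The fourth clause will be applied to r, the fifth to preimages of
    solvable ideals. *)
Lemma exists_levi_model (ms : seq (V -> V)) : (forall m, List.In m ms -> derived g m) ->
  exists n (e : 'I_n -> V) (f : 'I_n -> W) (S J : 'M[K]_n -> Prop),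
  [/\ dual_system p e f,
    lie S /\ (forall a, S a -> g (op p e f a) /\ brk (fun a => g (op p e f a)) a),
    forall m, List.In m ms -> exists a, m = op p e f a /\ S a,
    forall I k, lideal I (fun a => g (op p e f a)) -> (forall a, dser k I a -> a = 0) ->
      forall a, I a -> brk (fun a => g (op p e f a)) a -> J a &
    forall I k, lideal I S -> (forall a, dser k I a -> J a) -> forall a, I a -> word_orthogonal (op p e f a)].
Proof.
move=> hms.
have derg x : derived g x -> g x by case: hg => sg bg; apply: derived_min.
have [L hL] : exists L : seq (V * W), forall m, List.In m ms ->
    exists s, rep p s m /\ forall q, List.In q s -> List.In q L.
  elim: ms hms => [|m ms ih] h; first by exists [::].
  have [|L hL] := ih; first by move=> y yo; apply: h; right.
  have [s hs] := hgl (derg m (h m (or_introl erefl))).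
  exists (s ++ L) => y [<-|/hL [t [ht tL]]].
    by exists s; split=> // q qs; apply/List.in_app_iff; left.
  by exists t; split=> // q /tL qL; apply/List.in_app_iff; right.
pose r := size L; pose v (i : 'I_r) := (nth (0, 0) L i).1; pose w (i : 'I_r) := (nth (0, 0) L i).2.
have [ws [wsg wsspan]] := finite_spanning_family (word_in g)
  (fun t => row_mx (compress v w (word1 t)) (compress v w (word2 t))).
have [bs [bsg hbs]] : exists bs : seq (V -> V), (forall b, List.In b bs -> g b) /\
    forall m, List.In m ms -> derived (fun x => List.In x bs) m.
  elim: ms hms {hL} => [|m ms ih] h; first by exists [::].
  have [|bs [bsg hbs]] := ih; first by move=> y yo; apply: h; right.
  have [cs [csg hcs]] := derived_finite (h m (or_introl erefl)).
  exists (cs ++ bs); split; first by move=> b /List.in_app_iff [/csg|/bsg].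
  by move=> y [<-|/hbs hy]; [apply: derived_mono hcs | apply: derived_mono hy] => x xs;
     apply/List.in_app_iff; [left | right].
(* This fixes how large N must be: [bs] makes the given elements brackets within N, the letters of
   [ws] decide orthogonality to all words, and the vectors of [L] support the corner. *)
have [|n [e [f [de hops hv hw]]]] := exists_model hbil hnd (ops := bs ++ flatten ws) (map fst L) (map snd L).
  move=> x /List.in_app_iff [/bsg/hgl//|].
  elim: ws wsg {wsspan} => //= t ws ih wsg /List.in_app_iff [xt|]; last by apply: ih => t' tt; apply: wsg; right.
  by apply: hgl; apply: (wsg t) => //; left.
have opflat t x : List.In t ws -> List.In x t -> in_op p e f x.
  move=> tw xt; apply: hops; apply/List.in_app_iff; right.
  elim: ws tw {wsg wsspan} => //= t' ws ih [->|tw]; apply/List.in_app_iff; [by left | by right; apply: ih].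
pose N a := g (op p e f a).
have lN : lie N by apply: pull_lie.
have hvi i : in_spanl p e f (v i).
  by apply: hv; apply: (List.in_map fst L); apply/In_mem; apply: mem_nth.
have hwi i : in_spanr p e f (w i).
  by apply: hw; apply: (List.in_map snd L); apply/In_mem; apply: mem_nth.
pose M0 := lspan (fun a => List.In (op p e f a) ms).
have msop m : List.In m ms -> exists a, m = op p e f a /\ brk N a.
  move=> /hbs; apply: derived_op => // x xb; exists (rho p e f x).
  have xop : in_op p e f x by apply: hops; apply/List.in_app_iff; left.
  by split=> //; rewrite /N -xop; apply: bsg.
have M0brk a : M0 a -> brk N a.
  apply; first exact: brk_sp.
  by move=> b /msop [b' [/(op_inj hbil de) ->]].
have M0corner a : M0 a -> corner e f v w (hat a).
  move=> Ma; apply: (Ma (fun a => corner e f v w (hat a))).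
    split; first by rewrite hat0; apply: sp0; exact: corner_sp.
    by move=> c a' b' h1 h2; rewrite hat_lin; case: (corner_sp e f v w) => _; apply.
  move=> b /[dup] bm /hL [s [hs sL]].
  suff [C hC] : exists C : 'M[K]_r, forall y, op p e f b y = \sum_i \sum_j (C i j * p y (w j)) *: v i.
    by have := corner_hat e f hC; rewrite opK.
  have {}hs y : op p e f b y = \sum_(q <- s) p y q.2 *: q.1 by apply: hs.
  suff [C hC] : exists C : 'M[K]_r, forall y, \sum_(q <- s) p y q.2 *: q.1 = \sum_i \sum_j (C i j * p y (w j)) *: v i.
    by exists C => y; rewrite hs.
  elim: s sL {hs} => [|q s ih] sL.
    exists 0 => y; rewrite big_nil big1 // => i _; rewrite big1 // => j _; by rewrite mxE mul0r scale0r.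
  have [|C hC] := ih; first by move=> q' qs; apply: sL; right.
  have /In_mem qL : List.In q L by apply: sL; left.
  have ql : (index q L < r)%N by rewrite index_mem.
  pose i0 := Ordinal ql.
  (* A tensor from [L] is a single pair (v i, w i), so only the diagonal entry at its index
     grows. *)
  exists (delta_mx i0 i0 + C) => y; rewrite big_cons hC.
  have -> : \sum_i \sum_j ((delta_mx i0 i0 + C) i j * p y (w j)) *: v i =
      \sum_i \sum_j (delta_mx i0 i0 i j * p y (w j)) *: v i + \sum_i \sum_j (C i j * p y (w j)) *: v i.
    rewrite -big_split; apply: eq_bigr => i _; rewrite -big_split; apply: eq_bigr => j _.
    by rewrite !mxE mulrDl scalerDl.
  congr (_ + _); rewrite (bigD1 i0) //= [X in _ + X]big1 ?addr0; last first.
    by move=> i ii; rewrite big1 // => j _; rewrite mxE (negbTE ii) mul0r scale0r.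
  rewrite (bigD1 i0) //= [X in _ + X]big1 ?addr0; last first.
    by move=> j jj; rewrite mxE (negbTE jj) andbF mul0r scale0r.
  by rewrite mxE !eqxx mul1r /v /w /= nth_index.
have alght a : alg (hats N) a -> exists c d, a = ht c d.
  move=> Aa; apply: (Aa (fun a => exists c d, a = ht c d)).
  - split; first by exists 0, 0; have := hat0 n; rewrite /hat oppr0.
    by move=> c _ _ [a1 [b1 ->]] [a2 [b2 ->]]; exists (c *: a1 + a2), (c *: b1 + b2); rewrite ht_lin.
  - by move=> _ _ [a1 [b1 ->]] [a2 [b2 ->]]; exists (a1 * a2), (b2 * b1); rewrite htM.
  - by move=> _ [c [_ ->]]; exists c, (- c).
have [] := @levi_subalgebra _ (@star n) (@star_lin n) (@starM n) (@starK n) (@star_tr n)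
   (hats N) (hats M0) (word_radical e f) (hats_lie lN) _ _ (word_radical_sp e f)
   (word_radical_l de) (word_radical_r de) (@word_radical_star _ e f) (word_radical_rad de) _.
- by move=> _ [a [_ ->]]; apply: star_hat.
- by move=> _ [a [/M0brk Ba ->]]; apply: brk_hats.
- move=> y hy; apply: (corner_radical de hvi hwi (ws := ws)) => //.
    by move=> t tw; split=> [|x xt]; [exact: wsg | exact: opflat xt].
  apply: hy; first exact: corner_sp.
  move=> z [[a [/M0corner Ma ->]]//|[_ [c [_ [[a [/M0corner ca ->]] [k [d [/alght [d1 [d2 ->]] ->]]] [b [/M0corner cb ->]] ->]]]]].
  have -> : k%:M + ht d1 d2 = ht (k%:M + d1) (k%:M + d2).
    have := ht_lin k 1 1 d1 d2; rewrite ht11 => h.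
    rewrite -[k%:M]mulr1 mxSl -h; congr ht; by rewrite -[k%:M]mulr1 mxSl.
  exact: corner_mid.
move=> Sh [lSh ShN MSh hSh].
have Shats y : Sh y -> exists a, y = hat a by move=> /ShN [[a [_ ->]] _]; exists a.
pose S a := Sh (hat a).
have spS : sp S.
  split; first by rewrite /S hat0; apply: sp0; case: lSh.
  by move=> c a b Sa Sb; rewrite /S hat_lin; case: lSh => -[_ h] _; apply: h.
have ShS y : Sh y -> hats S y by move=> Sy; have [a ea] := Shats y Sy; exists a; rewrite /S -ea.
exists n, e, f, S, (fun a => trrad (alg (hats N)) (hat a)); split=> //.
- split.
    by split=> // a b Sa Sb; rewrite /S hat_br; case: lSh => _; apply.
  move=> a /ShN [/hatsE Na /hats_brk/hatsE Ba]; split=> //.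
- move=> m /[dup] mm /msop [a [em Ba]]; exists a; split=> //.
  by apply: MSh; apply/hatsE; apply: lspan_in; rewrite -em.
- move=> I k lI hk a Ia Ba.
  have lhI := hats_lideal lI.
  suff h j : (forall y, dser j (hats I) y -> brk (hats N) y -> trrad (alg (hats N)) y) ->
      forall y, hats I y -> brk (hats N) y -> trrad (alg (hats N)) y.
    apply: (h k) => [y /hats_dser [b [/hk -> ->]] _||]; [|exact/hatsE|exact: brk_hats].
    by rewrite hat0; apply: sp0; exact: trrad_alg_sp.
  elim: j => //= j ih hj; apply: ih => y Dy.
  have lD := dser_ideal j lhI (hats_lie lN).
  apply: (abelian_ideal_rad (hats_lie lN) lD) => // x z Dx Dz.
  have [_ DN _] := lD.
  by apply: hj; [apply: brk_in | apply: brk_in; apply: (DN)].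
- move=> I k lI hk a Ia.
  have [_ IS _] := lI.
  have Sa : S a by apply: IS.
  have /ShN [_ /hats_brk/hatsE Ba] := Sa.
  apply: word_radical_orthogonal => //; first by apply: (brk_derived hbil de) Ba.
  apply: (hSh (hats I) k) => //; last exact/hatsE.
    have [h1 h2 h3] := hats_lideal lI; split=> //.
      by move=> y /h2 [b [Sb ->]].
    by move=> x y /ShS Sx; apply: h3.
  by move=> y /hats_dser [b [/hk Jb ->]].
Qed.
End LeviModel.

(** * Levi components *)

Section LeviComponents.
Variables (V W : lmodType K) (p : V -> W -> K).
Hypothesis hbil : bilinear_pairing p.
Hypothesis hnd : nondegenerate_pairing p.
Variable g : opset V.
Hypothesis hg : subalgebra g.
Hypothesis hgl : incl g (gl p).

Let glin x : g x -> oplinear x.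
Proof. by move=> /hgl [s hs]; apply: (rep_linear hbil hs). Qed.
Let gsub : subspace g. Proof. by case: hg. Qed.
Let gbr x y : g x -> g y -> g (opbr x y). Proof. by case: hg => _; apply. Qed.
Let derg x : derived g x -> g x. Proof. exact: derived_min. Qed.
Let dsub : subspace (derived g). Proof. exact: span_subspace. Qed.
Local Notation wo := (word_orthogonal p g).

Let wo_subspace : subspace wo.
Proof.
have [D0 [Da Ds]] := dsub; split; last split.
- split=> //; exists [::]; split; first by move=> y; rewrite big_nil.
  by move=> w _; rewrite !big_nil.
- move=> x y [dx [s [hs es]]] [dy [t [ht et]]]; split; first exact: Da.
  exists (s ++ t); split; first exact: repD.
  by move=> w gw; rewrite !big_cat /= es // et.
- move=> c x [dx [s [hs es]]]; split; first exact: Ds.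
  exists [seq (c *: q.1, q.2) | q <- s]; split; first exact: repZ.
  move=> w gw; rewrite !big_map.
  transitivity (\sum_(q <- s) c * p (word1 w q.1) q.2).
    by apply: eq_bigr => q _ /=; rewrite (oplinearZ _ _ (word1_linear glin gw)) pairingZl.
  rewrite -mulr_sumr es // mulr_sumr; apply: eq_bigr => q _ /=.
  by rewrite (oplinearZ _ _ (word2_linear glin gw)) pairingZl.
Qed.

Lemma rep_compr s t x y : rep p s x -> rep p t y ->
  rep p [seq (p z.1 q.2 *: q.1, z.2) | q <- s, z <- t] (fun u => x (y u)).
Proof.
move=> hx hy u; rewrite hx big_allpairs_dep; apply: eq_bigr => q _.
rewrite hy pairing_suml // scaler_suml; apply: eq_bigr => z _ /=.
by rewrite pairingZl // scalerA.
Qed.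

(** Tracing [y,x] against w is tracing x against w followed by y, minus y followed by w; the balance
    condition for x covers both words. *)
Let wo_ideal : ideal wo g.
Proof.
split; [exact: wo_subspace | split; first by move=> x [/derg]].
move=> y x gy [dx [s [hs es]]]; have gx := derg dx.
split; first exact: derived_in.
have [t ht] := hgl gy.
set s2 := [seq (p z.1 q.2 *: q.1, z.2) | q <- s, z <- t].
exists ([seq (y q.1, q.2) | q <- s] ++ [seq (-1 *: q.1, q.2) | q <- s2]); split.
  have -> : opbr y x = opadd (fun u => y (x u)) (opscale (-1) (fun u => x (y u))).
    by apply: op_ext => u; rewrite /opbr /opadd /opscale scaleN1r.
  by apply: repD; [apply: rep_compl => //; apply: glin | apply: repZ => //; apply: rep_compr].
have sumE u : oplinear u ->
    \sum_(q <- [seq (y q.1, q.2) | q <- s] ++ [seq (-1 *: q.1, q.2) | q <- s2]) p (u q.1) q.2 =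
    \sum_(q <- s) p (u (y q.1)) q.2 - \sum_(q <- s) p (y (u q.1)) q.2.
  move=> lu; rewrite big_cat !big_map /=; congr (_ + _).
  rewrite -sumrN /s2 big_allpairs_dep; apply: eq_bigr => q _.
  rewrite [y (u q.1)]ht pairing_suml // -sumrN; apply: eq_bigr => z _ /=.
  by rewrite !(oplinearZ _ _ lu) !pairingZl // mulN1r mulrC.
move=> w gw; rewrite !sumE; [|exact: word2_linear gw|exact: word1_linear gw].
have e1 := es (rcons w y) (word_in_rcons gw gy).
have e2 : \sum_(q <- s) p (y (word1 w q.1)) q.2 = \sum_(q <- s) p (- word2 w (y q.1)) q.2 := es (y :: w) (word_in_cons gw gy).
rewrite (eq_bigr (fun q => p (word1 (rcons w y) q.1) q.2)); last by move=> q _; rewrite word1_rcons.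
have e3 : \sum_(q <- s) p (word2 (rcons w y) q.1) q.2 = \sum_(q <- s) p (- y (word2 w q.1)) q.2.
  by apply: eq_bigr => q _; rewrite (word2_rcons glin).
rewrite e1 e3 e2.
have neg (u : V -> V) : \sum_(q <- s) p (- u q.1) q.2 = - \sum_(q <- s) p (u q.1) q.2.
  by rewrite -sumrN; apply: eq_bigr => q _; rewrite -scaleN1r pairingZl // mulN1r.
rewrite (neg (fun v => word2 w (y v))) opprK addrC.
by rewrite (neg (fun v => y (word2 w v))).
Qed.

Let wo_subalgebra : subalgebra wo.
Proof.
split; first exact: wo_subspace.
by move=> x y [/derg gx _] hy; case: wo_ideal => _ [_]; apply.
Qed.

(** On the one-letter word y the two sums are tr (x y) and - tr (x y), so tr (x y) = 0 for x in [wo]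
    and y in g, and Cartan's criterion applies. *)
Let wo_locally_solvable : locally_solvable wo.
Proof.
move=> l hl; have gwo x : gen l x -> wo x by apply=> //; exact: wo_subalgebra.
have [|n [e [f [de hop _ _]]]] := exists_model hbil hnd (ops := l) [::] [::].
  by move=> x /hl [/derg/hgl].
have gop x : gen l x -> in_op p e f x by apply; [exact: in_op_subalgebra | exact: hop].
apply: (traceless_solvable hbil de) => //; first exact: gen_subalgebra.
move=> x y /[dup] gnx /gwo [_ [s [hs es]]] /gwo [/derg gy _].
rewrite (trace_rep_indep hbil hnd de (gop x gnx) hs (glin gy)).
have := es [:: y]; set t := \sum_(q <- s) _ => /(_ _)/=.
have gyw : word_in g [:: y] by move=> z [<-|[]].
move=> /(_ gyw).
have -> : \sum_(q <- s) p (- y q.1) q.2 = - t.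
  by rewrite /t -sumrN; apply: eq_bigr => q _; rewrite -scaleN1r pairingZl // mulN1r.
move=> e2; have : t *+ 2 == 0 by rewrite mulr2n {1}e2 addNr.
by rewrite -mulr_natr mulf_eq0 cplx_char0 orbF => /eqP.
Qed.

Variables (l r : opset V).
Hypothesis al : subalgebra l.
Hypothesis lg : incl l g.
Hypothesis rr : locsolv_radical g r.
Hypothesis ldec : forall f, derived g f <-> exists a b, (r a /\ derived g a) /\ l b /\ f = opadd a b.
Hypothesis lint : forall f, r f -> derived g f -> l f -> f = @opzero V.

Let rid : ideal r g. Proof. by case: rr. Qed.
Let rsub : subspace r. Proof. by case: rid. Qed.
Let rg x : r x -> g x. Proof. by case: rid => _ [h _]; apply: h. Qed.
Let lsub : subspace l. Proof. by case: al. Qed.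

Lemma word_orthogonal_radical x : wo x -> r x.
Proof. by case: rr => _ [_ h]; apply: (h _ wo_ideal). Qed.

Lemma levi_derived b : l b -> derived g b.
Proof.
move=> lb; apply/ldec; exists (@opzero V), b; split; last first.
  by split=> //; apply: op_ext => x; rewrite /opadd /opzero add0r.
by split; [case: rsub | case: dsub].
Qed.

(** The projection of [g,g] onto l along r, kept as a relation. *)
Definition levi_part f b := [/\ derived g f, l b & r (opadd f (opscale (-1) b))].

Lemma levi_part_ex f : derived g f -> exists b, levi_part f b.
Proof.
move=> /[dup] df /ldec [a [b [[ra da] [lb ->]]]]; exists b; split=> //; first by apply/ldec; exists a, b.
by rewrite (_ : opadd _ _ = a) //; apply: op_ext => x; rewrite /opadd /opscale scaleN1r addrK.
Qed.
Lemma levi_part_uniq f b b' : levi_part f b -> levi_part f b' -> b = b'.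
Proof.
move=> [df lb rb] [_ lb' rb']; apply: opsub0.
have [_ _ _ rB] := subspaceP rsub; have [_ _ _ lB] := subspaceP lsub.
have lbb : l (opadd b (opscale (-1) b')) by apply: lB.
apply: lint => //; last exact: levi_derived.
have := rB _ _ rb' rb; rewrite (_ : opadd _ _ = opadd b (opscale (-1) b')) //.
apply: op_ext => x; rewrite /opadd /opscale !scaleN1r opprB [b x - _]addrC addrACA subrr add0r.
by rewrite addrC.
Qed.
Lemma levi_part_self b : l b -> levi_part b b.
Proof.
move=> lb; split=> //; first exact: levi_derived.
rewrite (_ : opadd _ _ = @opzero V); first by case: rsub.
by apply: op_ext => x; rewrite /opadd /opscale scaleN1r subrr.
Qed.
Lemma levi_part_lin c f b f' b' : levi_part f b -> levi_part f' b' ->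
  levi_part (opadd (opscale c f) f') (opadd (opscale c b) b').
Proof.
have [_ [dA dS]] := dsub; have [_ [lA lS]] := lsub; have [_ [rA rS]] := rsub.
move=> [df lb rb] [df' lb' rb']; split; [by apply: dA => //; apply: dS | by apply: lA => //; apply: lS |].
have := rA _ _ (rS c _ rb) rb'; rewrite (_ : opadd (opscale c _) _ = opadd (opadd (opscale c f) f') (opscale (-1) (opadd (opscale c b) b'))) //.
by apply: op_ext => x; rewrite /opadd /opscale !scaleN1r opprD scalerBr addrACA.
Qed.
Lemma levi_part0 : levi_part (@opzero V) (@opzero V).
Proof. by apply: levi_part_self; case: lsub. Qed.
Lemma levi_partZ c f b : levi_part f b -> levi_part (opscale c f) (opscale c b).
Proof. by move=> h; have := levi_part_lin c h levi_part0; rewrite !opadd0. Qed.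
Lemma levi_partD f b f' b' : levi_part f b -> levi_part f' b' -> levi_part (opadd f f') (opadd b b').
Proof. by move=> h h'; have := levi_part_lin 1 h h'; rewrite !opscale1. Qed.
Lemma levi_part_br f b f' b' : levi_part f b -> levi_part f' b' -> levi_part (opbr f f') (opbr b b').
Proof.
move=> [df lb rb] [df' lb' rb']; split; [by apply: derived_in; apply: derg | by case: al => _; apply |].
have [_ [_ rbr]] := rid; have [_ _ _ rB] := subspaceP rsub.
have := rB _ _ (rbr _ _ (lg lb) rb') (rbr _ _ (derg df') rb).
have lf := glin (derg df); have lf' := glin (derg df'); have lb1 := glin (lg lb); have lb1' := glin (lg lb').
rewrite (_ : opadd _ _ = opadd (opbr f f') (opscale (-1) (opbr b b'))) //.
apply: op_ext => x; rewrite /opadd /opscale /opbr.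
rewrite (oplinearD _ _ lb1) (oplinearD _ _ lf') (oplinearZ _ _ lb1) (oplinearZ _ _ lf') !scaleN1r.
move: (b (f' x)) (b (b' x)) (f' (b x)) (b' (b x)) (f' (f x)) (f (f' x)) => a1 a2 a3 a4 a5 a6.
have subrBB (a b0 c d : V) : (a - b0) - (c - d) = (a - c) - (b0 - d).
  by rewrite [in LHS]opprD addrACA [in RHS]opprD.
rewrite (subrBB a1) (subrBB a5) -(opprB a1 a3) opprK.
by rewrite [a1 - a3 - _]addrC [a5 - a6 + _]addrC addrKA addrC (opprB a5).
Qed.

(** The preimage in S0 of a solvable ideal of S has a derived ideal inside r. As r is solvable
    within the model, that derived ideal lies in J; hence the whole preimage is orthogonal to words,
    so it lies in r, where the projection to l vanishes. *)
Lemma levi_semisimple_cover (ms : seq (V -> V)) : (forall m, List.In m ms -> l m) ->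
  exists (S : opset V) (bs : seq (V -> V)),
    [/\ subalgebra S, semisimple S, incl S l, forall m, List.In m ms -> S m &
        (forall b, List.In b bs -> S b) /\ (forall b, S b -> span (fun x => List.In x bs) b)].
Proof.
move=> hms.
have [|n [e [f [S0 [J [de [lS S0g] msS hJ hI]]]]]] := exists_levi_model hbil hnd hg hgl (ms := ms).
  by move=> m /hms; apply: levi_derived.
have [S0sp S0b] := lS.
have dS a : S0 a -> derived g (op p e f a).
  by move=> /S0g [_ Ba]; apply: (brk_derived hbil de) Ba.
pose S b := exists a, S0 a /\ levi_part (op p e f a) b.
have Ssub : subalgebra S.
  split; first split; last first.
  - move=> x y [a [Sa ha]] [b [Sb hb]]; exists (br a b); split; first exact: S0b.
    by rewrite op_br //; apply: levi_part_br.
  - split=> [x y|c x] [a [Sa ha]].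
      by move=> [b [Sb hb]]; exists (a + b); split; [apply: (spD S0sp) | rewrite opD; apply: levi_partD].
    by exists (c *: a); split; [apply: (spZ _ S0sp) | rewrite opZ; apply: levi_partZ].
  - by exists 0; split; [apply: sp0 | rewrite op0; apply: levi_part0].
have [U hU] := sp_vspace S0sp.
have [beta hbeta] : exists beta : 'M[K]_n -> V -> V, forall a, a \in U -> levi_part (op p e f a) (beta a).
  have /dep_choice [beta h] : forall a : 'M[K]_n, exists b, a \in U -> levi_part (op p e f a) b.
    move=> a; case: (boolP (a \in U)) => [/hU/dS/levi_part_ex [b hb]|_]; last by exists (op p e f a).
    by exists b.
  by exists beta.
exists S, [seq beta a | a <- vbasis U]; split=> //.
- move=> I [Isub [IS Ibr]] [k hk] x Ix.
  pose I0 a := S0 a /\ exists b, I b /\ levi_part (op p e f a) b.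
  have [Iz [Ia Is]] := Isub.
  have I0sp : sp I0.
    split; first by split; [apply: sp0 | exists (@opzero V); rewrite op0; split=> //; apply: levi_part0].
    move=> c a a' [Sa [b [Ib hb]]] [Sa' [b' [Ib' hb']]]; split; first by case: S0sp => _; apply.
    exists (opadd (opscale c b) b'); rewrite op_lin; split; last exact: levi_part_lin.
    by apply: (Ia) => //; apply: Is.
  have lI0 : lideal I0 S0.
    split=> // [a []//|a a' Sa [Sa' [b' [Ib' hb']]]]; split; first exact: S0b.
    have [b hb] := levi_part_ex (dS a Sa).
    exists (opbr b b'); rewrite op_br //; split; last exact: levi_part_br.
    by apply: Ibr => //; exists a.
  have dser_part j a : dser j I0 a -> S0 a /\ exists b, derived_series j I b /\ levi_part (op p e f a) b.
    elim: j a => [|j ih] a //=.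
    pose Q a := S0 a /\ exists b, derived (derived_series j I) b /\ levi_part (op p e f a) b.
    have [D0 [Da Ds]] := span_subspace (fun h => exists a b : V -> V, derived_series j I a /\ derived_series j I b /\ h = opbr a b).
    apply: (brk_sub (P := Q)).
      split; first by split; [apply: sp0 | exists (@opzero V); rewrite op0; split=> //; apply: levi_part0].
      move=> c u u' [Su [b [Ib hb]]] [Su' [b' [Ib' hb']]]; split; first by case: S0sp => _; apply.
      exists (opadd (opscale c b) b'); rewrite op_lin; split; last exact: levi_part_lin.
      by apply: (Da) => //; apply: Ds.
    move=> u u' /ih [Su [b [Db hb]]] /ih [Su' [b' [Db' hb']]]; split; first exact: S0b.
    by exists (opbr b b'); rewrite op_br //; split; [apply: derived_in | apply: levi_part_br].
  have rJ a : r (op p e f a) -> S0 a -> J a.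
    move=> ra Sa; pose T y := r y /\ in_op p e f y.
    have [r0 [rA rS]] := rsub; have [o0 [oA oS]] := in_op_subspace hbil de.
    have Tsub : subspace T.
      split; first by split.
      split=> [y z [? ?] [? ?]|c y [? ?]]; first by split; [apply: rA | apply: oA].
      by split; [apply: rS | apply: oS].
    have [k' hk'] : solvable T.
      exact: (locally_solvable_solvable (proj1 (proj2 rr)) Tsub (fun y h => proj1 h) (fun y h => proj2 h)).
    apply: (hJ (fun a => r (op p e f a)) k') => //; last by case: (S0g a Sa).
      split; first exact: pull_sp.
        by move=> y; apply: rg.
      by move=> y z gy rz; rewrite op_br //; case: rid => _ [_]; apply.
    move=> y Dy; apply: (op_inj hbil de); rewrite op0; apply: hk'.
    apply: (dser_derived_series hbil de) Dy => z rz; split=> //; exact: in_op_op.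
  have [a [Sa ha]] := IS x Ix.
  have woa : wo (op p e f a).
    apply: (hI I0 k) => //; last by split=> //; exists x.
    move=> y /dser_part [Sy [b [Db [_ _ rb]]]]; apply: rJ => //.
    move: rb; rewrite (hk b Db) (_ : opadd _ _ = op p e f y) //.
    by apply: op_ext => z; rewrite /opadd /opscale /opzero scaler0 addr0.
  have r0 : levi_part (op p e f a) (@opzero V).
    split; [exact: dS | by case: lsub |].
    rewrite (_ : opadd _ _ = op p e f a); first exact: word_orthogonal_radical.
    by apply: op_ext => z; rewrite /opadd /opscale /opzero scaler0 addr0.
  exact: levi_part_uniq ha r0.
- by move=> b [a [_ [_ lb _]]].
- by move=> m /[dup] /hms lm /msS [a [em Sa]]; exists a; rewrite -em; split=> //; apply: levi_part_self.
split.
  move=> b /List.in_map_iff [a [<- /In_mem aU]].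
  by have aU' := vbasis_mem aU; exists a; split; [apply/hU | apply: hbeta].
move=> b [a [/hU aU hb]].
set bs := [seq beta a | a <- vbasis U].
have [s0 [sA sS]] := span_subspace (fun x => List.In x bs).
pose P a := exists b, levi_part (op p e f a) b /\ span (fun x => List.In x bs) b.
suff [b' [hb' sb']] : P a by rewrite (levi_part_uniq hb hb').
have Psp : sp P.
  split; first by exists (@opzero V); rewrite op0; split=> //; apply: levi_part0.
  move=> c u u' [x [hx sx]] [x' [hx' sx']]; exists (opadd (opscale c x) x').
  by rewrite op_lin; split; [apply: levi_part_lin | apply: (sA) => //; apply: sS].
rewrite (coord_vbasis aU); apply: sp_sum => // i _; apply: spZ => //.
have iU : (vbasis U)`_i \in vbasis U by apply: mem_nth; rewrite size_tuple.
exists (beta (vbasis U)`_i); split; first by apply: hbeta; apply: vbasis_mem.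
by apply: span_in; apply: (List.in_map beta); apply/In_mem.
Qed.

Hypothesis hV : countable_dim V.
Hypothesis hW : countable_dim W.

Lemma levi_locally_semisimple : locally_semisimple l.
Proof.
have [eV heV] := hV; have [eW heW] := hW.
(* The tensors of the first n vectors of the two spanning sequences: finite-dimensional spaces that
   exhaust gl. *)
pose phi n (c : 'M[K]_n) : V -> V := fun x => \sum_(i < n) \sum_(j < n) (c i j * p x (eW j)) *: eV i.
have phi_lin n c (a b : 'M[K]_n) : phi n (c *: a + b) = opadd (opscale c (phi n a)) (phi n b).
  apply: op_ext => x; rewrite /opadd /opscale /phi scaler_sumr -big_split; apply: eq_bigr => i _.
  rewrite scaler_sumr -big_split; apply: eq_bigr => j _.
  by rewrite !mxE mulrDl scalerDl scalerA mulrA.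
have widen m n (c : 'M[K]_m) : (m <= n)%N -> exists d : 'M[K]_n, phi n d = phi m c.
  move=> mn.
  pose c' (i j : nat) : K := if (insub i : option 'I_m) is Some i' then
      (if (insub j : option 'I_m) is Some j' then c i' j' else 0) else 0.
  have c'E (i j : 'I_m) : c' i j = c i j by rewrite /c' !valK.
  exists (\matrix_(i, j) c' i j); apply: op_ext => x; rewrite /phi.
  transitivity (\sum_(i < n) \sum_(j < n) (c' i j * p x (eW j)) *: eV i).
    by apply: eq_bigr => i _; apply: eq_bigr => j _; rewrite mxE.
  rewrite -(big_mkord xpredT (fun i => \sum_(j < n) (c' i j * p x (eW j)) *: eV i)) (big_cat_nat (leq0n m) mn) //=.
  rewrite [X in _ + X]big_nat_cond [X in _ + X]big1 ?addr0; last first.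
    move=> i /andP [/andP [mi _] _]; rewrite big1 // => j _.
    by rewrite /c' insubF ?mul0r ?scale0r // ltnNge mi.
  rewrite big_mkord; apply: eq_bigr => i _.
  rewrite -(big_mkord xpredT (fun j => (c' i j * p x (eW j)) *: eV i)) (big_cat_nat (leq0n m) mn) //=.
  rewrite [X in _ + X]big_nat_cond [X in _ + X]big1 ?addr0; last first.
    move=> j /andP [/andP [mj _] _].
    by rewrite /c' valK insubF ?mul0r ?scale0r // ltnNge mj.
  by rewrite big_mkord; apply: eq_bigr => j _; rewrite c'E.
have gl_phi x : gl p x -> exists n (c : 'M[K]_n), x = phi n c.
  move=> [s hs]; have -> : x = fun y => \sum_(q <- s) p y q.2 *: q.1 by apply: op_ext.
  elim: s {hs} => [|[v w] s [n [c ih]]].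
    by exists 0%N, 0; apply: op_ext => y; rewrite big_nil /phi big_ord0.
  have [m [d hd]] : exists m (d : 'M[K]_m), (fun y => p y w *: v) = phi m d.
    have [nv [a ea]] := heV v; have [nw [b eb]] := heW w.
    have ext (L : lmodType K) (k k' : nat) (cf : nat -> K) (e : nat -> L) : (k <= k')%N ->
        \sum_(i < k) cf i *: e i = \sum_(i < k') (if (i < k)%N then cf i else 0) *: e i.
      move=> kk; rewrite (big_ord_widen k' (fun i => cf i *: e i) kk) big_mkcond.
      by apply: eq_bigr => i _; case: ifP => // _; rewrite scale0r.
    pose m := maxn nv nw.
    exists m, (\matrix_(i, j) ((if (i < nv)%N then a i else 0) * (if (j < nw)%N then b j else 0))).
    apply: op_ext => y; rewrite ea eb (ext _ nv m) ?leq_maxl // (ext _ nw m) ?leq_maxr //.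
    rewrite scaler_sumr; apply: eq_bigr => i _.
    rewrite pairing_sumr // scalerA mulr_suml scaler_suml; apply: eq_bigr => j _.
    by rewrite mxE pairingZr //; congr (_ *: _); ring.
  have [d' hd'] := widen m (maxn m n) d (leq_maxl _ _).
  have [c' hc'] := widen n (maxn m n) c (leq_maxr _ _).
  exists (maxn m n), (1 *: d' + c'); rewrite phi_lin hd' hc' opscale1 -hd -ih.
  by apply: op_ext => y; rewrite big_cons.
have /dep_choice [b hb] n : exists bs : seq (V -> V), (forall x, List.In x bs -> l x) /\
    forall c : 'M[K]_n, l (phi n c) -> span (fun x => List.In x bs) (phi n c).
  exact: finite_basis.
have /dep_choice [G hG] : forall ms : seq (V -> V), exists Sb : opset V * seq (V -> V), (forall m, List.In m ms -> l m) ->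
    [/\ subalgebra Sb.1, semisimple Sb.1, incl Sb.1 l, forall m, List.In m ms -> Sb.1 m &
        (forall b, List.In b Sb.2 -> Sb.1 b) /\ (forall b, Sb.1 b -> span (fun x => List.In x Sb.2) b)].
  move=> ms; case: (classic (forall m, List.In m ms -> l m)) => [h|h]; last by exists (l, [::]).
  by have [S [bs h']] := levi_semisimple_cover h; exists (S, bs).
(* The spanning list of the previous algebra makes the chain increase; [b k] makes it exhaust l. *)
pose M := fix M k : seq (V -> V) := if k is k'.+1 then (G (M k')).2 ++ b k' else [::].
have MSE k : M k.+1 = (G (M k)).2 ++ b k by [].
have Ml k m : List.In m (M k) -> l m.
  elim: k m => [|k ih] m; first by [].
  rewrite MSE => /List.in_app_iff [|]; last by case: (hb k) => h _; apply: h.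
  by have [_ _ Sl _ [hb' _]] := hG (M k) ih => /hb'; apply: Sl.
pose F k := (G (M k)).1.
have Fok k := hG (M k) (Ml k).
have FS k : incl (F k) (F k.+1).
  move=> x; have [_ _ _ _ [_ hs]] := Fok k; have [[sF _] _ _ hM _] := Fok k.+1.
  move=> /hs; apply: (span_min (Q := F k.+1)) => // y yb; apply: hM; rewrite MSE.
  by apply/List.in_app_iff; left.
have Fmono i j : (i <= j)%N -> incl (F i) (F j).
  by move=> /subnK <-; elim: (j - i)%N => [|k ih] x //; rewrite addSn => /ih; apply: FS.
exists nat, F; split; last split.
- move=> k; have [h1 h2 _ _ [h3 h4]] := Fok k; split=> //; split=> //.
  by exists (G (M k)).2.
- by move=> i j; case: (leqP i j) => h; [left | right]; apply: Fmono => //; apply: ltnW.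
- move=> x; split; last by move=> [k Fx]; have [_ _ Sl _ _] := Fok k; apply: Sl.
  move=> lx; have [n [c ex]] := gl_phi x (hgl (lg lx)); exists n.+1.
  have [[sF _] _ _ hM _] := Fok n.+1.
  have [_ hbn] := hb n; have := hbn c; rewrite -ex => /(_ lx).
  apply: (span_min (Q := F n.+1)) => // y yb; apply: hM; rewrite MSE.
  by apply/List.in_app_iff; right.
Qed.

Lemma levi_maximal m : subalgebra m -> incl m g -> locally_semisimple m -> incl l m -> incl m l.
Proof.
move=> [msub mbr] mg [I [F [hF [chain hm]]]] lm x mx.
have Fm j : incl (F j) m by move=> y Fy; apply/hm; exists j.
have [j Fjx] := (proj1 (hm x)) mx.
have [aF [fF sF]] := hF j.
have dx : derived g x.
  have /(_ x Fjx) := semisimple_perfect hbil hnd aF fF sF (fun y h => hgl (mg _ (Fm j y h))).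
  by apply: derived_mono => y /Fm/mg.
have [b hb] := levi_part_ex dx; have [_ lb rb] := hb.
have [_ _ _ mB] := subspaceP msub.
set a := opadd x (opscale (-1) b) in rb.
have ma : m a by apply: mB => //; apply: lm.
have [k Fka] := (proj1 (hm a)) ma.
have [[[sF0 [sFa sFs]] bF] [fFk sFk]] := hF k.
suff a0 : a = @opzero V by rewrite (opsub0 a0).
pose T y := r y /\ F k y.
have [r0 [rA rS]] := rsub.
have Tsub : subspace T.
  split; first by split.
  split=> [y z [? ?] [? ?]|c y [? ?]]; first by split; [apply: rA | apply: sFa].
  by split; [apply: rS | apply: sFs].
have [n [e [f [de Fop]]]] := fin_dim_model hbil hnd fFk (fun y h => hgl (mg _ (Fm k y h))).
apply: (sFk T) => //.
  split=> //; split; first by move=> y [].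
  move=> y z Fy [rz Fz]; split; last exact: bF.
  by case: rid => _ [_]; apply=> //; apply: mg; apply: Fm Fy.
exact: (locally_solvable_solvable (proj1 (proj2 rr)) Tsub (fun y h => proj1 h) (fun y h => Fop y (proj2 h))).
Qed.
End LeviComponents.

Theorem theorem4p3 (V W : lmodType cplx) (p : V -> W -> cplx)
  (hbil : bilinear_pairing p) (hnd : nondegenerate_pairing p)
  (hV : countable_dim V) (hW : countable_dim W)
  (g : opset V) (hg : subalgebra g) (hgl : incl g (gl p)) :
  (forall l : opset V, levi_component g l -> maximal_locally_semisimple g l) /\
  (forall l1 l2 : opset V, levi_component g l1 -> levi_component g l2 ->
     lie_isomorphic l1 l2).
Proof.
split.
  move=> l [al [lg [r [rr [ldec lint]]]]]; split=> //; split=> //; split.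
    exact: (levi_locally_semisimple hbil hnd hg hgl al lg rr ldec lint hV hW).
  move=> m am mg ms lm; exact: (levi_maximal hbil hnd hgl rr ldec am mg ms lm).
move=> l1 l2 [al1 [lg1 [r1 [rr1 [ldec1 lint1]]]]] [al2 [lg2 [r2 [rr2 [ldec2 lint2]]]]].
have er : r1 = r2.
  have [i1 [s1 m1]] := rr1; have [i2 [s2 m2]] := rr2.
  by apply: functional_extensionality => x; apply: propositional_extensionality; split; [apply: m2 | apply: m1].
subst r2.
(* Congruence modulo r is symmetric, so the projections between l1 and l2 invert each other; this
   yields injectivity. *)
have lin f b : l1 f -> levi_part g l2 r1 f b -> levi_part g l1 r1 b f.
  move=> l1f [df l2b rb]; split=> //; first exact: (levi_derived rr2 ldec2).
  have [[_ [_ rs]] _] := proj1 rr1.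
  have := rs (-1) _ rb; rewrite (_ : opscale _ _ = opadd b (opscale (-1) f)) //.
  by apply: op_ext => x; rewrite /opscale /opadd !scaleN1r opprB addrC.
have l1d f : l1 f -> derived g f by apply: (levi_derived rr1 ldec1).
have /dep_choice [phi hphi] : forall f, exists b, l1 f -> levi_part g l2 r1 f b.
  move=> f; case: (classic (l1 f)) => [/l1d df|nf]; last by exists f.
  by have [b hb] := levi_part_ex ldec2 df; exists b.
have uniq2 := @levi_part_uniq _ _ _ _ al2 rr2 ldec2 lint2.
exists phi; split; first by move=> f /hphi [].
have [[_ [l1a l1s]] l1b] := al1.
split; first by move=> f h l1f l1h; apply: (uniq2 (opadd f h)); [apply: hphi; apply: l1a |
   apply: (levi_partD al2 rr2); apply: hphi].
split.
  move=> c f l1f; apply: (uniq2 (opscale c f)); first by apply: hphi; apply: l1s.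
  by apply: (levi_partZ al2 rr2 ldec2); apply: hphi.
split.
  move=> f h l1f l1h; apply: (uniq2 (opbr f h)); first by apply: hphi; apply: l1b.
  by apply: (levi_part_br hbil hg hgl al2 lg2 rr2); apply: hphi.
split.
  move=> f h l1f l1h e; have h1 := lin _ _ l1f (hphi f l1f); have h2 := lin _ _ l1h (hphi h l1h).
  by rewrite e in h1; exact: (levi_part_uniq al1 rr1 ldec1 lint1 h1 h2).
move=> h l2h.
have [f hf] := levi_part_ex ldec1 (levi_derived rr2 ldec2 l2h).
have [_ l1f _] := hf; exists f; split=> //.
apply: (uniq2 f); first exact: hphi.
have [_ _ rf] := hf; split=> //; first exact: l1d.
have [[_ [_ rs]] _] := proj1 rr1.
have := rs (-1) _ rf; rewrite (_ : opscale _ _ = opadd f (opscale (-1) h)) //.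
by apply: op_ext => x; rewrite /opscale /opadd !scaleN1r opprB addrC.
Qed.
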